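(* Let $K$ be a compact set in $\mathbb R^3$. A point $p\in\mathbb R^3$ belongs to the minimal hull $\widehat K_{\mathfrak M}$ of $K$ if and only if there exists a null positive current $T$ on $\mathbb C^3$ of finite mass such that $\pi(\mathrm{supp}\,T)\subset\mathbb R^3$ is a bounded set and $dd^cT=\mu-\delta_p$, where $\mu$ is a probability measure on the tube $\mathcal T_K=K\times i\mathbb R^3\subset\mathbb C^3$ and $\delta_p$ is the point mass at $p$.
   Context: $\mathbb R^3$ is the standard real subspace of $\mathbb C^3$, and $\pi\colon\mathbb C^3\to\mathbb R^3$ is the projection $\pi(x+iy)=x$. Subharmonic functions are allowed to be identically $-\infty$. An upper semicontinuous function $u\colon\omega\to\mathbb R\cup\{-\infty\}$ on a domain $\omega\subset\mathbb R^n$ ($n\ge3$) is minimal plurisubharmonic if its restriction to any affine $2$-dimensional plane $L\subset\mathbb R^n$ is subharmonic on $L\cap\omega$ in any isothermal linear coordinates on $L$ (coordinates $(y_1,y_2)$ given by $x=a+y_1v_1+y_2v_2$ with $a\in L$ and $v_1,v_2$ orthogonal of equal nonzero length); the set of such functions is $\mathfrak M\mathrm{Psh}(\omega)$. The minimal hull of a compact set $K\subset\mathbb R^n$ is $\widehat K_{\mathfrak M}=\{x\in\mathbb R^n: u(x)\le\sup_K u\ \ \forall u\in\mathfrak M\mathrm{Psh}(\mathbb R^n)\}$. Let $\mathfrak A^*=\{z\in\mathbb C^3\setminus\{0\}: z_1^2+z_2^2+z_3^2=0\}$ (null vectors). A (real) $2$-form $\alpha$ on $\mathbb C^3$ is null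 positive if $\langle\alpha(q),\nu\wedge J\nu\rangle\ge0$ for every point $q$ and every $\nu\in\mathfrak A^*$ (identified with a tangent vector in $T_q\mathbb C^3$), where $J$ is the standard complex structure operator. A null positive current on $\mathbb C^3$ is a current $T$ of bidimension $(1,1)$ such that $T(\alpha)\ge0$ for every null positive $2$-form $\alpha$ with compact support. $d^c=i(\overline\partial-\partial)$, so $dd^c=2i\partial\overline\partial$, and $dd^cT$ is defined by $(dd^cT)(u)=T(dd^cu)$ for test functions $u$. *)

(* Defs.v *)
From HB Require Import structures.
From mathcomp Require Import all_boot all_order all_algebra.
From mathcomp Require Import all_classical all_reals all_analysis.
From mathcomp Require Import complex ring.

Set Implicit Arguments.
Unset Strict Implicit.
Unset Printing Implicit Defensive.

Import Order.TTheory GRing.Theory Num.Theory.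
Import numFieldNormedType.Exports.

Local Open Scope classical_set_scope.
Local Open Scope ring_scope.

Definition dotv (R : realType) (n : nat) (v w : 'rV[R]_n) : R :=
  \sum_i v ord0 i * w ord0 i.

Definition enorm (R : realType) (n : nat) (v : 'rV[R]_n) : R :=
  Num.sqrt (dotv v v).

(** * Minimal plurisubharmonic functions and minimal hulls

A function with values in [R \cup {-oo}] is a total [\bar R]-valued function
that avoids [+oo] on its domain; its values off the domain are irrelevant. *)

Definition usc_on (R : realType) (X : topologicalType) (D : set X)
    (u : X -> \bar R) : Prop :=
  forall x, D x -> forall a : R, (u x < a%:E)%E ->
    \forall y \near within D (nbhs x), (u y < a%:E)%E.

Definition closed_disc (R : realType) (c : R * R) (r : R) : set (R * R) :=
  [set y | (y.1 - c.1) ^+ 2 + (y.2 - c.2) ^+ 2 <= r ^+ 2].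

(* An upper semicontinuous function with values below [+oo] is bounded above
   on each circle, so its extended-real integral there is meaningful (possibly
   [-oo]).  The constant [-oo] is subharmonic. *)
Definition subharmonic (R : realType) (D : set (R * R))
    (f : R * R -> \bar R) : Prop :=
  [/\ forall y, D y -> f y != +oo%E,
      usc_on D f
    & forall (c : R * R) (r : R), 0 < r -> closed_disc c r `<=` D ->
      (f c <= ((2 * pi)^-1)%:E *
         \int[lebesgue_measure]_(t in (`[0%R, (2 * pi)%R] : set R))
            f (c.1 + r * cos t, c.2 + r * sin t)%R)%E].

Definition plane_param (R : realType) (n : nat) (a v1 v2 : 'rV[R]_n)
    (y : R * R) : 'rV[R]_n :=
  a + y.1 *: v1 + y.2 *: v2.

Definition isothermal (R : realType) (n : nat) (v1 v2 : 'rV[R]_n) : Prop :=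
  [/\ dotv v1 v2 = 0, enorm v1 = enorm v2 & enorm v1 != 0].

Definition minimal_psh (R : realType) (n : nat) (omega : set 'rV[R]_n)
    (u : 'rV[R]_n -> \bar R) : Prop :=
  [/\ forall x, omega x -> u x != +oo%E,
      usc_on omega u
    & forall a v1 v2 : 'rV[R]_n, isothermal v1 v2 ->
      subharmonic (plane_param a v1 v2 @^-1` omega)
                  (u \o plane_param a v1 v2)].

Definition minimal_hull (R : realType) (n : nat) (K : set 'rV[R]_n) :
    set 'rV[R]_n :=
  [set x | forall u, minimal_psh [set: 'rV[R]_n] u ->
     (u x <= ereal_sup (u @` K))%E].

(** * The complex space of dimension three

The row vector [row_mx x y] stands for [z = x + iy]. *)

Notation C3 R := ('rV[R]_(3 + 3)).

Section ComplexSpace.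
Variable R : realType.
Implicit Types (x : 'rV[R]_3) (q v w : C3 R).

Definition re_part q : 'rV[R]_3 := lsubmx q.
Definition im_part q : 'rV[R]_3 := rsubmx q.
Definition real_pt x : C3 R := row_mx x 0.

Definition zcoord q (j : 'I_3) : R[i] :=
  Complex (re_part q ord0 j) (im_part q ord0 j).

Definition Jmap v : C3 R := row_mx (- im_part v) (re_part v).

Lemma zcoord_Jmap v j : zcoord (Jmap v) j = 'i%C * zcoord v j.
Proof.
by rewrite /zcoord /Jmap /re_part /im_part row_mxKl row_mxKr mxE; simpc.
Qed.

Definition null_vector v : Prop :=
  v != 0 /\ \sum_(j < 3) zcoord v j ^+ 2 = 0.

Definition tube (K : set 'rV[R]_3) : set (C3 R) := re_part @^-1` K.

Definition ebase (k : 'I_(3 + 3)) : C3 R := delta_mx ord0 k.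

(** * Test functions and forms *)

Definition pderivs (s : seq 'I_(3 + 3)) (f : C3 R -> R) : C3 R -> R :=
  foldr (fun k (g : C3 R -> R) q => 'D_(ebase k) (g : C3 R -> R^o) q) f s.

Definition smooth (f : C3 R -> R) : Prop :=
  forall s : seq 'I_(3 + 3),
    continuous (pderivs s f) /\
    forall k q, derivable (pderivs s f : C3 R -> R^o) q (ebase k).

Definition supp (V : zmodType) (f : C3 R -> V) : set (C3 R) :=
  closure [set q | f q != 0].

Definition test_function (u : C3 R -> R) : Prop :=
  smooth u /\ compact (supp u).

(* A 2-form [\sum_(j < k) a_jk dt_j /\ dt_k], in the real coordinates
   [t = (x, y)], is encoded by its skew-symmetric coefficient matrix, so that
   its value on the bivector [v /\ w] is [\sum_(j, k) a_jk v_j w_k]. *)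
Definition two_form := C3 R -> 'M[R]_(3 + 3).

Definition pairing (A : 'M[R]_(3 + 3)) v w : R := (v *m A *m w^T) ord0 ord0.

Definition test_form (alpha : two_form) : Prop :=
  [/\ forall q, (alpha q)^T = - alpha q,
      forall j k, smooth (fun q => alpha q j k)
    & compact (supp alpha)].

Definition null_positive_form (alpha : two_form) : Prop :=
  forall q v, null_vector v -> 0 <= pairing (alpha q) v (Jmap v).

(* Real forms in the sum of the bidegrees (2,0) and (0,2). *)
Definition bidegree_20_02 (alpha : two_form) : Prop :=
  forall q v w, pairing (alpha q) (Jmap v) (Jmap w) = - pairing (alpha q) v w.

(** * The operator [dd^c] *)

Definition dx (u : C3 R -> R) (j : 'I_3) q : R :=
  'D_(ebase (lshift 3 j)) (u : C3 R -> R^o) q.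
Definition dy (u : C3 R -> R) (j : 'I_3) q : R :=
  'D_(ebase (rshift 3 j)) (u : C3 R -> R^o) q.

(* Coefficients of [\partial u = \sum_j u_(z_j) dz_j] and
   [\bar\partial u = \sum_j u_(\bar z_j) d\bar z_j]. *)
Definition del_coef (u : C3 R -> R) (j : 'I_3) q : R[i] :=
  ((dx u j q)%:C%C - 'i%C * (dy u j q)%:C%C) / 2.
Definition delbar_coef (u : C3 R -> R) (j : 'I_3) q : R[i] :=
  ((dx u j q)%:C%C + 'i%C * (dy u j q)%:C%C) / 2.

Definition del (u : C3 R -> R) q v : R[i] :=
  \sum_(j < 3) del_coef u j q * zcoord v j.
Definition delbar (u : C3 R -> R) q v : R[i] :=
  \sum_(j < 3) delbar_coef u j q * conjc (zcoord v j).

Definition dc (u : C3 R -> R) q v : R[i] :=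
  'i%C * (delbar u q v - del u q v).

Lemma dcE (u : C3 R -> R) q v :
  dc u q v = (\sum_(j < 3) (dx u j q * im_part v ord0 j -
                            dy u j q * re_part v ord0 j))%:C%C.
Proof.
rewrite /dc /delbar /del rmorph_sum -sumrB mulr_sumr; apply: eq_bigr => j _.
have i2 : 'i%C * 'i%C = -1 :> R[i] by rewrite -expr2 sqr_i.
have zE : zcoord v j =
    (re_part v ord0 j)%:C%C + 'i%C * (im_part v ord0 j)%:C%C.
  by rewrite /zcoord; simpc.
have zcE : conjc (zcoord v j) =
    (re_part v ord0 j)%:C%C - 'i%C * (im_part v ord0 j)%:C%C.
  by rewrite /zcoord; simpc.
rewrite /delbar_coef /del_coef zcE zE rmorphB !rmorphM /=.
set x := (_%:C)%C; set y := (_%:C)%C; set a := (_%:C)%C; set b := (_%:C)%C.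
transitivity ('i%C * 'i%C * (y * a - x * b)); last first.
  by rewrite i2; ring.
by field.
Qed.

(* The exterior derivative of the real 1-form [d^c u]; see [dcE]. *)
Definition ddc (u : C3 R -> R) : two_form := fun q =>
  \matrix_(j, k)
    ('D_(ebase j) ((fun q' => complex.Re (dc u q' (ebase k))) : C3 R -> R^o) q -
     'D_(ebase k) ((fun q' => complex.Re (dc u q' (ebase j))) : C3 R -> R^o) q).

(** * Currents

A current is represented by a total functional of which only the values on
test forms matter. *)

Definition functional := two_form -> R.

(* Continuity for the usual inductive limit topology on test forms. *)
Definition current (T : functional) : Prop :=
  (forall (a : R) (alpha beta : two_form), test_form alpha -> test_form beta ->
     T (fun q => a *: alpha q + beta q) = a * T alpha + T beta) /\
  (forall L : set (C3 R), compact L ->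
     exists (N : nat) (C : R), forall (alpha : two_form) (M : R),
       test_form alpha -> supp alpha `<=` L ->
       (forall s : seq 'I_(3 + 3), (size s <= N)%N -> forall j k q,
          `|pderivs s (fun q' => alpha q' j k) q| <= M) ->
       `|T alpha| <= C * M).

Definition bidimension_11 (T : functional) : Prop :=
  forall alpha, test_form alpha -> bidegree_20_02 alpha -> T alpha = 0.

Definition null_positive_current (T : functional) : Prop :=
  [/\ current T, bidimension_11 T
    & forall alpha, test_form alpha -> null_positive_form alpha -> 0 <= T alpha].

Definition comass_le1 (A : 'M[R]_(3 + 3)) : Prop :=
  forall v w, enorm v <= 1 -> enorm w <= 1 -> `|pairing A v w| <= 1.

Definition mass (T : functional) : \bar R :=
  ereal_sup [set (T alpha)%:E | alpha in
    [set alpha | test_form alpha /\ forall q, comass_le1 (alpha q)]].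

Definition current_supp (T : functional) : set (C3 R) :=
  [set q | forall U, open U -> U q ->
     exists alpha, [/\ test_form alpha, supp alpha `<=` U & T alpha != 0]].

End ComplexSpace.

Notation borelC3 R := (g_sigma_algebraType (@open (C3 R))).

(* The equation [dd^c T = mu - delta_p], tested on test functions. *)
Definition ddc_current_eq (R : realType) (T : functional R)
    (mu : probability (borelC3 R) R) (p : 'rV[R]_3) : Prop :=
  forall u : C3 R -> R, test_function u ->
    ((T (ddc u))%:E = \int[mu]_q (u q)%:E
                    - \int[\d_(real_pt p : borelC3 R)]_q (u q)%:E)%E.

(* Main.v *)
(** The identity behind both directions is that [dd^c u], paired with the bivector
[v /\ J v], is the sum of the second derivatives of [u] along [v] and [J v]; for
a function of [x = Re z] and a null vector [v] this is the Laplacian on a plane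
of R^3 in isothermal coordinates.

From the hull to a current: on pairs of a 2-form [alpha] and a function [f], let
[P (alpha, f)] be the infimum of [w p] over functions [w], sums of test functions,
multiples of [|y|^2] and smooth functions of [x], such that [dd^c w + alpha <= 0]
on null vectors and [f <= w] on the tube.  It is sublinear and [P 0 = 0]: the
infimum of [w] over the fibres [x + i R^3] is the opposite of a minimal
plurisubharmonic function.  A linear functional below [P] (Hahn-Banach) splits
into the current and, by Riesz representation, the measure; particular choices of
[w] bound the mass and the support and give tightness.

From a current to the hull: if [u] is minimal plurisubharmonic and [u p] exceeds
its supremum on [K], a sup-convolution makes [u] Lipschitz and a discrete
mollification yields smooth functions [g] of [x] with [g <= 0] on [K], [g p]
bounded below by a fixed positive number and [dd^c g >= - eta] on null vectors.
After cutting off with functions of [x] (harmless by the bounded projection of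
the support) and of [c y] with [c] small, the equation for [dd^c T] tested on [g]
contradicts the finite mass of [T]. *)

From HB Require Import structures.
Require Import Defs.
From mathcomp Require Import all_boot all_order all_algebra.
From mathcomp Require Import all_classical all_reals all_analysis.
From mathcomp Require Import measurable_realfun complex ring lra zify.

Set Implicit Arguments.
Unset Strict Implicit.
Unset Printing Implicit Defensive.

Import Order.TTheory GRing.Theory Num.Theory.
Import numFieldNormedType.Exports.

Local Open Scope classical_set_scope.
Local Open Scope ring_scope.

(** * Smooth functions *)

Section Smooth.
Context {R : realType}.
Implicit Types (f g u : C3 R -> R) (k : 'I_(3 + 3)).

(** The gauge [P] is an infimum that could a priori be -oo. Its finiteness is where the hull is
    used: majorants of a pair and of its opposite add up to a function that is nonnegative on the
    tube with Levi form at most 0 on null vectors, hence nonnegative at [p]. A majorant sees a form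
    only through its values on [v] and [Jmap v] with [v] null, so null positivity and bidimension
    (1,1) of the current follow at once. In the converse the error [eta] is multiplied by the mass
    of [T], so the lower bound at [p] must be fixed before [eta]. The kernel width is therefore
    chosen from the Lipschitz constant of the sup-convolution alone, and only the mesh of the
    lattice depends on [eta]; the Lipschitz bound makes the lattice error uniform. Lattice sums in
    place of convolutions leave only integrals over circles. The cutoff in [c y] costs a multiple of
    [c], because [g] depends on [x] alone and is bounded with its derivatives over bounded sets of
    [x]. *)

Definition partial1 k f : C3 R -> R := fun q => 'D_(ebase R k) (f : C3 R -> R^o) q.

Lemma pderivs_rcons s k f : pderivs (rcons s k) f = pderivs s (partial1 k f).
Proof. by rewrite /pderivs foldr_rcons. Qed.

Lemma smooth_continuous f : smooth f -> continuous f.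
Proof. by move=> /(_ [::])[]. Qed.

Lemma smooth_derivable f q k : smooth f -> derivable (f : C3 R -> R^o) q (ebase R k).
Proof. by move=> /(_ [::])[_]; exact. Qed.

Lemma smooth_partial1 f k : smooth f -> smooth (partial1 k f).
Proof. by move=> sf s; rewrite -pderivs_rcons; exact: sf. Qed.

Lemma smoothP f : continuous f ->
  (forall k q, derivable (f : C3 R -> R^o) q (ebase R k)) ->
  (forall k, smooth (partial1 k f)) -> smooth f.
Proof.
move=> cf df sf s; case/lastP: s => [|s k]; first by split.
by rewrite pderivs_rcons; exact: sf.
Qed.

(** Leibniz and chain rules turn one string of partials into sums over several functions, so an
    induction along the strings of [smooth] does not close. Counting derivatives, with all functions
    of order [n] at once, makes products, inverses and compositions plain inductions on [n]. *)
Fixpoint Cn n f : Prop :=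
  if n is m.+1 then [/\ continuous f,
    forall k q, derivable (f : C3 R -> R^o) q (ebase R k) &
    forall k, Cn m (partial1 k f)] else continuous f.

Lemma CnP f : smooth f <-> forall n, Cn n f.
Proof.
split=> [sf n|].
  elim: n f sf => [|n IH] f sf /=; first exact: smooth_continuous.
  split; [exact: smooth_continuous|move=> k q; exact: smooth_derivable|].
  by move=> k; apply: IH; exact: smooth_partial1.
move=> cf s; elim/last_ind: s f cf => [|s k IH] f cf.
  by have [? ? _] := cf 1%N; split.
by rewrite pderivs_rcons; apply: IH => n; have [_ _] := cf n.+1; exact.
Qed.

Lemma CnS n f : Cn n.+1 f -> [/\ continuous f,
    forall k q, derivable (f : C3 R -> R^o) q (ebase R k) &
    forall k, Cn n (partial1 k f)].
Proof. by []. Qed.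

Lemma CnW n f : Cn n.+1 f -> Cn n f.
Proof.
elim: n f => [|n IH] f; first by case.
by move=> [? ? h]; split=> // k; apply: IH; exact: h.
Qed.

Lemma partial1D k f g : (forall q, derivable (f : C3 R -> R^o) q (ebase R k)) ->
  (forall q, derivable (g : C3 R -> R^o) q (ebase R k)) ->
  partial1 k (fun q => f q + g q) = fun q => partial1 k f q + partial1 k g q.
Proof. by move=> df dg; apply/funext => q; exact: deriveD. Qed.

Lemma partial1M k f g : (forall q, derivable (f : C3 R -> R^o) q (ebase R k)) ->
  (forall q, derivable (g : C3 R -> R^o) q (ebase R k)) ->
  partial1 k (fun q => f q * g q) =
  fun q => f q * partial1 k g q + g q * partial1 k f q.
Proof. by move=> df dg; apply/funext => q; exact: deriveM. Qed.

Lemma CnD n f g : Cn n f -> Cn n g -> Cn n (fun q => f q + g q).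
Proof.
elim: n f g => [|n IH] f g /=.
  by move=> cf cg q; exact: (cvgD (cf q) (cg q)).
move=> [cf df hf] [cg dg hg]; split.
- by move=> q; exact: (cvgD (cf q) (cg q)).
- by move=> k q; apply: derivableD.
- by move=> k; rewrite partial1D//; apply: IH.
Qed.

Lemma CnM n f g : Cn n f -> Cn n g -> Cn n (fun q => f q * g q).
Proof.
elim: n f g => [|n IH] f g.
  by move=> cf cg q; exact: (cvgM (cf q) (cg q)).
move=> cnf cng; have [cg dg hg] := CnS cng; have [cf df hf] := CnS cnf; split.
- by move=> q; exact: (cvgM (cf q) (cg q)).
- by move=> k q; apply: derivableM.
- by move=> k; rewrite partial1M//; apply: CnD; apply: IH; by [|exact: CnW].
Qed.


Lemma smoothD f g : smooth f -> smooth g -> smooth (fun q => f q + g q).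
Proof. by move=> /CnP hf /CnP hg; apply/CnP => n; exact: CnD. Qed.


Lemma smoothM f g : smooth f -> smooth g -> smooth (fun q => f q * g q).
Proof. by move=> /CnP hf /CnP hg; apply/CnP => n; exact: CnM. Qed.

Lemma partial1_cst k (a : R) : partial1 k (cst a) = cst 0.
Proof. by apply/funext => q; exact: derive_cst. Qed.

Lemma smooth_cst (a : R) : smooth (cst a : C3 R -> R).
Proof.
apply/CnP => n; elim: n a => [|n IH] a /=; first exact: cst_continuous.
split; [exact: cst_continuous|by move=> k q; exact: derivable_cst|].
by move=> k; rewrite partial1_cst.
Qed.

Lemma smoothZ (a : R) f : smooth f -> smooth (fun q => a * f q).
Proof. by apply: smoothM; exact: smooth_cst. Qed.

Lemma smoothN f : smooth f -> smooth (fun q => - f q).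
Proof.
move=> sf; rewrite (_ : (fun q => _) = (fun q => (-1) * f q)); first exact: smoothZ.
by apply/funext => q; rewrite mulN1r.
Qed.

Lemma smoothB f g : smooth f -> smooth g -> smooth (fun q => f q - g q).
Proof. by move=> sf sg; exact: (smoothD sf (smoothN sg)). Qed.

Lemma smooth_sum (I : Type) (r : seq I) (P : pred I) (F : I -> C3 R -> R) :
  (forall i, P i -> smooth (F i)) -> smooth (fun q => \sum_(i <- r | P i) F i q).
Proof.
move=> sF; elim: r => [|i r IH].
  rewrite (_ : (fun q => _) = cst 0); first exact: smooth_cst.
  by apply/funext => q; rewrite big_nil.
case: (boolP (P i)) => Pi.
  rewrite (_ : (fun q => _) = fun q => F i q + \sum_(i <- r | P i) F i q).
    exact: (smoothD (sF _ Pi) IH).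
  by apply/funext => q; rewrite big_cons Pi.
rewrite (_ : (fun q => _) = fun q => \sum_(i <- r | P i) F i q) //.
by apply/funext => q; rewrite big_cons (negbTE Pi).
Qed.

Lemma is_derive_coord k (q v : C3 R) :
  is_derive q v (fun q : C3 R => q ord0 k : R^o) (v ord0 k).
Proof.
have df : differentiable (fun q : C3 R => q ord0 k : R^o) q.
  exact: differentiable_coord.
apply: DeriveDef; first exact: diff_derivable.
rewrite deriveE//.
have lin : linear (fun q : C3 R => q ord0 k : R^o) by move=> a x y; rewrite !mxE.
pose M := GRing.isLinear.Build _ _ _ _ _ lin.
pose L : {linear _ -> _} := HB.pack (fun q : C3 R => q ord0 k : R^o) M.
have /(@diff_lin _ _ _ L) -> // : continuous L.
by move=> x; exact: coord_continuous.
Qed.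

Lemma smooth_coord k : smooth (fun q : C3 R => q ord0 k).
Proof.
apply: smoothP.
- exact: coord_continuous.
- by move=> k' q; have [] := is_derive_coord k q (ebase R k').
- move=> k'; rewrite (_ : partial1 _ _ = cst (ebase R k' ord0 k)).
    exact: smooth_cst.
  by apply/funext => q; have [_] := is_derive_coord k q (ebase R k').
Qed.

(** The derivative [- f^-2 * f'] contains [1 / f] only up to order [n], so the induction closes
    through [CnM]. *)
Lemma CnV n f : (forall q, f q != 0) -> Cn n f -> Cn n (fun q => (f q)^-1).
Proof.
move=> f0; elim: n => [|n IH].
  by move=> cf q; exact: (cvgV (f0 q) (cf q)).
move=> cnf; have [cf df hf] := CnS cnf; split.
- by move=> q; exact: (cvgV (f0 q) (cf q)).
- by move=> k q; apply: derivableV; [exact: f0|exact: df].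
- move=> k; rewrite (_ : partial1 k _ =
    fun q => (fun=> -1) q * (((f q)^-1 * (f q)^-1) * partial1 k f q)).
    have /CnP c1 := smooth_cst (-1).
    apply: CnM; first exact: c1.
    apply: CnM; last exact: hf.
    by apply: CnM; apply: IH; exact: CnW.
  apply/funext => q; rewrite /partial1 deriveV//.
  by rewrite mulN1r -mulNr -expr2 -exprVn.
Qed.

Lemma smoothV f : (forall q, f q != 0) -> smooth f -> smooth (fun q => (f q)^-1).
Proof. by move=> f0 /CnP hf; apply/CnP => n; exact: CnV. Qed.

End Smooth.


(** * Differentiability from continuous partials and the chain rule *)

Section ChainRule.
Context {R : realType}.
Implicit Types (f g u : C3 R -> R) (k : 'I_(3 + 3)).

Lemma MVT_line f k (q : C3 R) (s : R) :
  (forall q, derivable (f : C3 R -> R^o) q (ebase R k)) ->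
  exists c, `|c| <= `|s| /\
    f (q + s *: ebase R k) - f q = s * partial1 k f (q + c *: ebase R k).
Proof.
move=> df.
pose g (t : R) := f (q + t *: ebase R k).
have dg t : is_derive t (1 : R) (g : R -> R^o) (partial1 k f (q + t *: ebase R k)).
  have := df (q + t *: ebase R k) => /derivable1P h.
  have e : (fun h : R => f (h *: ebase R k + (q + t *: ebase R k))) =
           (fun h : R => g (h + t)).
    by apply/funext => x; rewrite /g addrCA -scalerDl.
  split.
    move: h; rewrite e /derivable.
    by under eq_fun do rewrite /= addr0 add0r.
  rewrite /derive /partial1 /derive.
  suff -> : (fun h0 : R => h0^-1 *: ((g \o shift t) (h0 *: (1:R)) - g t)) =
   (fun h0 : R => h0^-1 *: ((f \o shift (q + t *: ebase R k)) (h0 *: ebase R k) -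
      f (q + t *: ebase R k))) by [].
  apply/funext => x /=; congr (_ *: (_ - _)).
  by rewrite /g addrCA -scalerDl; congr (f (_ + _ *: _)); rewrite [_ *: _]mulr1.
have cg (A : set R) : {within A, continuous g}.
  apply: continuous_subspaceT => t.
  by apply: differentiable_continuous; apply/derivable1_diffP; case: (dg t).
have [s0|s0] := leP 0 s.
  have [c ct e] := MVT_segment s0 (fun x _ => dg x) (cg _).
  exists c; split.
    by move: ct; rewrite in_itv /= => /andP[c0 cs]; rewrite !ger0_norm.
  by move: e; rewrite /g scale0r addr0 subr0 mulrC.
have [c ct e] := MVT_segment (ltW s0) (fun x _ => dg x) (cg _).
exists c; split.
  move: ct; rewrite in_itv /= => /andP[c0 cs].
  by rewrite !ler0_norm ?lerN2// ltW.
move: e; rewrite /g scale0r addr0 sub0r mulrN mulrC => e.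
by rewrite -opprB e opprK.
Qed.

(** Vertices of the staircase from [0] to [h] that switches on one coordinate at a time. *)
Definition hpart (m : nat) (h : C3 R) : C3 R :=
  \row_(j < 3 + 3) (if (j < m)%N then h ord0 j else 0).

Lemma hpartS (m : 'I_(3 + 3)) h : hpart m.+1 h = hpart m h + h ord0 m *: ebase R m.
Proof.
apply/rowP => j; rewrite !mxE /= ltnS leq_eqVlt.
have [->|jm] := eqVneq j m; first by rewrite eqxx ltnn add0r mulr1.
have jm' : (j : nat) == m = false by apply/negbTE.
by rewrite jm' /= mulr0 addr0.
Qed.

Lemma hpart0 h : hpart 0 h = 0.
Proof. by apply/rowP => j; rewrite !mxE. Qed.

Lemma hpart_full h : hpart (3 + 3) h = h.
Proof. by apply/rowP => j; rewrite !mxE ltn_ord. Qed.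

Lemma coord_le_norm n (h : 'rV[R]_n) (k : 'I_n) : `|h ord0 k| <= `|h|.
Proof.
rewrite [leRHS]mx_normrE; apply: (le_trans _ (le_bigmax _ _ (ord0, k))).
by [].
Qed.

Lemma norm_le_coord n (h : 'rV[R]_n) (e : R) : 0 <= e ->
  (forall k : 'I_n, `|h ord0 k| <= e) -> `|h| <= e.
Proof.
move=> e0 he; rewrite [leLHS]mx_normrE; apply/bigmax_leP; split => // -[i j] _ /=.
by rewrite (ord1 i).
Qed.

Lemma hpart_le m (h : C3 R) k (c : R) : (k : nat) = m -> `|c| <= `|h ord0 k| ->
  `|hpart m h + c *: ebase R k| <= `|h|.
Proof.
move=> km ch; apply: norm_le_coord => // j; rewrite !mxE /=.
have [->|jk] := eqVneq j k.
  by rewrite -km ltnn add0r mulr1 (le_trans ch)// coord_le_norm.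
rewrite mulr0 addr0; case: ifP => _; last by rewrite normr0.
exact: coord_le_norm.
Qed.

(** Each of the six steps of the staircase [hpart] is parallel to an axis, so the mean value theorem
    evaluates it at a point within [|h|] of [q]; continuity of the partials bounds the error of each
    step by [e / 6 * |h|]. *)
Lemma diff_estimate f (q : C3 R) (e : R) : 0 < e ->
  (forall k q, derivable (f : C3 R -> R^o) q (ebase R k)) ->
  (forall k, {for q, continuous (partial1 k f)}) ->
  \forall h \near (0 : C3 R),
   `|f (q + h) - f q - \sum_k h ord0 k * partial1 k f q| <= e * `|h|.
Proof.
move=> e0 df cf.
have e60 : 0 < e / 6%:R by rewrite divr_gt0.
have : \forall h \near (0 : C3 R), forall k,
    `|partial1 k f (q + h) - partial1 k f q| <= e / 6%:R.
  apply: (@filter_forall _ _ _ (nbhs (0 : C3 R))) => k.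
  have := cf k => /cvgrPdist_le/(_ _ e60).
  move=> /nbhs_ballP[d /= d0 H]; apply/nbhs_ballP; exists d => //= h.
  rewrite -ball_normE /= sub0r normrN => hd.
  rewrite distrC; apply: H; rewrite -ball_normE /=.
  by rewrite opprD addNKr normrN.
move=> /nbhs_ballP[d /= d0 dP]; near=> h.
have hd : `|h| < d.
  near: h; apply/nbhs_ballP; exists d => //= x; rewrite -ball_normE/= sub0r normrN//.
have key m : (m <= 6)%N -> `|f (q + hpart m h) - f q -
    \sum_(k < 3 + 3 | (k < m)%N) h ord0 k * partial1 k f q| <=
    m%:R * (e / 6%:R * `|h|).
  elim: m => [|m IH] m6.
    by rewrite hpart0 addr0 subrr sub0r normrN mul0r big_pred0 // normr0.
  pose k : 'I_(3 + 3) := Ordinal m6.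
  have -> : hpart m.+1 h = hpart m h + h ord0 k *: ebase R k by exact: (hpartS k).
  have [c [ch E]] := MVT_line (q + hpart m h) (h ord0 k) (df k).
  rewrite (bigD1 k)//=.
  have -> : \sum_(i < 3 + 3 | (i < m.+1)%N && (i != k)) h ord0 i * partial1 i f q =
            \sum_(i < 3 + 3 | (i < m)%N) h ord0 i * partial1 i f q.
    apply: eq_bigl => i; rewrite ltnS leq_eqVlt.
    have -> : (i != k) = ((i : nat) != m) by [].
    by case: (ltngtP (i : nat) m).
  set S := \sum_(i < _ | _) _ in IH *.
  rewrite addrA.
  have -> : f (q + hpart m h + h ord0 k *: ebase R k) - f q -
    (h ord0 k * partial1 k f q + S) =
    (f (q + hpart m h) - f q - S) +
    h ord0 k * (partial1 k f (q + hpart m h + c *: ebase R k) - partial1 k f q).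
    rewrite mulrBr -E; ring.
  rewrite mulrSr mulrDl mul1r (le_trans (ler_normD _ _))// lerD//.
    by apply: IH; exact: ltnW.
  rewrite normrM mulrC ler_pM//; last exact: coord_le_norm.
  rewrite -addrA; apply: dP.
  rewrite -ball_normE /= sub0r normrN (le_lt_trans _ hd)//.
  exact: hpart_le.
have := key 6%N (leqnn _); rewrite hpart_full.
have -> : 6%:R * (e / 6%:R * `|h|) = e * `|h|.
  by rewrite mulrA mulrCA mulfV ?mulr1.
rewrite [X in _ - X](eq_bigl xpredT) //; last by case=> i Hi /=; rewrite Hi.
Unshelve. all: by end_near. Qed.

Definition grad f (q v : C3 R) : R := \sum_k v ord0 k * partial1 k f q.

Lemma grad_linear f q : linear (grad f q : C3 R -> R^o).
Proof.
move=> a x y; rewrite /grad scaler_sumr -big_split/=; apply: eq_bigr => k _.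
by rewrite !mxE mulrDl scalerAl.
Qed.

Lemma grad_continuous f q : continuous (grad f q).
Proof.
apply: smooth_continuous; apply: smooth_sum => k _.
by apply: smoothM; [exact: smooth_coord|exact: smooth_cst].
Qed.

Lemma smooth_diff f q : smooth f ->
  differentiable (f : C3 R -> R^o) q /\
  'd (f : C3 R -> R^o) q = grad f q :> (C3 R -> R^o).
Proof.
move=> sf.
pose M := GRing.isLinear.Build _ _ _ _ _ (grad_linear f q).
pose L : {linear _ -> _} := HB.pack (grad f q : C3 R -> R^o) M.
have cL : continuous L by exact: grad_continuous.
have fE : (f : C3 R -> R^o) \o shift q = cst (f q) + L +o_ (0 : C3 R) id.
  apply/eqaddoP => e e0; near=> h.
  rewrite /= -[X in `|X| <= _]/((f (h + q) - (f q + grad f q h))) opprD addrA.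
  rewrite [h + q]addrC /grad.
  near: h; apply: diff_estimate => //.
  - by move=> k q'; exact: smooth_derivable.
  - by move=> k; apply: smooth_continuous; exact: smooth_partial1.
have dfL : 'd (f : C3 R -> R^o) q = L :> (C3 R -> R^o) by exact: diff_unique.
by split => //; apply/diff_locallyP; rewrite dfL; split.
Unshelve. all: by end_near. Qed.

Lemma derive1_curve f (c : R -> C3 R) (t : R) (dc : C3 R) : smooth f ->
  is_diff t c (fun h : R => h *: dc) ->
  is_derive t (1 : R) (f \o c : R -> R^o) (grad f (c t) dc).
Proof.
move=> sf [cd ce].
have [d de] := smooth_diff (c t) sf.
have dfc : differentiable ((f : C3 R -> R^o) \o c) t by apply: differentiable_comp.
split; first exact/derivable1_diffP.
by rewrite deriveE// diff_comp//= de ce scale1r.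
Qed.

End ChainRule.

Section DotNorm.
Context {R : realType} {n : nat}.
Implicit Types x : 'rV[R]_n.

Lemma dotv_ge0 x : 0 <= dotv x x.
Proof. by apply: sumr_ge0 => j _; exact: sqr_ge0. Qed.

Lemma coord_sq_le_dotv x k : x ord0 k ^+ 2 <= dotv x x.
Proof.
by rewrite /dotv (bigD1 k)//= -expr2 lerDl sumr_ge0// => j _; exact: sqr_ge0.
Qed.

Lemma norm_le_dotv x (M : R) : 0 <= M -> dotv x x <= M ^+ 2 -> `|x| <= M.
Proof.
move=> M0 h; apply: norm_le_coord => // k.
rewrite -(ler_pXn2r (n := 2))// ?nnegrE// real_normK ?num_real//.
exact: le_trans (coord_sq_le_dotv x k) h.
Qed.

Lemma dotv_le_norm x (M : R) : `|x| <= M -> dotv x x <= n%:R * M ^+ 2.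
Proof.
move=> xM; have -> : n%:R * M ^+ 2 = \sum_(j < n) M ^+ 2.
  by rewrite sumr_const card_ord mulr_natl.
apply: ler_sum => j _; rewrite -expr2 -real_normK ?num_real//.
have := le_trans (coord_le_norm x j) xM.
by rewrite ler_pXn2r// nnegrE// (le_trans (normr_ge0 x)).
Qed.

End DotNorm.

(* Unification must not unfold [smooth]. *)
#[local] Opaque smooth.

(** * Circles and second derivatives *)

Section Polar.
Context {R : realType}.
Implicit Types (f g u : C3 R -> R) (k : 'I_(3 + 3)).
Variables (q0 v w : C3 R).

Lemma is_diff_affine2 (a b : R -> R) (t da db : R) :
  is_derive t (1 : R) (a : R -> R^o) da -> is_derive t (1 : R) (b : R -> R^o) db ->
  is_diff t (fun x => q0 + a x *: v + b x *: w) (fun h : R => h *: (da *: v + db *: w)).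
Proof.
move=> [a1 a2] [b1 b2].
have dfa : differentiable (a : R -> R^o) t by exact/derivable1_diffP.
have dfb : differentiable (b : R -> R^o) t by exact/derivable1_diffP.
have da1 : is_diff t (fun x : R => a x *: v) (fun h : R => h *: (da *: v)).
  split; first exact: differentiableZl.
  rewrite (diffZl v dfa) diff1E//; apply/funext => h.
  by rewrite derive1E a2 scalerA.
have db1 : is_diff t (fun x : R => b x *: w) (fun h : R => h *: (db *: w)).
  split; first exact: differentiableZl.
  rewrite (diffZl w dfb) diff1E//; apply/funext => h.
  by rewrite derive1E b2 scalerA.
have dq : is_diff t (cst q0 : R -> C3 R) 0 by exact: is_diff_cst.
have h1 := is_diffD dq da1.
have h2 := is_diffD h1 db1.
have e : 0 + (fun h : R => h *: (da *: v)) + (fun h : R => h *: (db *: w)) =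
  (fun h : R => h *: (da *: v + db *: w)).
  by apply/funext => h; rewrite !fctE add0r scalerDr.
exact: (is_diff_eq h2 e).
Qed.

Definition circ (r t : R) : C3 R := q0 + (r * cos t) *: v + (r * sin t) *: w.

Definition radv t : C3 R := cos t *: v + sin t *: w.
Definition angv t : C3 R := cos t *: w - sin t *: v.

Lemma is_diff_circ_r (r t : R) :
  is_diff r (circ ^~ t) (fun h : R => h *: radv t).
Proof.
have der (c : R) : is_derive r (1 : R) (fun x : R => x * c : R^o) c.
  have -> : (fun x : R => x * c : R^o) = (c \*: (id : R -> R^o)).
    by apply/funext => x; rewrite /= mulrC.
  by apply: is_derive_eq; rewrite [_ *: _]mulr1.
exact: is_diff_affine2 (der _) (der _).
Qed.

Lemma is_diff_circ_t (r t : R) :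
  is_diff t (circ r) (fun h : R => h *: (r *: angv t)).
Proof.
have dc : is_derive t (1 : R) (fun x : R => r * cos x : R^o) (- (r * sin t)).
  have -> : (fun x : R => r * cos x : R^o) = (r \*: (cos : R -> R^o)) by [].
  by apply: is_derive_eq; rewrite [_ *: _]mulrN.
have ds : is_derive t (1 : R) (fun x : R => r * sin x : R^o) (r * cos t).
  have -> : (fun x : R => r * sin x : R^o) = (r \*: (sin : R -> R^o)) by [].
  exact: is_derive_eq.
have := is_diff_affine2 dc ds.
by rewrite /angv scalerBr !scalerA addrC scaleNr.
Qed.

Definition hess u (q x y : C3 R) : R := \sum_j \sum_k x ord0 j * y ord0 k *
  partial1 j (partial1 k u) q.

Lemma derive_rad u r t : smooth u ->
  is_derive r (1 : R) ((fun s => grad u (circ s t) (radv t)) : R -> R^o)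
     (hess u (circ r t) (radv t) (radv t)).
Proof.
move=> su.
pose F k : R -> R^o := radv t ord0 k \*: ((partial1 k u \o circ ^~ t) : R -> R^o).
have -> : ((fun s => grad u (circ s t) (radv t)) : R -> R^o) = \sum_k F k.
  by apply/funext => s; rewrite fct_sumE.
have d k : is_derive r (1 : R) (F k)
    (radv t ord0 k *: grad (partial1 k u) (circ r t) (radv t) : R^o).
  apply: is_deriveZ; apply: derive1_curve; first exact: smooth_partial1.
  exact: is_diff_circ_r.
apply: (is_derive_eq (is_derive_sum d)).
rewrite /hess exchange_big/=; apply: eq_bigr => k _.
rewrite [_ *: _]mulr_sumr; apply: eq_bigr => j _.
by rewrite mulrA [_ ord0 k * _]mulrC.
Qed.

(** The frame turns with the angle: the derivative of [angv] is [- radv], which produces the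
    gradient term beside the second derivative. *)
Lemma derive_ang u r t : smooth u ->
  is_derive t (1 : R) ((fun s => grad u (circ r s) (angv s)) : R -> R^o)
     (r * hess u (circ r t) (angv t) (angv t) - grad u (circ r t) (radv t)).
Proof.
move=> su.
have ca k : (fun s => angv s ord0 k : R^o) =
   (w ord0 k \*: (cos : R -> R^o)) - (v ord0 k \*: (sin : R -> R^o)).
  by apply/funext => s; rewrite /angv !mxE; congr (_ - _); rewrite mulrC.
have da k : is_derive t (1 : R) (fun s => angv s ord0 k : R^o) (- radv t ord0 k).
  rewrite ca; apply: is_derive_eq.
  by rewrite /radv !mxE scalerN opprD addrC; congr (- _ - _); rewrite mulrC.
have dp k : is_derive t (1 : R) ((partial1 k u \o circ r) : R -> R^o)
    (r * grad (partial1 k u) (circ r t) (angv t)).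
  have h := derive1_curve (smooth_partial1 k su) (is_diff_circ_t r t).
  apply: (is_derive_eq h).
  by rewrite /grad mulr_sumr; apply: eq_bigr => j _; rewrite mxE mulrA.
have -> : ((fun s => grad u (circ r s) (angv s)) : R -> R^o) =
   \sum_k (((fun s => angv s ord0 k) : R -> R^o) * ((partial1 k u \o circ r) : R -> R^o)).
  by apply/funext => s; rewrite fct_sumE.
have d k := is_deriveM (da k) (dp k).
apply: (is_derive_eq (is_derive_sum d)).
rewrite big_split/= -sumrN; congr (_ + _); last first.
  apply: eq_bigr => k _; rewrite [LHS]mulrN mulrC//.
rewrite /hess exchange_big/= mulr_sumr; apply: eq_bigr => k _.
rewrite [LHS]mulrCA; congr (_ * _); rewrite mulr_sumr; apply: eq_bigr => j _.
by rewrite mulrA [_ ord0 k * _]mulrC.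
Qed.

(** Rotation invariance of a trace: the cross terms in [cos t * sin t] cancel between the two frame
    vectors, and the squares recombine by [cos^2 + sin^2 = 1]. *)
Lemma hess_rad_ang u q t :
  hess u q (radv t) (radv t) + hess u q (angv t) (angv t) = hess u q v v + hess u q w w.
Proof.
rewrite /hess -!big_split/=; apply: eq_bigr => j _.
rewrite -!big_split/=; apply: eq_bigr => k _.
rewrite -!mulrDl; congr (_ * _); rewrite !mxE.
have e := cos2Dsin2 t.
transitivity ((cos t ^+ 2 + sin t ^+ 2) * (v ord0 j * v ord0 k + w ord0 j * w ord0 k)).
  ring.
by rewrite e mul1r.
Qed.

End Polar.

(** * Circle means *)

Lemma itv_shift (R : realType) (a x : R) : a - 1 < x < a + 1 -> -1 < x - a < 1.
Proof. by move=> h; lra. Qed.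

Section ContinuityR.
Context {R : realType}.
Implicit Types f g : R -> R.

Lemma contD f g : continuous f -> continuous g -> continuous (fun t => f t + g t).
Proof. by move=> cf cg t; exact: (@cvgD _ R^o _ _ _ f g _ _ (cf t) (cg t)). Qed.

Lemma contB f g : continuous f -> continuous g -> continuous (fun t => f t - g t).
Proof. by move=> cf cg t; exact: (@cvgB _ R^o _ _ _ f g _ _ (cf t) (cg t)). Qed.

Lemma contM f g : continuous f -> continuous g -> continuous (fun t => f t * g t).
Proof. by move=> cf cg t; exact: (cvgM (cf t) (cg t)). Qed.

Lemma contZ (a : R) f : continuous f -> continuous (fun t => a * f t).
Proof. by apply: contM; exact: cst_continuous. Qed.

Lemma cont_sum (I : Type) (s : seq I) (F : I -> R -> R) :
  (forall i, continuous (F i)) -> continuous (fun t => \sum_(i <- s) F i t).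
Proof.
move=> cF; elim: s => [|i s IH].
  rewrite (_ : (fun t => _) = cst 0); first exact: cst_continuous.
  by apply/funext => t; rewrite big_nil.
rewrite (_ : (fun t => _) = fun t => F i t + \sum_(i <- s) F i t); last first.
  by apply/funext => t; rewrite big_cons.
exact: contD.
Qed.

End ContinuityR.

Section CircleIntegral.
Context {R : realType}.
Implicit Types (u g : C3 R -> R) (f : R -> R).

Local Notation mu := (@lebesgue_measure R).
Definition circle_dom : set R := `[0, 2 * pi]%classic.

Lemma circle_dom_compact : compact circle_dom.
Proof. exact: segment_compact. Qed.

Lemma circle_dom_measurable : measurable circle_dom.
Proof. exact: measurable_itv. Qed.

Lemma circle_integrable f : continuous f -> mu.-integrable circle_dom (EFin \o f).
Proof.
move=> cf; apply: continuous_compact_integrable; first exact: circle_dom_compact.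
exact: continuous_subspaceT.
Qed.

Lemma circle_integralE f : continuous f ->
  (\int[mu]_(t in circle_dom) (f t)%:E)%E = (\int[mu]_(t in circle_dom) f t)%:E.
Proof.
move=> cf; rewrite /Rintegral fineK//.
apply: integrable_fin_num; first exact: circle_dom_measurable.
exact: circle_integrable.
Qed.

Lemma two_pi_gt0 : 0 < 2 * pi :> R.
Proof. by rewrite mulr_gt0// pi_gt0. Qed.

Lemma circle_integral_cst (c : R) : \int[mu]_(t in circle_dom) c = 2 * pi * c.
Proof.
rewrite Rintegral_cst; last exact: circle_dom_measurable.
rewrite mulrC; congr (_ * _).
rewrite /circle_dom [X in fine X]lebesgue_measure_itv/= lte_fin two_pi_gt0.
by rewrite -EFinB subr0.
Qed.

Lemma ball_bound g (M : R) : continuous g ->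
  exists C, 0 <= C /\ forall q, `|q| <= M -> `|g q| <= C.
Proof.
move=> cg.
pose A := [set q : C3 R | `|q| <= M].
have cA : compact A.
  apply: bounded_closed_compact.
    by exists M; split; [exact: num_real|move=> x Mx q /= /le_trans; apply; exact: ltW].
  have -> : A = (fun q : C3 R => `|q|) @^-1` [set x : R | x <= M] by [].
  apply: closed_comp; first by move=> x _; exact: (@norm_continuous _ (C3 R) x).
  exact: closed_le.
have /compact_bounded[C [_ hC]] : compact (g @` A).
  by apply: continuous_compact => //; exact: continuous_subspaceT.
exists (`|C| + 1); split; first by rewrite addr_ge0.
move=> q qM; apply: (hC (`|C| + 1)); last by exists q.
by rewrite (le_lt_trans (ler_norm C))// ltrDl.
Qed.

Lemma param_integral (phi dphi : R -> R -> R) (a C : R) :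
  (forall r t, is_derive r (1 : R) (phi ^~ t : R -> R^o) (dphi r t)) ->
  (forall r, continuous (phi r)) ->
  (forall r t, `|r - a| < 1 -> circle_dom t -> `|dphi r t| <= C) ->
  is_derive a (1 : R) (fun r => \int[mu]_(t in circle_dom) phi r t : R^o)
    (\int[mu]_(t in circle_dom) dphi a t).
Proof.
move=> dP cP bP.
have Ia : `]a - 1, a + 1[%classic a.
  by rewrite /= in_itv /= ltrBlDr ltrDl ltr01.
have intf x : `]a - 1, a + 1[%classic x -> mu.-integrable circle_dom (EFin \o phi x).
  by move=> _; exact: circle_integrable.
have der x y : `]a - 1, a + 1[%classic x -> circle_dom y -> derivable (phi ^~ y : R -> R^o) x 1.
  by move=> _ _; case: (dP x y).
have C0 (y : R) : 0 <= `|C| :> R by [].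
have intC : mu.-integrable circle_dom (EFin \o (fun=> `|C|)).
  apply: circle_integrable; exact: cst_continuous.
have ub x y : `]a - 1, a + 1[%classic x -> circle_dom y -> `|partial1of2 phi x y| <= `|C|.
  move=> /= xa Dy; rewrite partial1of2E; have [_ ->] := dP x y.
  rewrite (le_trans _ (ler_norm C))// bP// ltr_norml.
  by move: xa; rewrite in_itv/=; exact: itv_shift.
have mD := circle_dom_measurable.
have h1 := @derivable_under_integral R _ _ mu phi circle_dom mD a (a - 1) (a + 1) Ia intf der
  (fun=> `|C|) C0 intC ub.
have h2 := @differentiation_under_integral R _ _ mu phi circle_dom mD a (a - 1) (a + 1) Ia
  intf der (fun=> `|C|) C0 intC ub.
split; first exact: h1.
rewrite -derive1E h2; apply: eq_Rintegral => t _.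
by rewrite partial1of2E; have [_ ->] := dP a t.
Qed.

End CircleIntegral.

(** * The mean value inequality on circles *)

Section MeanValue.
Context {R : realType}.
Implicit Types (u g : C3 R -> R).
Variables (q0 v w : C3 R).
Local Notation mu := (@lebesgue_measure R).
Local Notation circ := (circ q0 v w).
Local Notation radv := (radv v w).
Local Notation angv := (angv v w).

Lemma circ_continuous_t r : continuous (circ r).
Proof.
move=> t; apply: differentiable_continuous.
by have [] := is_diff_circ_t q0 v w r t.
Qed.

Lemma circ_bound r t : `|circ r t| <= `|q0| + `|r| * `|v| + `|r| * `|w|.
Proof.
rewrite /circ (le_trans (ler_normD _ _))// lerD//.
  rewrite (le_trans (ler_normD _ _))// lerD//.
  rewrite normrZ ler_wpM2r// normrM ler_piMr//.
  by rewrite ler_norml cos_geN1 cos_le1.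
rewrite normrZ ler_wpM2r// normrM ler_piMr//.
by rewrite ler_norml sin_geN1 sin_le1.
Qed.

Lemma rad_bound t k : `|radv t ord0 k| <= `|v| + `|w|.
Proof.
rewrite /radv !mxE (le_trans (ler_normD _ _))// lerD// normrM.
  rewrite (le_trans _ (coord_le_norm v k))// ler_piMl//.
  by rewrite ler_norml cos_geN1 cos_le1.
rewrite (le_trans _ (coord_le_norm w k))// ler_piMl//.
by rewrite ler_norml sin_geN1 sin_le1.
Qed.

Lemma rad_continuous k : continuous (fun t => radv t ord0 k).
Proof.
rewrite /radv (_ : (fun t => _) = fun t => cos t * v ord0 k + sin t * w ord0 k).
  apply: contD; apply: contM; [exact: continuous_cos|exact: cst_continuous|
    exact: continuous_sin|exact: cst_continuous].
by apply/funext => s; rewrite !mxE.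
Qed.

Lemma ang_continuous k : continuous (fun t => angv t ord0 k).
Proof.
rewrite /angv (_ : (fun t => _) = fun t => cos t * w ord0 k - sin t * v ord0 k).
  apply: contB; apply: contM; [exact: continuous_cos|exact: cst_continuous|
    exact: continuous_sin|exact: cst_continuous].
by apply/funext => s; rewrite !mxE.
Qed.

Lemma comp_circ_continuous g r : continuous g -> continuous (fun t => g (circ r t)).
Proof. by move=> cg t; apply: continuous_comp; [exact: circ_continuous_t|exact: cg]. Qed.

Lemma grad_rad_continuous u r : smooth u ->
  continuous (fun t => grad u (circ r t) (radv t)).
Proof.
move=> su; apply: cont_sum => k; apply: contM; first exact: rad_continuous.
by apply: comp_circ_continuous; apply: smooth_continuous; exact: smooth_partial1.
Qed.

Lemma hess_continuous u r (x y : R -> C3 R) : smooth u ->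
  (forall k, continuous (fun t => x t ord0 k)) ->
  (forall k, continuous (fun t => y t ord0 k)) ->
  continuous (fun t => hess u (circ r t) (x t) (y t)).
Proof.
move=> su cx cy; apply: cont_sum => j; apply: cont_sum => k.
apply: contM; first exact: contM.
apply: comp_circ_continuous; apply: smooth_continuous; apply: smooth_partial1.
exact: smooth_partial1.
Qed.

Lemma local_circ_bound g a : continuous g -> exists C, 0 <= C /\
  forall r t, `|r - a| < 1 -> `|g (circ r t)| <= C.
Proof.
move=> cg; have [C [C0 hC]] := ball_bound
  (`|q0| + (`|a| + 1) * `|v| + (`|a| + 1) * `|w|) cg.
exists C; split => // r t ra; apply: hC.
have r1 : `|r| <= `|a| + 1.
  rewrite -[r](subrK a) addrC (le_trans (ler_normD _ _))// lerD2l; exact: ltW.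
rewrite (le_trans (circ_bound r t))// !lerD// ler_wpM2r//.
Qed.

Lemma local_grad_bound u a : smooth u -> exists C,
  forall r t, `|r - a| < 1 -> `|grad u (circ r t) (radv t)| <= C.
Proof.
move=> su.
have h k := local_circ_bound a (smooth_continuous (smooth_partial1 k su)).
have [C hC] := choice h.
exists (\sum_k (`|v| + `|w|) * C k) => r t ra.
rewrite (le_trans (ler_norm_sum _ _ _))// ler_sum// => k _.
rewrite normrM ler_pM// ?rad_bound//; have [_] := hC k; exact.
Qed.

Lemma local_hess_bound u a : smooth u -> exists C,
  forall r t, `|r - a| < 1 -> `|hess u (circ r t) (radv t) (radv t)| <= C.
Proof.
move=> su.
have h (jk : 'I_(3 + 3) * 'I_(3 + 3)) := local_circ_bound a
  (smooth_continuous (smooth_partial1 jk.1 (smooth_partial1 jk.2 su))).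
have [C hC] := choice h.
exists (\sum_j \sum_k (`|v| + `|w|) * (`|v| + `|w|) * C (j, k)) => r t ra.
rewrite (le_trans (ler_norm_sum _ _ _))// ler_sum// => j _.
rewrite (le_trans (ler_norm_sum _ _ _))// ler_sum// => k _.
rewrite !normrM ler_pM//; first by rewrite ler_pM// rad_bound.
by have [_] := hC (j, k); exact.
Qed.

Definition circle_sum u r := \int[mu]_(t in circle_dom) u (circ r t).

Lemma circle_sum_derive u r : smooth u -> is_derive r (1 : R) (circle_sum u : R -> R^o)
  (\int[mu]_(t in circle_dom) grad u (circ r t) (radv t)).
Proof.
move=> su; have [C hC] := local_grad_bound r su.
apply: (@param_integral _ (fun r t => u (circ r t))
  (fun r t => grad u (circ r t) (radv t)) r C).
- by move=> r' t; exact: (derive1_curve su (is_diff_circ_r q0 v w r' t)).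
- by move=> r'; apply: comp_circ_continuous; exact: smooth_continuous.
- by move=> r' t rr _; exact: hC.
Qed.

(** Differentiation gives the circle integral of [r * u_rr + u_r], with subscripts for the frame
    [radv], [angv]. By [derive_ang] the function [r * u_aa - u_r] is the derivative in [t] of a
    periodic function, so its integral vanishes; adding it leaves [r * (u_rr + u_aa)], and
    [hess_rad_ang] returns to the fixed vectors [v], [w]. *)
Lemma circle_flux_derive u r : smooth u ->
  is_derive r (1 : R)
    ((fun s => s * \int[mu]_(t in circle_dom) grad u (circ s t) (radv t)) : R -> R^o)
    (r * \int[mu]_(t in circle_dom) (hess u (circ r t) v v + hess u (circ r t) w w)).
Proof.
move=> su; have [C hC] := local_hess_bound r su.
pose A r t := grad u (circ r t) (radv t).
pose A' r t := hess u (circ r t) (radv t) (radv t).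
pose B' t := r * hess u (circ r t) (angv t) (angv t) - A r t.
pose L t := hess u (circ r t) v v + hess u (circ r t) w w.
have dI : is_derive r (1 : R) ((fun s => \int[mu]_(t in circle_dom) A s t) : R -> R^o)
   (\int[mu]_(t in circle_dom) A' r t).
  apply: (@param_integral _ A A' r C).
  - by move=> r' t; exact: derive_rad.
  - by move=> r'; exact: grad_rad_continuous.
  - by move=> r' t rr _; exact: hC.
have cA : continuous (A r) by exact: grad_rad_continuous.
have cA' : continuous (A' r) by apply: hess_continuous => // k; exact: rad_continuous.
have cAng : continuous (fun t => hess u (circ r t) (angv t) (angv t)).
  by apply: hess_continuous => // k; exact: ang_continuous.
have cB' : continuous B'.
  by apply: contB => //; exact: contZ.
have cL : continuous L.
  by apply: contD; apply: hess_continuous => // k; exact: cst_continuous.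
have intB : \int[mu]_(t in circle_dom) B' t = 0.
  pose B t := grad u (circ r t) (angv t).
  have dB t : is_derive t (1 : R) (B : R -> R^o) (B' t) by exact: derive_ang.
  have cB : continuous B.
    by move=> t; apply: differentiable_continuous; apply/derivable1_diffP; case: (dB t).
  rewrite /Rintegral /circle_dom (@continuous_FTC2 _ B' B 0 (2 * pi) two_pi_gt0).
  - rewrite -EFinB /= /B /circ /angv mulr_natl !cos2pi !sin2pi !cos0 !sin0 ?mulr1 ?mulr0.
    by rewrite subrr.
  - exact: continuous_subspaceT.
  - split.
    + by move=> t _; case: (dB t).
    + by apply: cvg_at_right_filter; exact: cB.
    + by apply: cvg_at_left_filter; exact: cB.
  - by move=> t _; rewrite derive1E; case: (dB t).
have h := is_deriveM (is_derive_id r (1 : R)) dI.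
apply: (is_derive_eq h) => /=.
have mD := @circle_dom_measurable R.
have iA := circle_integrable cA. have iA' := circle_integrable cA'.
have iL := circle_integrable cL. have iB' := circle_integrable cB'.
have e : r * \int[mu]_(t in circle_dom) L t =
  r * \int[mu]_(t in circle_dom) A' r t + \int[mu]_(t in circle_dom) A r t
     + \int[mu]_(t in circle_dom) B' t.
  rewrite -!RintegralZl//.
  rewrite -RintegralD//; last first.
    by apply: circle_integrable; exact: contZ.
  rewrite -RintegralD//; last first.
    by apply: circle_integrable; apply: contD => //; exact: contZ.
  apply: eq_Rintegral => t _; rewrite /L -(hess_rad_ang v w u _ t) /B' /A'.
  ring.
rewrite e intB addr0; congr (_ + _).
by rewrite [LHS]mulr1.
Qed.

(* With [M] the circle integral of [u], [r * M'(r)] is the flux of the gradient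
   through the circle of radius [r], whose derivative is [r] times the circle
   integral of the Laplacian. *)
Lemma subharmonic_mean u r0 : smooth u -> 0 <= r0 ->
  (forall r t, 0 <= r <= r0 ->
     0 <= hess u (circ r t) v v + hess u (circ r t) w w) ->
  2 * pi * u q0 <= \int[mu]_(t in circle_dom) u (circ r0 t).
Proof.
move=> su r00 hL.
pose N r := r * \int[mu]_(t in circle_dom) grad u (circ r t) (radv t).
have dN r := circle_flux_derive r su.
have dM r := circle_sum_derive r su.
have derc (f : R -> R) (df : R -> R) : (forall r, is_derive r (1 : R) (f : R -> R^o) (df r)) ->
   continuous f.
  by move=> h t; apply: differentiable_continuous; apply/derivable1_diffP; case: (h t).
have N0 r : 0 <= r <= r0 -> 0 <= N r.
  move=> /andP[r_ge0 rr0].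
  have <- : N 0 = 0 by rewrite /N mul0r.
  apply: (@ger0_derive1_le_cc _ N 0 r0) => //.
  - move=> x; rewrite in_itv/= => /andP[x0 xr]; rewrite derive1E.
    have [_ ->] := dN x.
    apply: mulr_ge0; first exact: ltW.
    by apply: Rintegral_ge0 => t _; apply: hL; rewrite !ltW.
  - by apply: continuous_subspaceT; exact: derc dN.
  - by rewrite in_itv/= lexx.
  - by rewrite in_itv/= r_ge0.
have <- : circle_sum u 0 = 2 * pi * u q0.
  rewrite -circle_integral_cst; apply: eq_Rintegral => t _.
  by rewrite /circ !mul0r !scale0r !addr0.
apply: (@ger0_derive1_le_cc _ (circle_sum u) 0 r0) => //.
- move=> x; rewrite in_itv/= => /andP[x0 xr]; rewrite derive1E.
  have [_ ->] := dM x.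
  have := N0 x; rewrite /N pmulr_rge0//; apply; by rewrite !ltW.
- by apply: continuous_subspaceT; exact: derc dM.
- by rewrite in_itv/= lexx.
- by rewrite in_itv/= r00 lexx.
Qed.

End MeanValue.

(** * The Levi form and the operator ddc *)

Section Levi.
Context {R : realType}.
Implicit Types (u f g : C3 R -> R) (q v w : C3 R).

(** Four times the complex Hessian of [u] on [v]. *)
Definition levi u q v : R := hess u q v v + hess u q (Jmap v) (Jmap v).

Lemma lshift_re v j : v ord0 (lshift 3 j) = re_part v ord0 j.
Proof. by rewrite mxE. Qed.

Lemma rshift_im v j : v ord0 (rshift 3 j) = im_part v ord0 j.
Proof. by rewrite mxE. Qed.

Lemma re_Jmap v : re_part (Jmap v) = - im_part v.
Proof. by rewrite /re_part /Jmap row_mxKl. Qed.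

Lemma im_Jmap v : im_part (Jmap v) = re_part v.
Proof. by rewrite /im_part /Jmap row_mxKr. Qed.

Lemma C3_ext v w : re_part v = re_part w -> im_part v = im_part w -> v = w.
Proof. by move=> h1 h2; rewrite -[v]hsubmxK -[w]hsubmxK -/(re_part v) h1 -/(im_part v) h2. Qed.

Lemma re_partP a v w : re_part (a *: v + w) = a *: re_part v + re_part w.
Proof. exact: (linearP (@lsubmx R 1 3 3)). Qed.

Lemma im_partP a v w : im_part (a *: v + w) = a *: im_part v + im_part w.
Proof. exact: (linearP (@rsubmx R 1 3 3)). Qed.

Lemma re_partN v : re_part (- v) = - re_part v.
Proof. exact: (linearN (@lsubmx R 1 3 3)). Qed.

Lemma im_partN v : im_part (- v) = - im_part v.
Proof. exact: (linearN (@rsubmx R 1 3 3)). Qed.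

Lemma Jmap_linear : linear (@Jmap R).
Proof.
move=> a x y; apply: C3_ext; rewrite ?re_Jmap ?im_Jmap.
  by rewrite re_partP im_partP !re_Jmap opprD scalerN.
by rewrite re_partP im_partP !im_Jmap.
Qed.

Lemma JmapK v : Jmap (Jmap v) = - v.
Proof.
by apply: C3_ext; rewrite ?re_Jmap ?im_Jmap ?re_partN ?im_partN ?re_Jmap.
Qed.

HB.instance Definition _ := GRing.isLinear.Build R (C3 R) (C3 R) _ (@Jmap R) Jmap_linear.

Lemma sum_Jmap v l : \sum_k v ord0 k * Jmap (ebase R k) ord0 l = Jmap v ord0 l.
Proof.
rewrite {2}(row_sum_delta v) (linear_sum (@Jmap R)) summxE; apply: eq_bigr => k _.
have e : @Jmap R (v 0 k *: 'e_k) = v 0 k *: @Jmap R 'e_k by exact: (linearZ_LR (@Jmap R)).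
by apply: (etrans _ (congr1 (fun z : C3 R => z ord0 l) (esym e))); rewrite [RHS]mxE.
Qed.

Lemma Re_dc u q w : complex.Re (dc u q w) = - grad u q (Jmap w).
Proof.
rewrite dcE /= /grad big_split_ord/= -big_split/= -sumrN; apply: eq_bigr => j _.
rewrite !lshift_re !rshift_im re_Jmap im_Jmap !mxE /dx /dy /partial1.
by rewrite mulNr opprD opprK mulrC; congr (_ - _); rewrite mulrC.
Qed.

Lemma pairing_sum A v w : pairing A v w = \sum_j \sum_k v ord0 j * w ord0 k * A j k.
Proof.
rewrite /pairing mxE exchange_big/=; apply: eq_bigr => k _.
rewrite !mxE mulr_suml; apply: eq_bigr => j _.
by rewrite mulrAC.
Qed.

Lemma partial1Z u k (a : R) : smooth u ->
  partial1 k (fun q => a * u q) = (fun q => a * partial1 k u q).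
Proof.
by move=> su; apply/funext => q; apply: deriveZ; exact: smooth_derivable.
Qed.

Lemma partial1_sum (I : Type) (r : seq I) (F : I -> C3 R -> R) k :
  (forall i, smooth (F i)) ->
  partial1 k (fun q => \sum_(i <- r) F i q) = fun q => \sum_(i <- r) partial1 k (F i) q.
Proof.
move=> sF; elim: r => [|i r IH].
  have e (G : I -> C3 R -> R) : (fun q => \sum_(i <- [::]) G i q) = cst 0.
    by apply/funext => q; rewrite big_nil.
  by rewrite !e partial1_cst.
have e (G : I -> C3 R -> R) : (fun q => \sum_(i <- i :: r) G i q) =
   fun q => G i q + \sum_(i <- r) G i q.
  by apply/funext => q; rewrite big_cons.
rewrite !e partial1D; first by rewrite IH.
- by move=> q; exact: smooth_derivable.
- by move=> q; apply: smooth_derivable; exact: smooth_sum.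
Qed.

Lemma ddc_entry u q j k : smooth u -> ddc u q j k =
  - (\sum_(l < 3 + 3) Jmap (ebase R k) ord0 l * partial1 j (partial1 l u) q) +
    \sum_(l < 3 + 3) Jmap (ebase R j) ord0 l * partial1 k (partial1 l u) q.
Proof.
move=> su.
have dck i : (fun q' => complex.Re (dc u q' (ebase R i))) =
   fun q' => \sum_l (- Jmap (ebase R i) ord0 l) * partial1 l u q'.
  apply/funext => q'; rewrite Re_dc /grad -sumrN; apply: eq_bigr => l _.
  by rewrite mulNr.
have pdc i h : 'D_(ebase R i) ((fun q' => complex.Re (dc u q' (ebase R h))) : C3 R -> R^o) q =
    - \sum_l Jmap (ebase R h) ord0 l * partial1 i (partial1 l u) q.
  rewrite dck -[LHS]/(partial1 i _ q) partial1_sum; last first.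
    by move=> l; apply: smoothZ; exact: smooth_partial1.
  rewrite -sumrN; apply: eq_bigr => l _; rewrite (partial1Z _ _ (smooth_partial1 l su)).
  exact: mulNr.
by rewrite mxE; apply: (etrans (congr2 _ (pdc j k) (congr1 -%R (pdc k j)))); rewrite opprK.
Qed.

(** Contract [ddc_entry] with [v] and [Jmap v]. In the first sum [Jmap] acts on [Jmap v], and
    [J^2 = - 1] turns the minus sign into [hess u q v v]; in the second it acts on [v] and gives the
    term along [Jmap v]. *)
Lemma ddc_pairing u q v : smooth u ->
  pairing (ddc u q) v (Jmap v) = levi u q v.
Proof.
move=> su.
rewrite pairing_sum /levi.
have -> : hess u q v v = \sum_j \sum_k v ord0 j * Jmap v ord0 k *
   (- \sum_l Jmap (ebase R k) ord0 l * partial1 j (partial1 l u) q).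
  apply: eq_bigr => j _.
  transitivity (\sum_l v ord0 j * (- \sum_k Jmap v ord0 k * Jmap (ebase R k) ord0 l) *
     partial1 j (partial1 l u) q).
    by apply: eq_bigr => l _; rewrite sum_Jmap JmapK mxE opprK.
  under eq_bigr do rewrite -sumrN mulr_sumr mulr_suml.
  rewrite exchange_big/=; apply: eq_bigr => k _.
  by rewrite -sumrN mulr_sumr; apply: eq_bigr => l _; ring.
have -> : hess u q (Jmap v) (Jmap v) = \sum_j \sum_k v ord0 j * Jmap v ord0 k *
   (\sum_l Jmap (ebase R j) ord0 l * partial1 k (partial1 l u) q).
  rewrite exchange_big/=; apply: eq_bigr => k _.
  transitivity (\sum_l Jmap v ord0 k * (\sum_j v ord0 j * Jmap (ebase R j) ord0 l) *
     partial1 k (partial1 l u) q).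
    by apply: eq_bigr => l _; rewrite sum_Jmap.
  transitivity (\sum_l \sum_j Jmap v ord0 k * (v ord0 j * Jmap (ebase R j) ord0 l) *
     partial1 k (partial1 l u) q).
    by apply: eq_bigr => l _; rewrite mulr_sumr mulr_suml.
  rewrite exchange_big/=; apply: eq_bigr => j _.
  by rewrite mulr_sumr; apply: eq_bigr => l _; ring.
rewrite -big_split/=; apply: eq_bigr => j _; rewrite -big_split/=; apply: eq_bigr => k _.
by rewrite (ddc_entry q j k su) mulrDr.
Qed.

Lemma hessD f g q v w : smooth f -> smooth g ->
  hess (fun q => f q + g q) q v w = hess f q v w + hess g q v w.
Proof.
move=> sf sg; rewrite /hess -big_split/=; apply: eq_bigr => j _.
rewrite -big_split/=; apply: eq_bigr => k _.
have d f' k' : smooth f' -> forall q, derivable (f' : C3 R -> R^o) q (ebase R k').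
  by move=> sf' q'; exact: smooth_derivable.
rewrite partial1D; try exact: d.
by rewrite partial1D ?mulrDr//; apply: d; exact: smooth_partial1.
Qed.

Lemma hessZ (a : R) f q v w : smooth f ->
  hess (fun q => a * f q) q v w = a * hess f q v w.
Proof.
move=> sf; rewrite /hess mulr_sumr; apply: eq_bigr => j _.
rewrite mulr_sumr; apply: eq_bigr => k _.
rewrite (partial1Z k a sf) (partial1Z j a (smooth_partial1 k sf)).
exact: mulrCA.
Qed.

Lemma leviD f g q v : smooth f -> smooth g ->
  levi (fun q => f q + g q) q v = levi f q v + levi g q v.
Proof. move=> sf sg; have h1 := hessD q v v sf sg; have h2 := hessD q (Jmap v) (Jmap v) sf sg.
by apply: (etrans (congr2 _ h1 h2)); exact: addrACA. Qed.

Lemma leviZ (a : R) f q v : smooth f ->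
  levi (fun q => a * f q) q v = a * levi f q v.
Proof. move=> sf; have h1 := hessZ a q v v sf; have h2 := hessZ a q (Jmap v) (Jmap v) sf.
by apply: (etrans (congr2 _ h1 h2)); rewrite /levi mulrDr. Qed.

Lemma hess_cst (a : R) q v w : hess (cst a) q v w = 0.
Proof.
rewrite /hess big1// => j _; rewrite big1// => k _.
by rewrite !partial1_cst mulr0.
Qed.

Lemma hessM f g q v w : smooth f -> smooth g ->
  hess (fun q => f q * g q) q v w =
  f q * hess g q v w + g q * hess f q v w + (grad f q v * grad g q w + grad g q v * grad f q w).
Proof.
move=> sf sg; rewrite /hess /grad !mulr_suml !mulr_sumr -!big_split/=.
apply: eq_bigr => j _.
rewrite !mulr_sumr -!big_split/=; apply: eq_bigr => k _.
have d f' k' : smooth f' -> forall q, derivable (f' : C3 R -> R^o) q (ebase R k').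
  by move=> sf' q'; exact: smooth_derivable.
have s1 := smooth_partial1 k sf; have s2 := smooth_partial1 k sg.
rewrite partial1M; try exact: d.
rewrite partial1D; try (by apply: d; exact: smoothM).
rewrite !partial1M; try exact: d.
move: (partial1 j (partial1 k f) q) (partial1 j (partial1 k g) q) => a b.
move: (partial1 j f q) (partial1 k f q) (partial1 j g q) (partial1 k g q) => c e c' e'.
move: (f q) (g q) (v ord0 j) (w ord0 k) => x y z t.
ring.
Qed.

Lemma partial1_coord j k : partial1 k (fun q : C3 R => q ord0 j) = cst ((j == k)%:R).
Proof.
apply/funext => q; have [_ h] := is_derive_coord j q (ebase R k).
by rewrite /partial1 h /ebase mxE eqxx.
Qed.

Lemma grad_coord j q v : grad (fun q : C3 R => q ord0 j) q v = v ord0 j.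
Proof.
rewrite /grad (bigD1 j)//= partial1_coord /cst eqxx mulr1 big1 ?addr0// => k kj.
by rewrite partial1_coord /cst eq_sym (negbTE kj) mulr0.
Qed.

Lemma hess_coord j q v w : hess (fun q : C3 R => q ord0 j) q v w = 0.
Proof.
rewrite /hess big1// => i _; rewrite big1// => k _.
by rewrite partial1_coord partial1_cst mulr0.
Qed.

Lemma hess_sum (I : Type) (r : seq I) (F : I -> C3 R -> R) q v w :
  (forall i, smooth (F i)) ->
  hess (fun q => \sum_(i <- r) F i q) q v w = \sum_(i <- r) hess (F i) q v w.
Proof.
move=> sF; rewrite /hess [RHS]exchange_big/=; apply: eq_bigr => j _.
rewrite [RHS]exchange_big/=; apply: eq_bigr => k _.
rewrite partial1_sum// partial1_sum ?mulr_sumr// => i; exact: smooth_partial1.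
Qed.

Definition sqre q : R := \sum_(j < 3) q ord0 (lshift 3 j) * q ord0 (lshift 3 j).
Definition sqim q : R := \sum_(j < 3) q ord0 (rshift 3 j) * q ord0 (rshift 3 j).

Lemma sqreE q : sqre q = dotv (re_part q) (re_part q).
Proof. by apply: eq_bigr => j _; rewrite !lshift_re. Qed.

Lemma sqimE q : sqim q = dotv (im_part q) (im_part q).
Proof. by apply: eq_bigr => j _; rewrite !rshift_im. Qed.

Lemma re2_ge0 q : 0 <= sqre q.
Proof. by rewrite sqreE dotv_ge0. Qed.

Lemma im2_ge0 q : 0 <= sqim q.
Proof. by rewrite sqimE dotv_ge0. Qed.

Lemma smooth_sqre : smooth sqre.
Proof. by apply: smooth_sum => j _; apply: smoothM; exact: smooth_coord. Qed.

Lemma smooth_sqim : smooth sqim.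
Proof. by apply: smooth_sum => j _; apply: smoothM; exact: smooth_coord. Qed.

Lemma hess_sqre q v : hess sqre q v v = 2 * sqre v.
Proof.
rewrite hess_sum; last by move=> j; apply: smoothM; exact: smooth_coord.
rewrite /sqre mulr_sumr; apply: eq_bigr => j _.
rewrite hessM; try exact: smooth_coord.
by rewrite !hess_coord !grad_coord; ring.
Qed.

Lemma hess_sqim q v : hess sqim q v v = 2 * sqim v.
Proof.
rewrite hess_sum; last by move=> j; apply: smoothM; exact: smooth_coord.
rewrite /sqim mulr_sumr; apply: eq_bigr => j _.
rewrite hessM; try exact: smooth_coord.
by rewrite !hess_coord !grad_coord; ring.
Qed.

Lemma sqre_Jmap v : sqre (Jmap v) = sqim v.
Proof.
by rewrite sqreE re_Jmap sqimE /dotv; apply: eq_bigr => j _; rewrite !mxE mulrNN.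
Qed.

Lemma sqim_Jmap v : sqim (Jmap v) = sqre v.
Proof. by rewrite sqreE sqimE im_Jmap. Qed.

Lemma levi_sqre q v : levi sqre q v = 2 * (sqre v + sqim v).
Proof. by rewrite /levi !hess_sqre sqre_Jmap; ring. Qed.

Lemma levi_sqim q v : levi sqim q v = 2 * (sqre v + sqim v).
Proof. by rewrite /levi !hess_sqim sqim_Jmap; ring. Qed.

Lemma enorm2 q : enorm q ^+ 2 = sqre q + sqim q.
Proof.
by rewrite /enorm sqr_sqrtr ?dotv_ge0// /dotv big_split_ord.
Qed.

(** For [v = x + iy] the sum of squares is [|x|^2 - |y|^2 + 2i x.y]. *)
Lemma null_vectorP v : null_vector v <->
  [/\ v != 0, sqre v = sqim v & dotv (re_part v) (im_part v) = 0].
Proof.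
have e : \sum_(j < 3) zcoord v j ^+ 2 =
   Complex (sqre v - sqim v) (2 * dotv (re_part v) (im_part v)).
  have -> : forall a b : R, Complex a b = a%:C%C + 'i%C * b%:C%C.
    by move=> a b; simpc.
  rewrite /sqre /sqim /dotv -sumrB mulr_sumr !rmorph_sum/= mulr_sumr -big_split/=.
  apply: eq_bigr => j _; rewrite /zcoord !lshift_re !rshift_im expr2; simpc.
  by congr (Complex _ _); ring.
split=> [[v0 h]|[v0 h1 h2]].
  move: h; rewrite e => -[/eqP h1 /eqP]; rewrite mulf_eq0 pnatr_eq0/= => /eqP h2.
  by split => //; apply/eqP; rewrite -subr_eq0.
by split => //; rewrite e h1 h2 subrr mulr0.
Qed.

End Levi.

(** * Flat functions and cutoffs *)

Section FlatExp.
Context {R : realType}.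
Implicit Types (p : {poly R}) (t : R).

(* The class of functions [p(1/t) exp(-1/t)], extended by [0] to [t <= 0], is
   closed under differentiation. *)
Definition flat p t : R := if 0 < t then p.[t^-1] * expR (- t^-1) else 0.

(** With [s = 1/t], the derivative of [p(s) exp(-s)] in [t] is [s^2 (p(s) - p'(s)) exp(-s)]. *)
Definition dflat p : {poly R} := 'X ^+ 2 * (p - p^`()).

Lemma poly_le_expR p : exists C, 0 <= C /\ forall s : R, 0 <= s -> `|p.[s]| <= C * expR s.
Proof.
exists (\sum_(i < size p) `|p`_i| * i`!%:R); split.
  by apply: sumr_ge0 => i _; rewrite mulr_ge0.
move=> s s0; rewrite horner_coef mulr_suml (le_trans (ler_norm_sum _ _ _))// ler_sum// => i _.
rewrite normrM -mulrA ler_wpM2l// ger0_norm ?exprn_ge0//.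
case: (nat_of_ord i) => [|n].
  by rewrite expr0 fact0 mul1r (le_trans _ (expR_ge1Dx s))// lerDl.
rewrite mulrC -ler_pdivrMr ?ltr0n ?fact_gt0//.
by rewrite (le_trans _ (expR_ge1Dxn n s0))// lerDr.
Qed.

Lemma is_derive_flat p t : is_derive t (1 : R) (flat p : R -> R^o) (flat (dflat p) t).
Proof.
have [t0|t0|->] := ltgtP t 0.
- have -> : flat (dflat p) t = 0 by rewrite /flat ltNge (ltW t0).
  have E : \near t, (cst 0 : R -> R^o) t = flat p t.
    near=> s; rewrite /flat ifN // -leNgt ltW//.
    by near: s; exact: lt_nbhsl.
  apply: (near_eq_is_derive E).
- have E : \near t, (fun t : R => p.[t^-1] * expR (- t^-1) : R^o) t = flat p t.
    near=> s; rewrite /flat ifT //.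
    by near: s; exact: lt_nbhsr.
  apply: (near_eq_is_derive E).
  have tn0 : t != 0 by rewrite gt_eqF.
  have dv : is_derive t (1 : R) (fun t : R => t^-1 : R^o) (- t ^- 2).
    have did := @derivable_id R R^o t 1.
    split; first exact: (@derivableV R R^o id t 1 tn0 did).
    by rewrite (@deriveV R R^o id t 1 tn0 did) derive_id [_ *: _]mulr1.
  have dp := @is_derive1_comp _ (horner p) (fun t : R => t^-1) t _ _ (is_derive_poly p t^-1) dv.
  have dn : is_derive t (1 : R) (fun t : R => - t^-1 : R^o) (t ^- 2).
    by have := is_deriveN dv; rewrite opprK.
  have de := @is_derive1_comp _ expR (fun t : R => - t^-1) t _ _ (is_derive_expR _) dn.
  have := is_deriveM dp de; move/is_derive_eq; apply.
  rewrite /flat t0 /dflat !hornerE /= -!exprVn.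
  rewrite -[_ *: _]/(_ * _) -[X in _ + X]/(_ * _) /=.
  set e := expR _; set a := p.[_]; set b := p^`().[_]; set s := t^-1.
  by ring.
have -> : flat (dflat p) 0 = 0 by rewrite /flat ltxx.
(* At the origin the difference quotient equals [h * (s^2 p(s) exp(-s))] with [s = 1/h > 0], which
   is at most [C * |h|]. *)
have [C [C0 hC]] := poly_le_expR ('X ^+ 2 * p).
have L : h^-1 *: (flat p (h + 0) - flat p 0) @[h --> 0^'] --> (0 : R^o).
  apply/cvgrPdist_le => e e0; near=> h.
  rewrite addr0 {2}/flat ltxx subr0 sub0r normrN.
  have hn0 : h != 0 by near: h; exact: nbhs_dnbhs_neq.
  have hC1 : `|h| * C <= e.
    have : `|h| <= e / (C + 1).
      near: h; apply: dnbhs0_le; rewrite divr_gt0// ltr_wpDl//.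
    rewrite ler_pdivlMr ?ltr_wpDl// => /(le_trans _); apply.
    by rewrite ler_wpM2l// lerDl.
  rewrite /flat; case: ltP => h0; last by rewrite scaler0 normr0 ltW.
  have h10 : 0 <= h^-1 by rewrite invr_ge0 ltW.
  have := hC _ h10; rewrite !hornerE => hC2.
  rewrite -[_ *: _]/(_ * _).
  have -> : h^-1 * (p.[h^-1] * expR (- h^-1)) =
     h * ((h^-1 * h^-1 * p.[h^-1]) * (expR h^-1)^-1).
    by rewrite expRN !mulrA mulfV// mul1r.
  rewrite normrM (le_trans _ hC1)// ler_wpM2l// normrM.
  rewrite normfV (gtr0_norm (expR_gt0 _)).
  by rewrite ler_pdivrMr ?expR_gt0// -expr2.
split.
  by apply/cvg_ex; exists 0; under eq_fun do rewrite /= scaler1.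
rewrite -derive1E; exact: cvg_lim L.
Unshelve. all: by end_near. Qed.

Lemma flat_continuous p : continuous (flat p).
Proof.
move=> t; apply: differentiable_continuous; apply/derivable1_diffP.
by case: (is_derive_flat p t).
Qed.

Lemma flat_le0 p t : t <= 0 -> flat p t = 0.
Proof. by rewrite /flat ltNge => ->. Qed.

Lemma deriv1p : (1 : {poly R})^`() = 0.
Proof. by rewrite -polyC1 derivC. Qed.

Lemma flat1_gt0 t : 0 < t -> 0 < flat 1 t.
Proof. by move=> t0; rewrite /flat t0 hornerC mul1r expR_gt0. Qed.

Lemma flat1_ge0 t : 0 <= flat 1 t.
Proof. by case: (ltP 0 t) => h; [exact/ltW/flat1_gt0|rewrite flat_le0]. Qed.

End FlatExp.

Section SmoothComp.
Context {R : realType}.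
Implicit Types (f g u : C3 R -> R) (q v w : C3 R) (p : {poly R}).

Lemma derive_comp1 (h : R -> R) g q v (d : R) :
  is_derive (g q) (1 : R) (h : R -> R^o) d -> derivable (g : C3 R -> R^o) q v ->
  is_derive q v (h \o g : C3 R -> R^o) (d * 'D_v (g : C3 R -> R^o) q).
Proof.
move=> dh dg.
have line (f : C3 R -> R) : 'D_v (f : C3 R -> R^o) q = 'D_1 ((fun s : R => f (s *: v + q)) : R -> R^o) 0.
  rewrite /derive.
  suff -> : (fun s : R => s^-1 *: ((f \o shift q) (s *: v) - f q)) =
    (fun s : R => s^-1 *: (((fun s : R => f (s *: v + q)) \o shift 0) (s *: (1 : R)) -
       f (0 *: v + q))) by [].
  by apply/funext => s /=; rewrite addr0 scale0r add0r [_ *: 1]mulr1.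
have dg1 : is_derive (0 : R) (1 : R) ((fun s : R => g (s *: v + q)) : R -> R^o) ('D_v (g : C3 R -> R^o) q).
  apply: DeriveDef; last by rewrite line.
  by move: dg => /derivable1P.
have dh' : is_derive ((fun s : R => g (s *: v + q)) 0) (1 : R) (h : R -> R^o) d.
  by rewrite scale0r add0r.
have [h1 h2] := is_derive1_comp dh' dg1.
by split; [exact/derivable1P|rewrite line].
Qed.

Lemma partial1_flat p g k : smooth g ->
  partial1 k (fun q => flat p (g q)) = fun q => flat (dflat p) (g q) * partial1 k g q.
Proof.
move=> sg; apply/funext => q.
have [_ h] := derive_comp1 (is_derive_flat p (g q)) (@smooth_derivable _ _ q k sg).
exact: h.
Qed.

Lemma smooth_flat p g : smooth g -> smooth (fun q => flat p (g q)).
Proof.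
move=> sg; apply/CnP => n; elim: n p => [|n IH] p.
  move=> q; apply: continuous_comp; first exact: smooth_continuous.
  exact: flat_continuous.
split.
- move=> q; apply: continuous_comp; first exact: smooth_continuous.
  exact: flat_continuous.
- move=> k q.
  by have [] := derive_comp1 (is_derive_flat p (g q)) (@smooth_derivable _ _ q k sg).
- move=> k; rewrite partial1_flat//; apply: CnM; first exact: IH.
  by have /CnP := smooth_partial1 k sg; exact.
Qed.

Lemma grad_flat p g q v : smooth g ->
  grad (fun q => flat p (g q)) q v = flat (dflat p) (g q) * grad g q v.
Proof.
move=> sg; rewrite /grad mulr_sumr; apply: eq_bigr => k _.
by rewrite partial1_flat// mulrCA.
Qed.

Lemma hess_flat p g q v w : smooth g ->
  hess (fun q => flat p (g q)) q v w =
  flat (dflat (dflat p)) (g q) * (grad g q v * grad g q w) + flat (dflat p) (g q) * hess g q v w.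
Proof.
move=> sg; rewrite /hess /grad mulr_suml !mulr_sumr -big_split/=.
apply: eq_bigr => j _; rewrite !mulr_sumr -big_split/=; apply: eq_bigr => k _.
rewrite (partial1_flat p k sg) partial1M; last first.
- by move=> q'; apply: smooth_derivable; exact: smooth_partial1.
- by move=> q'; apply: smooth_derivable; exact: smooth_flat.
rewrite (partial1_flat _ j sg).
move: (flat _ _) (flat _ _) (partial1 j g q) (partial1 k g q) (partial1 j _ q) => a b c d e.
move: (v ord0 j) (w ord0 k) => x y; ring.
Qed.

(** Equal to 1 up to [t = 1] and to 0 from [t = 2] on. The denominator is positive because [2 - t]
    and [t - 1] are never both nonpositive. *)
Definition step (t : R) : R := flat 1 (2 - t) / (flat 1 (2 - t) + flat 1 (t - 1)).

Lemma step_den_gt0 t : 0 < flat 1 (2 - t) + flat 1 (t - 1) :> R.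
Proof.
case: (ltP 1 t) => t1.
  by rewrite ltr_wpDl ?flat1_ge0// flat1_gt0// subr_gt0.
by rewrite ltr_pwDl ?flat1_ge0// flat1_gt0// subr_gt0 (le_lt_trans t1)// ltr1n.
Qed.

Lemma step_ge0 t : 0 <= step t.
Proof. by rewrite divr_ge0// ?flat1_ge0// ltW// step_den_gt0. Qed.

Lemma step_le1 t : step t <= 1.
Proof. by rewrite ler_pdivrMr ?step_den_gt0// mul1r lerDl flat1_ge0. Qed.

Lemma step1 t : t <= 1 -> step t = 1.
Proof.
move=> t1; rewrite /step (@flat_le0 _ _ (t - 1)) ?subr_le0// addr0 divff//.
by rewrite gt_eqF// flat1_gt0// subr_gt0 (le_lt_trans t1)// ltr1n.
Qed.

Lemma step0 t : 2 <= t -> step t = 0.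
Proof. by move=> t2; rewrite /step flat_le0 ?mul0r// subr_le0. Qed.

Lemma smooth_step g : smooth g -> smooth (fun q => step (g q)).
Proof.
move=> sg.
have s1 : smooth (fun q => flat 1 (2 - g q)).
  by apply: smooth_flat; exact: (smoothB (smooth_cst 2) sg).
have s2 : smooth (fun q => flat 1 (g q - 1)).
  by apply: smooth_flat; exact: (smoothB sg (smooth_cst 1)).
have s3 := smoothD s1 s2.
have s4 : smooth (fun q => (flat 1 (2 - g q) + flat 1 (g q - 1))^-1).
  by apply: smoothV s3 => q; rewrite gt_eqF// step_den_gt0.
exact: (smoothM s1 s4).
Qed.

(** A function of [x] vanishing for [|x|^2 <= M] and strictly plurisubharmonic beyond. With
    [s = |x|^2 - M], the factor [s] makes the profile convex: [exp(-1/s)] is concave for [s > 1/2],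
    whereas [s exp(-1/s)] has second derivative [s^-3 exp(-1/s)]. *)
Definition barrier (M : R) (q : C3 R) : R := (sqre q - M) * flat 1 (sqre q - M).

Lemma smooth_sqreB M : smooth (fun q : C3 R => sqre q - M).
Proof. exact: (smoothB (@smooth_sqre R) (smooth_cst M)). Qed.

Lemma smooth_barrier M : smooth (barrier M).
Proof. by apply: smoothM; [|apply: smooth_flat]; exact: smooth_sqreB. Qed.

Lemma barrier0 M q : sqre q <= M -> barrier M q = 0.
Proof. by move=> h; rewrite /barrier flat_le0 ?mulr0// subr_le0. Qed.

(** For [s > 0] the Hessian along [w] is [s^-3 exp(-1/s)] times the square of a first derivative,
    plus [(1/s + 1) exp(-1/s)] times [2 * sqre w]. Discarding the first term and [1/s], then adding
    the cases [w = v] and [w = Jmap v], gives the bound. *)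
Lemma levi_barrier M q v :
  2 * flat 1 (sqre q - M) * (sqre v + sqim v) <= levi (barrier M) q v.
Proof.
have sg := smooth_sqreB M.
have hs w : hess (fun q : C3 R => sqre q - M) q w w = 2 * sqre w.
  have e := hessD q w w (@smooth_sqre R) (smooth_cst (- M)).
  by apply: (etrans e); rewrite hess_cst addr0 hess_sqre.
pose s := sqre q - M.
have hb w : hess (barrier M) q w w =
  (s * flat (dflat (dflat 1)) s + 2 * flat (dflat 1) s) * (grad (fun q => sqre q - M) q w) ^+ 2
  + (s * flat (dflat 1) s + flat 1 s) * (2 * sqre w).
  rewrite /barrier (hessM q w w sg (smooth_flat 1 sg)) (hess_flat 1 q w w sg) hs grad_flat// -/s.
  move: (grad _ _ _) (flat _ _) (flat _ _) (flat _ _) (sqre w) => a b c d e; ring.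
have [s0|s0] := leP s 0.
  by rewrite -/s /levi !hb !flat_le0// !(mulr0, mul0r, addr0).
rewrite -/s; pose e := flat 1 s.
have e0 : 0 < e by exact: flat1_gt0.
have f1 : flat (dflat 1) s = s^-1 ^+ 2 * e.
  rewrite /e /flat s0 /dflat deriv1p subr0 mulr1 hornerXn hornerC mul1r. by [].
have f2 : flat (dflat (dflat 1)) s = (s^-1 ^+ 4 - 2 * s^-1 ^+ 3) * e.
  rewrite /e /flat s0 {1}/dflat /dflat deriv1p subr0 mulr1 derivXn /= expr1 !hornerE /=.
  by move: (s^-1) (expR _) => x y; ring.
have key w : 2 * e * sqre w <= hess (barrier M) q w w.
  rewrite hb f1 f2 -/e.
  have -> : s * ((s^-1 ^+ 4 - 2 * s^-1 ^+ 3) * e) + 2 * (s^-1 ^+ 2 * e) = s^-1 ^+ 3 * e.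
    by field; rewrite gt_eqF.
  have -> : s * (s^-1 ^+ 2 * e) + e = (s^-1 + 1) * e by field; rewrite gt_eqF.
  have si : 0 <= s^-1 by rewrite invr_ge0 ltW.
  rewrite -[leLHS]add0r lerD//.
    by rewrite mulr_ge0 ?sqr_ge0// mulr_ge0 ?exprn_ge0// ltW.
  rewrite mulrAC [leRHS]mulrAC ler_wpM2r ?(ltW e0)//.
  by rewrite ler_peMl ?lerDr// mulr_ge0// re2_ge0.
by rewrite mulrDr -[sqim v]sqre_Jmap /levi lerD.
Qed.

End SmoothComp.

(** * Hahn-Banach *)

Section HahnBanach.
Context {R : realType} {V : lmodType R}.
Variable D : set V.
Hypothesis D0 : D 0.
Hypothesis DP : forall a x y, D x -> D y -> D (a *: x + y).

Let DD x y : D x -> D y -> D (x + y).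
Proof. by move=> Dx Dy; rewrite -[x]scale1r; exact: DP. Qed.

Let DZ a x : D x -> D (a *: x).
Proof. by move=> Dx; rewrite -[_ *: _]addr0; exact: DP. Qed.

Let DN x : D x -> D (- x).
Proof. by move=> Dx; rewrite -scaleN1r; exact: DZ. Qed.

(** Relative to the subspace [D], because the gauge to which this applies is a real infimum
    controlled only on bounded data. *)
Definition sublinear_on (p : V -> R) : Prop :=
  (forall x y, D x -> D y -> p (x + y) <= p x + p y) /\
  (forall c x, 0 < c -> D x -> p (c *: x) = c * p x).

Lemma homogeneous_le q : (forall c x, 0 < c -> D x -> q (c *: x) <= c * q x) ->
  forall c x, 0 < c -> D x -> q (c *: x) = c * q x.
Proof.
move=> half c x c0 Dx; apply/eqP; rewrite eq_le half//=.
have ci : 0 < c^-1 by rewrite invr_gt0.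
have := half _ _ ci (DZ c Dx); rewrite scalerA mulVf ?gt_eqF// scale1r => h.
by rewrite mulrC -ler_pdivlMr// mulrC.
Qed.

Lemma sublinear0 p : sublinear_on p -> p 0 = 0.
Proof.
move=> [_ /(_ 2 0 ltac:(by []) D0)]; rewrite scaler0 => h; lra.
Qed.

Lemma sublinear_opp p x : sublinear_on p -> D x -> - p (- x) <= p x.
Proof.
move=> sp Dx; have [h _] := sp; have := h _ _ Dx (DN Dx).
by rewrite subrr (sublinear0 sp) => h'; lra.
Qed.

(** Zorn's lemma for the reversed pointwise order. The infimum of a chain is finite since every
    sublinear functional below [P] is at least [- P (- x)] at [x], and it is subadditive since two
    members of a chain can be replaced by the smaller one. *)
Lemma sublinear_minimal (P : V -> R) : sublinear_on P ->
  exists p, [/\ sublinear_on p, forall x, D x -> p x <= P x &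
    forall q, sublinear_on q -> (forall x, D x -> q x <= p x) ->
      forall x, D x -> p x <= q x].
Proof.
move=> sP.
pose T := {p : V -> R | sublinear_on p /\ forall x, D x -> p x <= P x}.
have PP : forall x, D x -> P x <= P x by [].
pose t0 : T := exist _ P (conj sP PP).
pose r (s t : T) : bool := `[< forall x, D x -> sval t x <= sval s x >].
have lb (t : T) x : D x -> - P (- x) <= sval t x.
  case: t => p [sp pP] /= Dx; rewrite (le_trans _ (sublinear_opp sp Dx))//.
  by rewrite lerN2 pP//; exact: DN.
have [||A totA|[p [sp pP]] pmax] := @ZL_preorder T t0 r.
- by move=> t; apply/asboolP.
- move=> s t u /asboolP st /asboolP tu; apply/asboolP => x Dx.
  exact: le_trans (tu _ Dx) (st _ Dx).
- have [[s0 As0]|A0] := pselect (exists s, A s); last first.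
    by exists t0 => s As; exfalso; apply: A0; exists s.
  pose E x := [set sval t x | t in A].
  have E0 x : E x !=set0 by exists (sval s0 x), s0.
  have Elb x : D x -> has_lbound (E x).
    by move=> Dx; exists (- P (- x)) => _ [t At <-]; exact: lb.
  pose q x := inf (E x).
  have qle t x : A t -> D x -> q x <= sval t x.
    by move=> At Dx; apply: ge_inf; [exact: Elb|exists t].
  have leq x m : (forall t, A t -> m <= sval t x) -> m <= q x.
    by move=> h; apply: lb_le_inf => // _ [t At <-]; exact: h.
  have sq : sublinear_on q.
    split.
      move=> x y Dx Dy; rewrite -lerBlDr; apply: (@leq) => s As.
      rewrite lerBlDr -lerBlDl.
      apply: (@leq) => t At; rewrite lerBlDl.
      have [/asboolP h|/asboolP h] := totA _ _ As At.
        rewrite (le_trans (qle t _ At (DD Dx Dy)))//.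
        case: (svalP t) => [[ht _] _]; rewrite (le_trans (ht _ _ Dx Dy))//.
        by rewrite lerD2r h.
      rewrite (le_trans (qle s _ As (DD Dx Dy)))//.
      case: (svalP s) => [[ht _] _]; rewrite (le_trans (ht _ _ Dx Dy))//.
      by rewrite lerD2l h.
    apply: homogeneous_le => c x c0 Dx; rewrite mulrC -ler_pdivrMr//; apply: (@leq) => t At.
    rewrite ler_pdivrMr// mulrC; case: (svalP t) => [[_ ht] _]; rewrite -ht//.
    by apply: qle => //; exact: DZ.
  have qP x : D x -> q x <= P x.
    move=> Dx; rewrite (le_trans (qle s0 _ As0 Dx))//.
    by case: (svalP s0) => _; exact.
  exists (exist _ q (conj sq qP)) => s As; apply/asboolP => x Dx /=.
  exact: qle.
exists p; split => // q sq qp x Dx.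
have qP y : D y -> q y <= P y by move=> Dy; exact: le_trans (qp _ Dy) (pP _ Dy).
have := pmax (exist _ q (conj sq qP)).
by rewrite /r => /(_ ltac:(by apply/asboolP)) /asboolP/(_ x Dx).
Qed.

(* A minimal sublinear functional [p] is linear: for fixed [y] the functional
   [x |-> inf_(t >= 0) (p (x + t y) - t p y)] is sublinear and below [p], hence
   equal to [p], and its value at [- y] is at most [- p y]. *)
Theorem hahn_banach (P : V -> R) : sublinear_on P ->
  exists F : V -> R, [/\ forall a x y, D x -> D y -> F (a *: x + y) = a * F x + F y &
    forall x, D x -> F x <= P x].
Proof.
move=> /sublinear_minimal[p [sp pP pmin]]; exists p; split => //.
have odd y : D y -> p (- y) = - p y.
  move=> Dy; apply/eqP; rewrite eq_le; apply/andP; split; last first.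
    by have := sublinear_opp sp (DN Dy); rewrite opprK.
  have [psub phom] := sp.
  pose E x := [set p (x + t *: y) - t * p y | t in [set t | 0 <= t]].
  have E0 x : E x !=set0 by exists (p (x + 0 *: y) - 0 * p y), 0 => /=.
  have Elb x : D x -> lbound (E x) (- p (- x)).
    move=> Dx _ [t /= t0 <-].
    have Dt : D (t *: y) by exact: DZ.
    have tp : t * p y = p (t *: y).
      by have [->|t1] := eqVneq t 0; [rewrite mul0r scale0r (sublinear0 sp)|
        rewrite phom// lt0r t1].
    rewrite tp lerBrDr addrC.
    have := psub _ _ (DD Dx Dt) (DN Dx).
    by rewrite [x + _]addrC addrK => h; rewrite lerBlDr.
  pose q x := inf (E x).
  have qle x t : D x -> 0 <= t -> q x <= p (x + t *: y) - t * p y.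
    move=> Dx t0; apply: ge_inf; last by exists t.
    by exists (- p (- x)); exact: Elb.
  have leq x m : (forall t, 0 <= t -> m <= p (x + t *: y) - t * p y) -> m <= q x.
    by move=> h; apply: lb_le_inf => // _ [t /= t0 <-]; exact: h.
  have sq : sublinear_on q.
    split.
      move=> x z Dx Dz; rewrite -lerBlDr; apply: (@leq) => s s0.
      rewrite lerBlDr -lerBlDl.
      apply: (@leq) => t t0; rewrite lerBlDl.
      rewrite (le_trans (qle _ (s + t) (DD Dx Dz) (addr_ge0 s0 t0)))//.
      have -> : x + z + (s + t) *: y = (x + s *: y) + (z + t *: y).
        by rewrite scalerDl addrACA.
      have := psub _ _ (DD Dx (DZ s Dy)) (DD Dz (DZ t Dy)) => h.
      rewrite mulrDl; lra.
    apply: homogeneous_le => c x c0 Dx; rewrite mulrC -ler_pdivrMr//; apply: (@leq) => t t0.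
    rewrite ler_pdivrMr// mulrC mulrBr -(phom c (x + t *: y) c0 (DD Dx (DZ t Dy))).
    rewrite scalerDr scalerA mulrA; apply: qle; first exact: DZ.
    by rewrite mulr_ge0// ltW.
  have qp x : D x -> q x <= p x.
    by move=> Dx; have := qle _ 0 Dx (lexx _); rewrite scale0r addr0 mul0r subr0.
  rewrite (le_trans (pmin q sq qp _ (DN Dy)))//.
  by have := qle _ 1 (DN Dy) ler01; rewrite scale1r addNr (sublinear0 sp) mul1r sub0r.
have [psub phom] := sp.
have add x y : D x -> D y -> p (x + y) = p x + p y.
  move=> Dx Dy; apply/eqP; rewrite eq_le psub//=.
  have := psub _ _ (DD Dx Dy) (DN Dy).
  by rewrite addrK (odd _ Dy) => h; lra.
move=> a x y Dx Dy; rewrite add//; last exact: DZ.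
congr (_ + _); have [a0|a0|->] := ltgtP a 0; last first.
- by rewrite scale0r mul0r (sublinear0 sp).
- by rewrite phom.
- rewrite -[a]opprK scaleNr odd; last exact: DZ.
  by rewrite (phom _ _ _ Dx) ?oppr_gt0// [RHS]mulNr.
Qed.

End HahnBanach.

(** * A Riesz representation theorem *)

Lemma lipschitz_cont (R : realType) n (f : 'rV[R]_n -> R) (C : R) :
  (forall x y, `|f x - f y| <= C * `|x - y|) -> continuous f.
Proof.
move=> fC x; apply/(@cvgrPdist_le _ _ _ (nbhs x)) => e e0.
apply/nbhs_ballP; exists (e / (`|C| + 1)) => /= [|y].
  by rewrite divr_gt0// ltr_wpDl.
rewrite -ball_normE /= ltr_pdivlMr ?ltr_wpDl// => h.
rewrite (le_trans (fC x y))// (le_trans _ (ltW h))// mulrC ler_wpM2l//.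
by rewrite (le_trans (ler_norm C))// lerDl.
Qed.

Lemma dist_function (R : realType) n (A : set 'rV[R]_n) : closed A -> A !=set0 ->
  exists h : 'rV[R]_n -> R, [/\ continuous h, forall x, 0 <= h x,
    forall x, 0 < h x <-> ~ A x & forall x z, A z -> h x <= `|x - z|].
Proof.
move=> cA [a0 Aa0].
pose E x := [set `|x - z| | z in A].
have E0 x : E x !=set0 by exists `|x - a0|, a0.
have Elb x : has_lbound (E x) by exists 0 => _ [z _ <-].
pose h x := inf (E x).
have h0 x : 0 <= h x by apply: lb_le_inf => // _ [z _ <-].
have hle x z : A z -> h x <= `|x - z| by move=> Az; apply: ge_inf => //; exists z.
have half x y : h x - h y <= `|x - y|.
  rewrite lerBlDr -lerBlDl; apply: lb_le_inf => // _ [z Az <-].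
  rewrite lerBlDl (le_trans (hle x z Az))// -[x - z](subrKA y).
  exact: ler_normD.
exists h; split => //.
  apply: (@lipschitz_cont _ _ _ 1) => x y; rewrite mul1r ler_norml half andbT.
  by rewrite lerNl opprB distrC half.
move=> x; split=> [hx Ax|nAx].
  by move: hx; rewrite ltNge => /negP; apply; have := hle x x Ax; rewrite subrr normr0.
have : open (~` A) by rewrite openC.
rewrite openE => /(_ x nAx) /nbhs_ballP[d /= d0 dA].
apply: (lt_le_trans d0); apply: lb_le_inf => // _ [z Az <-].
rewrite leNgt; apply/negP => xz; apply: (dA z) => //.
by rewrite -ball_normE.
Qed.

Section Riesz.
Context {R : realType}.
Local Notation T := (C3 R).
Implicit Types (f g : T -> R) (E X : set T).

Definition cbounded f : Prop := continuous f /\ exists M, forall x, `|f x| <= M.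

Lemma cbounded_cst (a : R) : cbounded (cst a).
Proof. by split; [exact: cst_continuous|exists `|a|]. Qed.

Lemma cboundedD f g : cbounded f -> cbounded g -> cbounded (fun x => f x + g x).
Proof.
move=> [cf [M hM]] [cg [N hN]]; split.
  by move=> x; exact: (cvgD (cf x) (cg x)).
by exists (M + N) => x; rewrite (le_trans (ler_normD _ _))// lerD.
Qed.

Lemma cboundedM f g : cbounded f -> cbounded g -> cbounded (fun x => f x * g x).
Proof.
move=> [cf [M hM]] [cg [N hN]]; split.
  by move=> x; exact: (cvgM (cf x) (cg x)).
by exists (M * N) => x; rewrite normrM ler_pM.
Qed.

Lemma cboundedZ (a : R) f : cbounded f -> cbounded (fun x => a * f x).
Proof. by apply: cboundedM; exact: cbounded_cst. Qed.

Lemma cboundedB f g : cbounded f -> cbounded g -> cbounded (fun x => f x - g x).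
Proof.
move=> bf bg; have := cboundedD bf (cboundedZ (-1) bg).
by congr cbounded; apply/funext => x; rewrite mulN1r.
Qed.

Lemma cbounded_sum (I : Type) (s : seq I) (F : I -> T -> R) :
  (forall i, cbounded (F i)) -> cbounded (fun x => \sum_(i <- s) F i x).
Proof.
move=> bF; elim: s => [|i s IH].
  rewrite (_ : (fun x => _) = cst 0); first exact: cbounded_cst.
  by apply/funext => x; rewrite big_nil.
rewrite (_ : (fun x => _) = fun x => F i x + \sum_(i <- s) F i x); last first.
  by apply/funext => x; rewrite big_cons.
exact: cboundedD.
Qed.

Lemma cbounded_max f (a : R) : cbounded f -> cbounded (fun x => Num.max (f x) a).
Proof.
move=> [cf [M hM]]; split.
  by move=> x; apply: continuous_max; [exact: cf|exact: cst_continuous].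
exists (M + `|a|) => x; rewrite /Num.max; case: ifP => _.
  by rewrite ler_wpDl// (le_trans _ (hM x)).
by rewrite (le_trans (hM x))// lerDl.
Qed.

Lemma cbounded_min f (a : R) : cbounded f -> cbounded (fun x => Num.min (f x) a).
Proof.
move=> bf; have := cboundedZ (-1) (cbounded_max (- a) (cboundedZ (-1) bf)).
by congr cbounded; apply/funext => x; rewrite !mulN1r oppr_max !opprK.
Qed.

Variables (L : (T -> R) -> R) (S : set T).
Hypothesis LP : forall a f g, cbounded f -> cbounded g ->
  L (fun x => a * f x + g x) = a * L f + L g.
Hypothesis L_ge0 : forall f, cbounded f -> (forall x, S x -> 0 <= f x) -> 0 <= L f.
Hypothesis L1 : L (cst 1) = 1.
(** Positivity alone would allow mass to escape to infinity, since [L] lives on bounded continuous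
    functions over a noncompact space. *)
Hypothesis L_tight : forall e, 0 < e -> exists A, [/\ compact A, A `<=` S &
  forall f, cbounded f -> (forall x, 0 <= f x <= 1) -> (forall x, A x -> f x = 0) ->
    L f <= e].

Lemma LD f g : cbounded f -> cbounded g -> L (fun x => f x + g x) = L f + L g.
Proof.
move=> bf bg; rewrite -[L f]mul1r -LP//; congr L.
by apply/funext => x; rewrite mul1r.
Qed.

Lemma L0 : L (cst 0) = 0.
Proof.
have := LD (cbounded_cst 0) (cbounded_cst 0).
rewrite (_ : (fun x => _) = cst 0); last by apply/funext => x; rewrite addr0.
by move=> h; apply: (@addrI _ (L (cst 0))); rewrite -h addr0.
Qed.

Lemma LZ (a : R) f : cbounded f -> L (fun x => a * f x) = a * L f.
Proof.
move=> bf; rewrite -[RHS]addr0 -L0 -LP//; last exact: cbounded_cst.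
by congr L; apply/funext => x; rewrite addr0.
Qed.

Lemma LB f g : cbounded f -> cbounded g -> L (fun x => f x - g x) = L f - L g.
Proof.
move=> bf bg; rewrite -mulN1r -LZ// -LD//; last exact: cboundedZ.
by congr L; apply/funext => x; rewrite mulN1r.
Qed.

Lemma L_sum (I : Type) (s : seq I) (F : I -> T -> R) :
  (forall i, cbounded (F i)) -> L (fun x => \sum_(i <- s) F i x) = \sum_(i <- s) L (F i).
Proof.
move=> bF; elim: s => [|i s IH].
  rewrite big_nil -[RHS]L0; congr L.
  by apply/funext => x; rewrite big_nil.
rewrite (_ : (fun x => _) = fun x => F i x + \sum_(i <- s) F i x); last first.
  by apply/funext => x; rewrite big_cons.
by rewrite LD ?IH ?big_cons//; exact: cbounded_sum.
Qed.

Lemma L_le f g : cbounded f -> cbounded g -> (forall x, S x -> f x <= g x) -> L f <= L g.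
Proof.
move=> bf bg h; rewrite -subr_ge0 -LB//; apply: L_ge0; first exact: cboundedB.
by move=> x Sx; rewrite subr_ge0 h.
Qed.

Lemma L_cst (a : R) : L (cst a) = a.
Proof.
rewrite -[RHS]mulr1 -L1 -LZ; last exact: cbounded_cst.
by congr L; apply/funext => x; rewrite /cst mulr1.
Qed.

Local Open Scope ereal_scope.

(* Covering by countable sums of functions, rather than by open sets, makes
   countable subadditivity immediate. *)
Definition covers E (F : nat -> T -> R) : Prop :=
  [/\ forall n, cbounded (F n), forall n x, (0 <= F n x)%R &
    forall x, E x -> 1 <= \esum_(n in [set: nat]) (F n x)%:E].

Definition rmu E : \bar R :=
  ereal_inf [set \esum_(n in [set: nat]) (L (F n))%:E | F in covers E].

Lemma LF_ge0 f : cbounded f -> (forall x, 0 <= f x)%R -> 0 <= (L f)%:E.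
Proof. by move=> bf f0; rewrite lee_fin; apply: L_ge0. Qed.

Lemma rmu_ge0 E : 0 <= rmu E.
Proof.
apply: le_ereal_inf_tmp => _ [F [bF F0 _] <-]; apply: esum_ge0 => n _.
exact: LF_ge0.
Qed.

Lemma rmu_le E F : covers E F -> rmu E <= \esum_(n in [set: nat]) (L (F n))%:E.
Proof. by move=> cF; apply: ereal_inf_lbound; exists F. Qed.

(** A doubly indexed cover is a cover after re-indexing along a bijection of [nat] with [nat * nat];
    sums of nonnegative terms may be taken in any order. *)
Lemma rmu_le2 E (F : nat -> nat -> T -> R) :
  (forall i j, cbounded (F i j)) -> (forall i j x, 0 <= F i j x)%R ->
  (forall x, E x -> 1 <= \esum_(i in [set: nat]) \esum_(j in [set: nat]) (F i j x)%:E) ->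
  rmu E <= \esum_(i in [set: nat]) \esum_(j in [set: nat]) (L (F i j))%:E.
Proof.
move=> bF F0 EF.
have prodT : [set: nat] `*`` (fun=> [set: nat]) = [set: nat * nat].
  by apply/seteqP; split => // x _; split.
have /card_esym/ppcard_eqP[f] := card_nat2.
have bij : set_bij setT setT f by exact: bij.
have e (a : nat -> nat -> \bar R) : (forall i j, 0 <= a i j) ->
   \esum_(i in [set: nat]) \esum_(j in [set: nat]) a i j =
   \esum_(n in [set: nat]) a (f n).1 (f n).2.
  by move=> a0; rewrite esum_esum// prodT (@reindex_esum R nat (nat * nat)%type setT setT f _ bij).
rewrite e; last by move=> i j; exact: LF_ge0.
apply: (@rmu_le _ (fun n => F (f n).1 (f n).2)); split => // x Ex.
have := EF x Ex; rewrite e// => i j; rewrite lee_fin; exact: F0.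
Qed.

Lemma esum_only0 (a : \bar R) :
  \esum_(n in [set: nat]) (if n == 0%N then a else 0) = \esum_(n in [set 0%N]) a.
Proof.
rewrite [RHS]esum_mkcond; apply: eq_esum => n _.
suff -> : (n \in [set 0%N]) = (n == 0%N) by [].
by apply/idP/eqP; rewrite inE.
Qed.

Lemma rmu_le1 E f : cbounded f -> (forall x, 0 <= f x)%R ->
  (forall x, E x -> 1 <= f x)%R -> rmu E <= (L f)%:E.
Proof.
move=> bf f0 Ef.
pose F n := if n == 0%N then f else cst 0%R.
have -> : (L f)%:E = \esum_(n in [set: nat]) (L (F n))%:E.
  rewrite (eq_esum (b := fun n => if n == 0%N then (L f)%:E else 0)).
    by rewrite esum_only0 esum_set1//; exact: LF_ge0.
  by move=> n _; rewrite /F; case: ifP => // _; rewrite L0.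
apply: rmu_le; split.
- by move=> n; rewrite /F; case: ifP => // _; exact: cbounded_cst.
- by move=> n x; rewrite /F; case: ifP.
- move=> x Ex; rewrite (eq_esum (b := fun n => if n == 0%N then (f x)%:E else 0)).
    by rewrite esum_only0 esum_set1 ?lee_fin ?Ef.
  by move=> n _; rewrite /F; case: ifP.
Qed.

Lemma rmu0 : rmu set0 = 0.
Proof.
apply/eqP; rewrite eq_le rmu_ge0 andbT -[leRHS]/(0%R%:E) -L0.
by apply: rmu_le1 => //; exact: cbounded_cst.
Qed.

Lemma le_rmu : {homo rmu : A B / A `<=` B >-> A <= B}.
Proof.
move=> A B AB; apply: le_ereal_inf_tmp => _ [F [bF F0 FB] <-].
by apply: rmu_le; split => // x Ax; apply: FB; exact: AB.
Qed.

Lemma esum_ge1 (a : nat -> \bar R) i : (forall i, 0 <= a i) ->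
  a i <= \esum_(n in [set: nat]) a n.
Proof.
move=> a0; apply: esum_ge; exists [set i].
  by split => //; exact: finite_set1.
by rewrite fsbig_set1.
Qed.

Lemma rmu_sigma_subadditive : sigma_subadditive rmu.
Proof.
move=> A; have [[i ioo]|] := pselect (exists i, rmu (A i) = +oo).
  rewrite (eseries_pinfty _ _ ioo) ?leey// => n _.
  by rewrite -ltNye (lt_le_trans _ (rmu_ge0 _)).
rewrite -forallNE => Aoo.
suff add2e (e : {posnum R}) :
    rmu (\bigcup_n A n) <= \sum_(i <oo) rmu (A i) + e%:num%:E.
  by apply/lee_addgt0Pr => _/posnumP[].
rewrite (le_trans _ (epsilon_trick _ _ _))//; last first.
  by move=> n; exact: rmu_ge0.
have PG n : exists G, covers (A n) G /\ \esum_(k in [set: nat]) (L (G k))%:E <=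
   rmu (A n) + (e%:num / (2 ^ n.+1)%:R)%:E.
  have fn : rmu (A n) \is a fin_num.
    by rewrite ge0_fin_numE ?rmu_ge0// ltey; apply/eqP; exact: Aoo.
  have en1 : (0 < e%:num / (2 ^ n.+1)%:R)%R by [].
  have /(lb_ereal_inf_adherent en1)[x [G GA <-] xS] := fn.
  by exists G; split => //; exact/ltW.
have {PG} [G PG] := choice PG.
have cG n := (PG n).1.
apply: (@le_trans _ _ (\esum_(i in [set: nat]) \esum_(j in [set: nat]) (L (G i j))%:E)).
  apply: rmu_le2.
  - by move=> i j; have [] := cG i.
  - by move=> i j x; have [] := cG i.
  - move=> x [i _ Aix]; have [_ G0 /(_ _ Aix) h] := cG i.
    apply: (le_trans h).
    apply: (@esum_ge1 (fun i => \esum_(j in [set: nat]) (G i j x)%:E)) => i'.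
    by apply: esum_ge0 => j _; rewrite lee_fin; have [_ h' _] := cG i'; exact: h'.
have h0 i : 0 <= \esum_(j in [set: nat]) (L (G i j))%:E.
  by apply: esum_ge0 => j _; have [? ? _] := cG i; exact: LF_ge0.
rewrite nneseries_esumT; last first.
  by move=> n; apply: adde_ge0; [exact: rmu_ge0|rewrite lee_fin divr_ge0].
by apply: le_esum => i _; exact: (PG i).2.
Qed.

HB.instance Definition _ := isOuterMeasure.Build R T rmu rmu0 rmu_ge0 le_rmu
  rmu_sigma_subadditive.

Lemma esum_partial (a : nat -> R) (m : nat) : (forall i, 0 <= a i)%R ->
  (\sum_(0 <= k < m) a k)%R%:E <= \esum_(n in [set: nat]) (a n)%:E.
Proof.
move=> a0; rewrite -nneseries_esumT => [|n]; last by rewrite lee_fin.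
rewrite -sumEFin; apply: nneseries_lim_ge => n _ _; by rewrite lee_fin.
Qed.

Lemma esum_le_bound (a : nat -> R) (s : R) : (forall i, 0 <= a i)%R ->
  (forall m, \sum_(0 <= k < m) a k <= s)%R -> \esum_(n in [set: nat]) (a n)%:E <= s%:E.
Proof.
move=> a0 as_; rewrite -nneseries_esumT => [|n]; last by rewrite lee_fin.
apply: lime_le.
  by apply: is_cvg_nneseries => n _ _; rewrite lee_fin.
by apply: nearW => m; rewrite sumEFin lee_fin.
Qed.

(* With [h] the distance to the complement of [U], each covering function [F] is
   split by the cutoffs [min (k h) 1], which increase to the indicator of [U]. *)
Lemma rmu_open_caratheodory (U : set T) : open U -> (rmu : set T -> \bar R).-caratheodory U.
Proof.
move=> oU; apply: le_caratheodory_measurable => X.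
have [U0|/set0P nU0] := eqVneq (~` U) set0.
  rewrite U0 setI0 -[X in _ + X]/(rmu set0) rmu0 adde0; apply: le_rmu.
  by move=> x [].
have cU : closed (~` U) by rewrite closedC.
have [h [ch h0 hU _]] := dist_function cU nU0.
apply: le_ereal_inf_tmp => _ [F [bF F0 FX] <-].
have LF0 n : (0 <= L (F n))%R by apply: L_ge0.
have [->|Foo] := eqVneq (\esum_(n in [set: nat]) (L (F n))%:E) +oo.
  by rewrite leey.
pose hk (k : nat) x : R := Num.min (k%:R * h x)%R 1%R.
have bh k : cbounded (hk k).
  split.
    move=> x; apply: (@continuous_min _ _ (fun x => (k%:R * h x)%R)); last exact: cst_continuous.
    have ck : continuous (cst k%:R%R : T -> R) by exact: cst_continuous.
    exact: (cvgM (ck x) (ch x)).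
  exists 1%R => x; rewrite ger0_norm; first by rewrite /hk ge_min lexx orbT.
  by rewrite /hk le_min ler01 mulr_ge0.
have hk0 k x : (0 <= hk k x)%R by rewrite /hk le_min ler01 mulr_ge0.
have hk1 k x : (hk k x <= 1)%R by rewrite /hk ge_min lexx orbT.
have hkS k x : (hk k x <= hk k.+1 x)%R.
  rewrite /hk le_min; apply/andP; split; last by rewrite ge_min lexx orbT.
  by rewrite ge_min ler_wpM2r// ler_nat.
have hk00 x : hk 0%N x = 0%R by rewrite /hk mul0r; apply/min_idPl.
(* Increments of the cutoffs: they telescope to [F n] on [U], so together they cover [X] inside
   [U]. *)
pose D k n x : R := (F n x * (hk k.+1 x - hk k x))%R.
have bD k n : cbounded (D k n) by apply: cboundedM => //; exact: cboundedB.
have D0 k n x : (0 <= D k n x)%R by rewrite mulr_ge0// subr_ge0.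
have bFh k n : cbounded (fun x => F n x * hk k x)%R by exact: cboundedM.
pose l k n := L (fun x => F n x * hk k x)%R.
have lle k n : (l k n <= L (F n))%R by apply: L_le => // x _; rewrite ler_piMr.
pose s n := sup [set l k n | k in [set: nat]].
have sup_l n : has_sup [set l k n | k in [set: nat]].
  by split; [exists (l 0%N n), 0%N|exists (L (F n)) => _ [k _ <-]].
have ls k n : (l k n <= s n)%R by apply: sup_upper_bound => //; exists k.
have LD_ k n : L (D k n) = (l k.+1 n - l k n)%R.
  rewrite /l -LB//; congr L; apply/funext => x; exact: mulrBr.
have l0 n : l 0%N n = 0%R.
  by rewrite /l -L0; congr L; apply/funext => x; rewrite hk00 mulr0.
have LDs n : \esum_(k in [set: nat]) (L (D k n))%:E <= (s n)%:E.
  apply: esum_le_bound => [k|m]; first by apply: L_ge0.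
  under eq_bigr do rewrite LD_.
  by rewrite telescope_sumr// l0 subr0.
suff add2e (e : {posnum R}) : rmu (X `&` U) + rmu (X `&` ~` U) <=
    \esum_(n in [set: nat]) (L (F n))%:E + e%:num%:E.
  by apply/lee_addgt0Pr => _/posnumP[].
(* [s n] bounds the cost of the part of [F n] inside [U]. A cutoff index that reaches it up to
   [e / 2^(n+1)] leaves at most [L (F n) - s n + e / 2^(n+1)] for the part outside, so the total
   exceeds the cost of [F] by at most [e]. *)
have kn n : exists k, (s n - e%:num / (2 ^ n.+1)%:R < l k n)%R.
  have en : (0 < e%:num / (2 ^ n.+1)%:R :> R)%R by [].
  by have [_ [k _ <-] h'] := sup_adherent en (sup_l n); exists k.
have {kn} [k_ hk_] := choice kn.
have c1 : rmu (X `&` U) <= \esum_(n in [set: nat]) (s n)%:E.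
  apply: (@le_trans _ _ (\esum_(n in [set: nat]) \esum_(k in [set: nat]) (L (D k n))%:E)).
    apply: (@rmu_le2 _ (fun n k => D k n)) => // x [Xx Ux].
    apply: (le_trans (FX _ Xx)); apply: le_esum => n _.
    have hx : (0 < h x)%R by apply/hU => nUx; exact: nUx.
    have [m hm] : exists m, hk m x = 1%R.
      exists (Num.bound (h x)^-1); rewrite /hk; apply/min_idPr.
      rewrite -ler_pdivrMr// mul1r ltW//.
      by apply: archi_boundP; rewrite invr_ge0.
    apply: (le_trans _ (esum_partial m _)); last by move=> i; exact: D0.
    rewrite /D -mulr_sumr telescope_sumr// hm hk00 subr0 mulr1//.
  by apply: le_esum => n _; exact: LDs.
pose G n x := (F n x * (1 - hk (k_ n) x))%R.
have bG n : cbounded (G n) by apply: cboundedM => //; apply: cboundedB => //; exact: cbounded_cst.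
have c2 : rmu (X `&` ~` U) <= \esum_(n in [set: nat]) (L (G n))%:E.
  apply: rmu_le; split => //.
    by move=> n x; rewrite mulr_ge0// subr_ge0.
  move=> x [Xx Ux]; apply: (le_trans (FX _ Xx)); apply: le_esum => n _.
  have hx : h x = 0%R.
    apply/eqP; rewrite eq_le h0 andbT leNgt; apply/negP => /hU; exact.
  have -> : G n x = F n x; last by [].
  by rewrite /G /hk hx mulr0 (min_idPl _) ?ler01// subr0 mulr1.
have LG n : L (G n) = (L (F n) - l (k_ n) n)%R.
  rewrite /l -LB//; congr L; apply/funext => x; by rewrite /G mulrBr mulr1.
have s0 n : (0 <= s n)%R by rewrite -(l0 n).
apply: (le_trans (leeD c1 c2)).
rewrite -esumD; last 2 first.
- by move=> n _; rewrite lee_fin.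
- by move=> n _; rewrite lee_fin; apply: L_ge0 => // x _; rewrite mulr_ge0// subr_ge0.
rewrite -nneseries_esumT; last first.
  move=> n; rewrite -EFinD lee_fin addr_ge0//; apply: L_ge0 => // x _.
  by rewrite mulr_ge0// subr_ge0.
rewrite -nneseries_esumT; last by move=> n; rewrite lee_fin.
rewrite (le_trans _ (epsilon_trick _ _ _))//.
apply: lee_nneseries => [n _ _|n _].
  rewrite -EFinD lee_fin addr_ge0//; apply: L_ge0 => // x _.
  by rewrite mulr_ge0// subr_ge0.
rewrite -!EFinD lee_fin LG; have := hk_ n; lra.
Qed.

(** For a cover [F] of [S], compactness of the set [A] from [L_tight] gives one partial sum [g]
    exceeding [1 - e / 2] on all of [A]. The deficit [max (1 - e / 2 - g) 0] vanishes on [A], so [L]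
    gives it at most [e / 2], and therefore [1 - e <= L g]. *)
Lemma rmu_S : rmu S = 1.
Proof.
apply/eqP; rewrite eq_le; apply/andP; split.
  by rewrite -L1; apply: rmu_le1 => //; exact: cbounded_cst.
apply: le_ereal_inf_tmp => _ [F [bF F0 FS] <-].
have LF0 n : (0 <= L (F n))%R by apply: L_ge0.
apply/lee_addgt0Pr => e e0.
have e20 : (0 < e / 2)%R by rewrite divr_gt0.
have [A [cA AS hA]] := L_tight e20.
pose U N := [set x | (1 - e / 2 < \sum_(0 <= n < N) F n x)%R].
have oU N : open (U N).
  have -> : U N = (fun x => \sum_(0 <= n < N) F n x)%R @^-1` [set y | (1 - e / 2 < y)%R] by [].
  apply: open_comp; last exact: open_gt.
  by move=> x _; have [+ _] := @cbounded_sum _ (index_iota 0 N) F bF; exact.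
have AU : A `<=` \bigcup_(N in [set: nat]) U N.
  move=> x /AS Sx; have := FS _ Sx.
  rewrite -nneseries_esumT => [h|n]; last by rewrite lee_fin.
  have h1 : ((1 - e / 2)%:E < \sum_(n <oo) (F n x)%:E).
    by apply: (lt_le_trans _ h); rewrite lte_fin ltrBlDr ltrDl.
  have [N hN] : exists N, (1 - e / 2)%:E < \sum_(0 <= n < N) (F n x)%:E.
    apply: contrapT => /forallNP hN; move: h1; rewrite ltNge => /negP; apply.
    apply: lime_le.
      by apply: is_cvg_nneseries => n _ _; rewrite lee_fin.
    by apply: nearW => m; rewrite leNgt; apply/negP; exact: hN.
  by exists N => //; move: hN; rewrite sumEFin lte_fin.
have UM N M : (N <= M)%N -> U N `<=` U M.
  move=> NM x; rewrite /U /= => /lt_le_trans; apply.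
  by rewrite [leRHS](@big_cat_nat _ _ _ N)//= lerDl sumr_ge0.
have [N AN] : exists N, A `<=` U N.
  move: cA; rewrite compact_cover => /(_ _ setT U (fun N _ => oU N) AU)[D _ AD].
  exists (\max_(i <- finmap.enum_fset D) i)%N => x /AD [i /= Di Ui].
  by apply: UM Ui; exact: (@leq_bigmax_seq _ _ xpredT id).
pose g x := (\sum_(0 <= n < N) F n x)%R.
have bg : cbounded g by exact: cbounded_sum.
have g0 x : (0 <= g x)%R by rewrite sumr_ge0.
pose f x := Num.max (1 - e / 2 - g x)%R 0%R.
have bf : cbounded f.
  apply: cbounded_max; apply: cboundedB => //; exact: cbounded_cst.
have f1 x : (0 <= f x <= 1)%R.
  rewrite /f le_max lexx orbT ge_max ler01 andbT.
  have := g0 x; move: (g x) e20 => y ? ?; lra.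
have fA x : A x -> f x = 0%R.
  by move=> /AN; rewrite /U /= => h; apply/max_idPr; rewrite subr_le0 ltW.
have h1 : ((1 - e / 2) <= L g + L f)%R.
  rewrite -LD// -[leLHS]L_cst; apply: L_le; first exact: cbounded_cst.
    exact: cboundedD.
  by move=> x _; rewrite -lerBlDl /f le_max lexx.
have h2 := hA f bf f1 fA.
have h3 : (L g)%:E <= \esum_(n in [set: nat]) (L (F n))%:E.
  by rewrite /g L_sum//; exact: esum_partial.
apply: (@le_trans _ _ ((L g)%:E + e%:E)); last exact: leeD2r.
rewrite -EFinD lee_fin; lra.
Qed.

Lemma rmuT : rmu setT = 1.
Proof.
apply/eqP; rewrite eq_le; apply/andP; split.
  by rewrite -L1; apply: rmu_le1 => //; exact: cbounded_cst.
by rewrite -rmu_S; exact: le_rmu.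
Qed.

(** The same set function on the Borel type: [rmu] carries the outer measure structure, this copy
    the structure of a probability measure. *)
Definition riesz_measure : set (borelC3 R) -> \bar R := rmu.

Lemma borel_caratheodory (A : set (borelC3 R)) : measurable A ->
  (rmu : set T -> \bar R).-caratheodory A.
Proof.
move: A; apply: smallest_sub.
  split.
  - exact: (@caratheodory_measurable_set0 _ _ rmu).
  - move=> B mB; rewrite setTD; exact: (@caratheodory_measurable_setC _ _ rmu).
  - by move=> F mF; exact: (@caratheodory_measurable_bigcup _ _ rmu).
by move=> U oU; exact: rmu_open_caratheodory.
Qed.

Lemma riesz_measure0 : riesz_measure set0 = 0.
Proof. exact: rmu0. Qed.

Lemma riesz_measure_ge0 (A : set (borelC3 R)) : 0 <= riesz_measure A.
Proof. exact: rmu_ge0. Qed.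

Lemma riesz_measure_sigma_additive : semi_sigma_additive riesz_measure.
Proof.
move=> F mF tF mUF.
apply: (@caratheodory_measure_sigma_additive _ _ rmu) => //.
  by move=> i; exact: borel_caratheodory (mF i).
exact: borel_caratheodory mUF.
Qed.

HB.instance Definition _ := isMeasure.Build _ _ _ riesz_measure
  riesz_measure0 riesz_measure_ge0 riesz_measure_sigma_additive.

Lemma riesz_measureT : riesz_measure setT = 1.
Proof. exact: rmuT. Qed.

HB.instance Definition _ := Measure_isProbability.Build _ _ _ riesz_measure
  riesz_measureT.

Lemma continuous_borel f : continuous f -> measurable_fun [set: borelC3 R] f.
Proof.
move=> cf; apply: (measurability _ (RGenOpens.measurableE R)).
move=> _ [_ [a [b ->]] <-]; rewrite setTI; apply: sub_sigma_algebra.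
apply: open_comp; last exact: interval_open.
by move=> x _; exact: cf.
Qed.

Local Notation mu := (riesz_measure : probability (borelC3 R) R).

Lemma cbounded_integrable f : cbounded f -> mu.-integrable setT (EFin \o f).
Proof.
move=> [cf [M hM]]; apply: measurable_bounded_integrable => //.
- by rewrite [X in X < _]riesz_measureT ltry.
- exact: continuous_borel.
- by exists M; split; [exact: num_real|move=> x Mx y _ /=; rewrite (le_trans (hM y))// ltW].
Qed.

(* Layer cake: [N f] is the sum of the layers [min (max (N f - i) 0) 1]. *)
Lemma riesz_integral_le f : cbounded f -> (forall x, 0 <= f x <= 1)%R ->
  \int[mu]_x (f x)%:E <= (L f)%:E.
Proof.
move=> bf f01.
have If : \int[mu]_x (f x)%:E \is a fin_num.
  by apply: integrable_fin_num => //; exact: cbounded_integrable.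
rewrite -(fineK If) lee_fin; apply/ler_addgt0Pr => e e0.
pose N := (Num.bound e^-1).+1.
have Ne : (N%:R^-1 <= e :> R)%R.
  rewrite invf_ple ?posrE// ltW// (lt_le_trans (archi_boundP _)) ?invr_ge0 ?ltW//.
  by rewrite ltr_nat.
pose phi (i : nat) x : R := Num.min (Num.max (N%:R * f x - i%:R) 0)%R 1%R.
pose A i := [set x : borelC3 R | (i.+1%:R <= N%:R * f x)%R].
have bphi i : cbounded (phi i).
  apply: cbounded_min; apply: cbounded_max; apply: cboundedB; last exact: cbounded_cst.
  exact: cboundedZ.
have phi0 i x : (0 <= phi i x)%R by rewrite /phi le_min ler01 andbT le_max lexx orbT.
have mA i : measurable (A i).
  have [cNf _] := cboundedZ N%:R bf.
  have := continuous_borel cNf measurableT (measurable_itv `[i.+1%:R, +oo[).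
  by rewrite setTI; congr measurable; apply/seteqP; split => x; rewrite /A /= in_itv/= andbT.
have muA i : mu (A i) <= (L (phi i))%:E.
  apply: rmu_le1 => // x Ax; rewrite /phi le_min lexx andbT le_max.
  by apply/orP; left; move: Ax; rewrite /A /= lerBrDr -natr1 addrC.
have sumphi x : (\sum_(0 <= i < N) phi i x = N%:R * f x)%R.
  have key m : (\sum_(0 <= i < m) phi i x = Num.min (N%:R * f x) m%:R)%R.
    elim: m => [|m IH].
      rewrite big_geq//; apply/esym/min_idPr; rewrite mulr_ge0//.
      by case/andP: (f01 x).
    rewrite big_nat_recr//= IH /phi; set t := (N%:R * f x)%R.
    have t0 : (0 <= t)%R by rewrite mulr_ge0//; case/andP: (f01 x).
    have [tm|mt] := leP t m%:R.
      rewrite (max_idPr _) ?subr_le0// (min_idPl _) ?ler01// addr0.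
      by apply/esym/min_idPl; rewrite (le_trans tm)// ler_nat.
    rewrite (max_idPl _); last by rewrite subr_ge0 ltW.
    have [tm1|m1t] := leP t m.+1%:R.
      rewrite (min_idPl _); first by rewrite addrC subrK.
      by rewrite lerBlDl natr1.
    rewrite (min_idPr _); first by rewrite natr1.
    by rewrite lerBrDl natr1 ltW.
  rewrite key; apply/min_idPl; rewrite ler_piMr//.
  by case/andP: (f01 x).
(* Counting the levels [i + 1 <= N f] loses at most one partial layer, hence the [1]; after division
   by [N] it costs at most [e]. *)
have Nf x : (N%:R * f x <= 1 + \sum_(0 <= i < N) \1_(A i) x)%R.
  have t1 : (N%:R * f x <= N%:R)%R by rewrite ler_piMr//; case/andP: (f01 x).
  move: t1; rewrite /A; elim: (N in (_ <= N%:R)%R -> (_ <= 1 + \sum_(0 <= i < N) _)%R) => [|m IH] t1.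
    by rewrite big_geq// addr0 (le_trans t1)// ler01.
  rewrite big_nat_recr//=; have [tm|mt] := leP (N%:R * f x)%R m%:R.
    by rewrite addrA ler_wpDr// IH.
  have -> : (\sum_(0 <= i < m) \1_[set x0 | (i.+1%:R <= N%:R * f x0)%R] x = m%:R :> R)%R.
    rewrite (eq_big_nat _ _ (F2 := fun=> 1%R)).
      by rewrite big_const_nat subn0 iter_addr_0.
    move=> i /andP[_ im]; rewrite indicE mem_set//=.
    by rewrite (le_trans _ (ltW mt))// ler_nat.
  by rewrite addrA ler_wpDr// addrC natr1.
have h : (N%:R)%:E * \int[mu]_x (f x)%:E <= (1 + N%:R * L f)%:E.
  rewrite -ge0_integralZl_EFin//; last first.
  - by apply/measurable_EFinP; apply: continuous_borel; case: bf.
  - by move=> x _; rewrite lee_fin; case/andP: (f01 x).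
  apply: (@le_trans _ _ (\int[mu]_x (1 + \sum_(0 <= i < N) (\1_(A i) x)%:E))).
    apply: ge0_le_integral => //.
    - by move=> x _; rewrite -EFinM lee_fin mulr_ge0//; case/andP: (f01 x).
    - apply/measurable_EFinP.
      by apply: continuous_borel; have [] := cboundedZ N%:R bf.
    - apply: emeasurable_funD => //; apply: emeasurable_sum => i.
      by apply/measurable_EFinP; exact: measurable_indic.
    - by move=> x _; rewrite sumEFin -EFinD lee_fin Nf.
  rewrite ge0_integralD//; last 2 first.
  - by move=> x _; apply: sume_ge0 => i _; rewrite lee_fin.
  - apply: emeasurable_sum => i.
    by apply/measurable_EFinP; exact: measurable_indic.
  rewrite integral_cst// mul1e [X in X + _]riesz_measureT EFinD leeD2l//.
  rewrite ge0_integral_sum//; last first.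
    by move=> i; apply/measurable_EFinP; exact: measurable_indic.
  rewrite -LZ// -(eq_fun (sumphi)) L_sum// -sumEFin; apply: lee_sum => i _.
  rewrite (integral_indic _ measurableT (mA i)) setIT; exact: muA.
move: h; rewrite -(fineK If) -EFinM lee_fin => h.
have N0 : (0 < N%:R :> R)%R by rewrite ltr0n.
rewrite -(ler_pM2l N0) (le_trans h)// mulrDr addrC lerD2l.
by rewrite -ler_pdivrMl// mulr1.
Qed.

(** Applied to both [g] and [1 - g], the one-sided bound [riesz_integral_le] becomes an equality for
    values in [[0, 1]]; an affine change reduces any bounded function to that range. *)
Lemma riesz_integral f : cbounded f -> \int[mu]_x (f x)%:E = (L f)%:E.
Proof.
move=> bf.
have unit g : cbounded g -> (forall x, 0 <= g x <= 1)%R -> \int[mu]_x (g x)%:E = (L g)%:E.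
  move=> bg g01; apply/eqP; rewrite eq_le riesz_integral_le//=.
  have Ig := cbounded_integrable bg.
  have If : \int[mu]_x (g x)%:E \is a fin_num by apply: integrable_fin_num.
  have := @riesz_integral_le (fun x => 1 - g x)%R.
  rewrite (LB (cbounded_cst 1) bg) L1.
  have -> : \int[mu]_x (1 - g x)%:E = 1 - \int[mu]_x (g x)%:E.
    under eq_integral do rewrite EFinB.
    rewrite integralB_EFin//; last exact: (cbounded_integrable (cbounded_cst 1)).
    by rewrite integral_cst// mul1e [X in X - _]riesz_measureT.
  rewrite -(fineK If) -EFinB !lee_fin => h.
  have h01 x : (0 <= 1 - g x <= 1)%R.
    by have /andP[? ?] := g01 x; apply/andP; split; lra.
  have := h (cboundedB (cbounded_cst 1) bg) h01; lra.
have [cf [M hM]] := bf.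
pose C := (`|M| + 1)%R.
have C0 : (0 < C)%R by rewrite ltr_wpDl.
pose g x := ((C + f x) / (2 * C))%R.
have fC x : (- C <= f x <= C)%R.
  by rewrite -ler_norml (le_trans (hM x))// (le_trans (ler_norm M))// lerDl.
have bg : cbounded g.
  have := cboundedM (cboundedD (cbounded_cst C) bf) (cbounded_cst (2 * C)^-1).
  by [].
have g01 x : (0 <= g x <= 1)%R.
  have /andP[h1 h2] := fC x.
  rewrite /g divr_ge0/=; [|lra|lra].
  rewrite ler_pdivrMr; lra.
have fE x : f x = (2 * C * g x - C)%R by rewrite /g; field; rewrite gt_eqF.
have -> : f = (fun x => 2 * C * g x - C)%R by apply/funext.
rewrite (LB (cboundedZ _ bg) (cbounded_cst C)) LZ// L_cst.
under eq_integral do rewrite EFinB.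
have Ig := cbounded_integrable bg.
rewrite integralB_EFin//; [|exact: (cbounded_integrable (cboundedZ _ bg))|
   exact: (cbounded_integrable (cbounded_cst C))].
rewrite integral_cst// [X in _ - _ * X]riesz_measureT mule1.
under eq_integral do rewrite EFinM.
by rewrite integralZl// unit.
Qed.

Theorem riesz_probability : exists mu : probability (borelC3 R) R, mu S = 1 /\
  forall f, cbounded f -> \int[mu]_x (f x)%:E = (L f)%:E.
Proof. by exists mu; split; [exact: rmu_S|move=> f; exact: riesz_integral]. Qed.

End Riesz.

(** * Plurisubharmonic functions from test functions *)

Section TestFunctions.
Context {R : realType}.
Implicit Types (u f g : C3 R -> R) (q v w : C3 R).

Lemma csupp_bounded g (A : set (C3 R)) : continuous g -> compact A ->
  (forall q, ~ A q -> g q = 0) -> exists C, 0 <= C /\ forall q, `|g q| <= C.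
Proof.
move=> cg cA gA.
have /compact_bounded[C [_ hC]] := cA.
have [B [B0 hB]] := ball_bound (`|C| + 1) cg.
exists B; split => // q; have [Aq|/gA ->] := pselect (A q); last by rewrite normr0.
apply: hB; apply: (hC (`|C| + 1)) => //.
by rewrite (le_lt_trans (ler_norm C))// ltrDl.
Qed.

Lemma not_supp (V : zmodType) (h : C3 R -> V) q : ~ supp h q -> h q = 0.
Proof.
by move=> nq; apply: contrapT => hq; apply: nq; apply: subset_closure; exact/eqP.
Qed.

Lemma partial1_supp f k q : ~ supp f q -> partial1 k f q = 0.
Proof.
move=> nq.
have : open (~` supp f) by rewrite openC; exact: closed_closure.
rewrite openE => /(_ q nq) h.
have E : \near q, (cst 0 : C3 R -> R^o) q = (f : C3 R -> R^o) q.
  by apply: filterS h => q' nq'; rewrite not_supp.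
by rewrite /partial1 -(near_eq_derive (ebase R k) E) derive_cst.
Qed.

Lemma test_function_bounded u : test_function u -> exists C, 0 <= C /\ forall q, `|u q| <= C.
Proof.
move=> [su cu]; apply: csupp_bounded cu _; first exact: smooth_continuous.
by move=> q; exact: not_supp.
Qed.

Lemma partial1_bounded u k : test_function u -> exists C, 0 <= C /\ forall q, `|partial1 k u q| <= C.
Proof.
move=> [su cu]; apply: csupp_bounded cu _.
  by apply: smooth_continuous; exact: smooth_partial1.
by move=> q; exact: partial1_supp.
Qed.

Lemma is_diff_line q v (t : R) :
  is_diff t (fun t : R => q + t *: v) (fun h : R => h *: v).
Proof.
have h := @is_diff_affine2 _ q v 0 id (cst 0) t 1 0 (is_derive_id _ _) (is_derive_cst _ _ _).
have -> : (fun t : R => q + t *: v) = (fun x : R => q + id x *: v + (cst 0 x : R) *: 0).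
  by apply/funext => x; rewrite scaler0 addr0.
apply: (is_diff_eq h); apply/funext => x.
by rewrite scale1r scaler0 addr0.
Qed.

Lemma line_MVT u q v : smooth u ->
  exists c, 0 <= c <= 1 /\ u (q + v) - u q = grad u (q + c *: v) v.
Proof.
move=> su.
have d t := derive1_curve su (is_diff_line q v t).
have cg : {within `[0 : R, 1], continuous (u \o (fun t => q + t *: v))}.
  apply: continuous_subspaceT => t; apply: differentiable_continuous.
  by apply/derivable1_diffP; case: (d t).
have [c] := MVT_segment ler01 (fun x _ => d x) cg.
by rewrite in_itv subr0 mulr1 /= scale1r scale0r addr0 => c01 e; exists c.
Qed.

Lemma test_function_lipschitz u : test_function u ->
  exists C, 0 <= C /\ forall q q', `|u q - u q'| <= C * `|q - q'|.
Proof.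
move=> tu.
have [C hC] := choice (fun k => partial1_bounded k tu).
exists (\sum_k C k); split; first by apply: sumr_ge0 => k _; case: (hC k).
move=> q q'.
have [c [_]] := line_MVT q' (q - q') tu.1; rewrite [q' + _]addrC subrK => ->.
rewrite /grad (le_trans (ler_norm_sum _ _ _))// mulr_suml ler_sum// => k _.
rewrite normrM mulrC ler_pM// ?coord_le_norm//.
by case: (hC k).
Qed.

Lemma test_functionN u : test_function u -> test_function (fun q => - u q).
Proof.
move=> [su cu]; split; first exact: smoothN.
rewrite /supp (_ : [set q | - u q != 0] = [set q | u q != 0])//.
by apply/seteqP; split => q /=; rewrite oppr_eq0.
Qed.

Lemma test_functionZ (a : R) u : test_function u -> test_function (fun q => a * u q).
Proof.
move=> [su cu]; split; first exact: smoothZ.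
apply: subclosed_compact cu _; first exact: closed_closure.
apply: closure_subset => q /=; apply: contra_neq => ->; exact: mulr0.
Qed.

Lemma test_functionD u f : test_function u -> test_function f ->
  test_function (fun q => u q + f q).
Proof.
move=> [su cu] [sf cf]; split; first exact: smoothD.
have cuf : compact (supp u `|` supp f) by exact: compactU.
apply: subclosed_compact cuf _; first exact: closed_closure.
rewrite /supp -closureU; apply: closure_subset => q /=.
have [->|] := eqVneq (u q) 0; last by left.
by rewrite add0r; right.
Qed.

Lemma test_function0 : test_function (cst 0 : C3 R -> R).
Proof.
split; first exact: smooth_cst.
rewrite /supp (_ : [set q | _] = set0) ?closure0; first exact: compact0.
by apply/seteqP; split => // q /=; rewrite eqxx.
Qed.

End TestFunctions.

(** * Fibre infima and minimal plurisubharmonic functions *)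

Section PshFromNull.
Context {R : realType}.
Implicit Types (u f g w : C3 R -> R) (x y : 'rV[R]_3) (q v : C3 R).

Definition depends_re g : Prop := forall q q', re_part q = re_part q' -> g q = g q'.

Lemma re_row_mx x y : re_part (row_mx x y) = x.
Proof. by rewrite /re_part row_mxKl. Qed.

Lemma im_row_mx x y : im_part (row_mx x y) = y.
Proof. by rewrite /im_part row_mxKr. Qed.

Lemma re_partD q v : re_part (q + v) = re_part q + re_part v.
Proof. by have := re_partP 1 q v; rewrite !scale1r. Qed.

Lemma re_partZ (a : R) v : re_part (a *: v) = a *: re_part v.
Proof.
have re0 : re_part (0 : C3 R) = 0 by apply/rowP => j; rewrite !mxE.
by rewrite -[a *: v]addr0 re_partP re0 addr0.
Qed.

(** The vector is [v1 - i v2]. With this sign its image under [Jmap] has real part [v2], so a circle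
    in the complex direction of this vector projects onto the given circle with the same angle. *)
Lemma isothermal_null (v1 v2 : 'rV[R]_3) : isothermal v1 v2 ->
  null_vector (row_mx v1 (- v2) : C3 R).
Proof.
move=> [d12 e12 e1]; apply/null_vectorP.
have dN (a b : 'rV[R]_3) : dotv a (- b) = - dotv a b.
  by rewrite /dotv -sumrN; apply: eq_bigr => j _; rewrite mxE mulrN.
have dNN (a : 'rV[R]_3) : dotv (- a) (- a) = dotv a a.
  by apply: eq_bigr => j _; rewrite !mxE mulrNN.
have d0 (a : 'rV[R]_3) : 0 <= dotv a a by apply: sumr_ge0 => j _; exact: sqr_ge0.
split.
- apply: contra e1 => /eqP h; apply/eqP.
  have -> : v1 = 0 by rewrite -(re_row_mx v1 (- v2)) h; apply/rowP => j; rewrite !mxE.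
  by rewrite /enorm /dotv big1 ?sqrtr0// => j _; rewrite mxE mul0r.
- rewrite sqreE sqimE re_row_mx im_row_mx dNN.
  by have := congr1 (fun z => z ^+ 2) e12; rewrite /enorm !sqr_sqrtr.
- by rewrite re_row_mx im_row_mx dN d12 oppr0.
Qed.

Lemma row_mx_norm0 (x x' y : 'rV[R]_3) : `|row_mx x y - row_mx x' y : C3 R| <= `|x - x'|.
Proof.
have -> : (row_mx x y - row_mx x' y : C3 R) = row_mx (x - x') 0.
  by rewrite opp_row_mx add_row_mx subrr.
apply: norm_le_coord => // k; rewrite -[k]splitK /unsplit; case: (fintype.split k) => j.
  by rewrite row_mxEl; exact: coord_le_norm.
by rewrite row_mxEr mxE normr0.
Qed.

Variables (phi G : C3 R -> R) (a : R).
Hypothesis tphi : test_function phi.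
Hypothesis a0 : 0 <= a.
Hypothesis sG : smooth G.
Hypothesis reG : depends_re G.

Let w q := phi q + a * sqim q + G q.
Hypothesis levi_w : forall q v, null_vector v -> levi w q v <= 0.

Lemma smooth_w : smooth w.
Proof.
have [sphi _] := tphi.
exact: (smoothD (smoothD sphi (smoothZ a (@smooth_sqim R))) sG).
Qed.

(** [G] is constant on fibres and stays outside the infimum. What remains depends on [x] only
    through the Lipschitz function [phi], which makes [s] Lipschitz. *)
Let s x := inf [set phi (row_mx x y) + a * sqim (row_mx x y : C3 R) | y in [set: 'rV[R]_3]].

Let s_lb x : has_lbound [set phi (row_mx x y) + a * sqim (row_mx x y : C3 R) | y in [set: 'rV[R]_3]].
Proof.
have [C [C0 hC]] := test_function_bounded tphi.
exists (- C) => _ [y _ <-]; rewrite -[leLHS]addr0 lerD//.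
  by have := hC (row_mx x y); rewrite ler_norml => /andP[].
by rewrite mulr_ge0// im2_ge0.
Qed.

Let s_ne x : [set phi (row_mx x y) + a * sqim (row_mx x y : C3 R) | y in [set: 'rV[R]_3]] !=set0.
Proof. by exists (phi (row_mx x 0) + a * sqim (row_mx x 0 : C3 R)), 0. Qed.

Let s_continuous : continuous s.
Proof.
have [C [C0 hC]] := test_function_lipschitz tphi.
have half x x' : s x - s x' <= C * `|x - x'|.
  rewrite lerBlDr -lerBlDl; apply: lb_le_inf => // _ [y _ <-].
  rewrite lerBlDl; apply: (@le_trans _ _ (phi (row_mx x y) + a * sqim (row_mx x y : C3 R))).
    by apply: ge_inf => //; exists y.
  have -> : sqim (row_mx x y : C3 R) = sqim (row_mx x' y : C3 R).
    by rewrite !sqimE !im_row_mx.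
  rewrite addrA lerD2r -lerBlDr (le_trans (ler_norm _))// (le_trans (hC _ _))//.
  by rewrite ler_wpM2l// row_mx_norm0.
apply: (@lipschitz_cont _ _ _ C) => x x'; rewrite ler_norml half andbT.
by rewrite lerNl opprB distrC half.
Qed.

Definition inf_fiber x : R := s x + G (real_pt x).

Lemma inf_fiber_le x y : inf_fiber x <= w (row_mx x y).
Proof.
rewrite /inf_fiber /w (reG (q := row_mx x y) (q' := real_pt x)); last first.
  by rewrite /real_pt !re_row_mx.
by rewrite lerD2r; apply: ge_inf => //; exists y.
Qed.

Lemma le_inf_fiber x (m : R) : (forall y, m <= w (row_mx x y)) -> m <= inf_fiber x.
Proof.
move=> h; rewrite /inf_fiber -lerBlDr; apply: lb_le_inf => // _ [y _ <-].
rewrite lerBlDr; have := h y; rewrite /w (reG (q := row_mx x y) (q' := real_pt x))//.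
by rewrite /real_pt !re_row_mx.
Qed.

Lemma real_pt_continuous : continuous (@real_pt R).
Proof.
move=> x; apply/(@cvgrPdist_le _ _ _ (nbhs x)) => e e0.
apply/nbhs_ballP; exists e => //= x'; rewrite -ball_normE /= => h.
by rewrite (le_trans (row_mx_norm0 _ _ _))// ltW.
Qed.

Lemma inf_fiber_continuous : continuous inf_fiber.
Proof.
have cG : continuous (G \o @real_pt R).
  move=> x; apply: (@continuous_comp _ _ _ (@real_pt R) G); first exact: real_pt_continuous.
  exact: smooth_continuous.
move=> x; exact: (cvgD (s_continuous (x := x)) (cG x)).
Qed.

Lemma plane_continuous n (b v1 v2 : 'rV[R]_n) : continuous (plane_param b v1 v2).
Proof.
move=> y; rewrite /plane_param.
apply: cvgD; first apply: cvgD; first exact: cvg_cst.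
  by apply: cvgZr_tmp; exact: cvg_fst.
by apply: cvgZr_tmp; exact: cvg_snd.
Qed.

Lemma continuous_usc (X : topologicalType) (D : set X) (f : X -> R) :
  continuous f -> usc_on D (fun z => (f z)%:E).
Proof.
move=> cf z Dz b; rewrite lte_fin => fzb.
have : \forall t \near z, f t < b by exact: (@cvgr_lt _ _ (nbhs z) _ f (f z) (cf z)).
by move=> h; rewrite near_withinE; apply: filterS h => t ft _; rewrite lte_fin.
Qed.

(** Every point [(x, y)] above the centre carries a lift of the planar circle, namely the circle
    along the null vector [V] and [Jmap V]. There [- w] satisfies the mean value inequality, and
    [inf_fiber <= w] on the lift. So the circle mean of [- inf_fiber] is at least [- w (x, y)] for
    every [y], hence at least the supremum over [y]. *)
Lemma sup_fiber_psh : minimal_psh [set: 'rV[R]_3] (fun x => (- inf_fiber x)%:E).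
Proof.
have cN : continuous (fun x => - inf_fiber x).
  by move=> x; apply: continuousN; exact: inf_fiber_continuous.
split=> // [|b v1 v2 iso]; first exact: continuous_usc.
have cNp : continuous (fun y : R * R => - inf_fiber (plane_param b v1 v2 y)).
  move=> y; apply: (@continuous_comp _ _ _ (plane_param b v1 v2) (fun x => - inf_fiber x)).
    exact: plane_continuous.
  exact: cN.
split=> // [|c r r0 _]; first exact: continuous_usc cNp.
rewrite /comp.
pose V : C3 R := row_mx v1 (- v2).
have nV : null_vector V by exact: isothermal_null.
pose f t := - inf_fiber (plane_param b v1 v2 (c.1 + r * cos t, c.2 + r * sin t)).
have cf : continuous f.
  move=> t; apply: (@continuous_comp _ _ _ (fun t => (c.1 + r * cos t, c.2 + r * sin t))
    (fun y : R * R => - inf_fiber (plane_param b v1 v2 y))); last exact: cNp.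
  have h1 : continuous (fun t => c.1 + r * cos t).
    by apply: contD; [exact: cst_continuous|apply: contZ; exact: continuous_cos].
  have h2 : continuous (fun t => c.2 + r * sin t).
    by apply: contD; [exact: cst_continuous|apply: contZ; exact: continuous_sin].
  exact: (cvg_pair (h1 t) (h2 t)).
rewrite (circle_integralE cf) -EFinM lee_fin.
have tp := @two_pi_gt0 R.
rewrite -ler_pdivrMl ?invr_gt0// invrK mulrN lerNl mulrC -ler_pdivrMr//.
apply: le_inf_fiber => y; rewrite ler_pdivrMr// mulrC lerNl -mulrN.
pose q0 : C3 R := row_mx (plane_param b v1 v2 c) y.
pose u q := - w q.
have su : smooth u by apply: smoothN; exact: smooth_w.
have lu q : 0 <= hess u q V V + hess u q (Jmap V) (Jmap V).
  rewrite -/(levi u q V).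
  have -> : u = (fun q => (-1) * w q) by apply/funext => z; rewrite mulN1r.
  by rewrite leviZ; [rewrite mulN1r oppr_ge0; exact: levi_w|exact: smooth_w].
have := @subharmonic_mean _ q0 V (Jmap V) u r su (ltW r0) (fun r' t _ => lu _).
move=> /le_trans; apply.
have cu : continuous (fun t => u (circ q0 V (Jmap V) r t)).
  by apply: comp_circ_continuous; exact: smooth_continuous.
apply: le_Rintegral.
- exact: circle_dom_measurable.
- exact: circle_integrable.
- exact: circle_integrable.
move=> t _; rewrite /u /f lerN2.
set z := circ _ _ _ _ _.
rewrite -[z]hsubmxK -/(re_part z) -/(im_part z).
suff -> : plane_param b v1 v2 (c.1 + r * cos t, c.2 + r * sin t) = re_part z.
  exact: inf_fiber_le.
rewrite /z /circ !re_partD !re_partZ re_Jmap im_row_mx opprK !re_row_mx.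
by rewrite /plane_param /= !scalerDl addrA addrA; congr (_ + _); rewrite -!addrA; congr (_ + (_ + _)); rewrite addrC.
Qed.

End PshFromNull.

(** * The functional attached to a point of the hull *)

Section PairingBounds.
Context {R : realType}.
Implicit Types (q v w : C3 R) (A B : 'M[R]_(3 + 3)).

Lemma pairingD A B v w : pairing (A + B) v w = pairing A v w + pairing B v w.
Proof. by rewrite /pairing mulmxDr mulmxDl mxE. Qed.

Lemma pairingZ (a : R) A v w : pairing (a *: A) v w = a * pairing A v w.
Proof. by rewrite /pairing -scalemxAr -scalemxAl mxE. Qed.

Lemma pairing0 v w : pairing (0 : 'M[R]_(3 + 3)) v w = 0.
Proof. by rewrite /pairing mulmx0 mul0mx mxE. Qed.

(** From [|ab| <= (a^2 + b^2) / 2]: each squared coordinate is repeated over the six values of the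
    other index, and [Jmap] is an isometry. *)
Lemma pairing_bound A (C : R) v : (forall j k, `|A j k| <= C) ->
  `|pairing A v (Jmap v)| <= 6 * C * (sqre v + sqim v).
Proof.
move=> hA; rewrite pairing_sum.
have C0 : 0 <= C by apply: le_trans (hA ord0 ord0).
have eN (x : C3 R) : \sum_(j < 3 + 3) (x ord0 j : R) * x ord0 j = sqre x + sqim x.
  by rewrite big_split_ord.
apply: (@le_trans _ _ (\sum_(j < 3 + 3) \sum_(k < 3 + 3)
   C * ((v ord0 j * v ord0 j + Jmap v ord0 k * Jmap v ord0 k) / 2))).
  rewrite (le_trans (ler_norm_sum _ _ _))// ler_sum// => j _.
  rewrite (le_trans (ler_norm_sum _ _ _))// ler_sum// => k _.
  rewrite normrM mulrC ler_pM//.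
  move: (v ord0 j) (Jmap v ord0 k) => x y.
  rewrite ler_norml; apply/andP; split.
    have := sqr_ge0 (x + y); rewrite expr2 => h; lra.
  have := sqr_ge0 (x - y); rewrite expr2 => h; lra.
rewrite le_eqVlt; apply/orP; left; apply/eqP.
under eq_bigr do rewrite -mulr_sumr -mulr_suml big_split/= sumr_const card_ord eN.
rewrite -mulr_sumr -mulr_suml big_split/= sumr_const card_ord sumrMnl eN.
rewrite sqre_Jmap sqim_Jmap [sqim v + _]addrC -!(mulr_natr (sqre v + sqim v)).
by move: (sqre v) (sqim v) => x y; field.
Qed.

Lemma comass_pairing A v : comass_le1 A -> `|pairing A v (Jmap v)| <= sqre v + sqim v.
Proof.
move=> cA; have [->|v0] := eqVneq v 0.
  by rewrite /pairing !mul0mx mxE normr0 addr_ge0// ?re2_ge0 ?im2_ge0.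
have e2 := enorm2 v.
have eJ : enorm (Jmap v) = enorm v.
  rewrite /enorm; congr Num.sqrt; rewrite /dotv !big_split_ord /=.
  by rewrite -/(sqre _) -/(sqim _) -/(sqre v) -/(sqim v) sqre_Jmap sqim_Jmap addrC.
have n0 : 0 <= enorm v by exact: sqrtr_ge0.
have nv : enorm v != 0.
  apply: contra v0 => /eqP h; move: e2; rewrite h expr0n/= => /esym/eqP.
  rewrite paddr_eq0 ?re2_ge0 ?im2_ge0// => /andP[/eqP h1 /eqP h2].
  apply/eqP/rowP => k; rewrite mxE -[k]splitK /unsplit.
  case: (fintype.split k) => j.
    by move/psumr_eq0P: h1 => /(_ (fun j _ => sqr_ge0 _) j isT)/eqP; rewrite mulf_eq0 orbb => /eqP.
  by move/psumr_eq0P: h2 => /(_ (fun j _ => sqr_ge0 _) j isT)/eqP; rewrite mulf_eq0 orbb => /eqP.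
have enZ (x : C3 R) : enorm ((enorm v)^-1 *: x) = (enorm v)^-1 * enorm x.
  rewrite {1 3}/enorm /dotv.
  under eq_bigr do rewrite !mxE mulrACA -expr2.
  by rewrite -mulr_sumr sqrtrM ?sqr_ge0// sqrtr_sqr ger0_norm// invr_ge0.
have := cA ((enorm v)^-1 *: v) ((enorm v)^-1 *: Jmap v).
rewrite !enZ eJ mulVf// lexx => /(_ isT isT).
have -> : pairing A ((enorm v)^-1 *: v) ((enorm v)^-1 *: Jmap v) =
   (enorm v)^-2 * pairing A v (Jmap v).
  rewrite /pairing linearZ/= -!scalemxAl -scalemxAr scalerA mxE.
  by rewrite -invfM -expr2.
rewrite normrM ger0_norm; last by rewrite invr_ge0 exprn_ge0.
by rewrite mulrC ler_pdivrMr ?mul1r -?e2// exprn_gt0// lt0r nv.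
Qed.

(** Skew-symmetry and [J^2 = - 1] make the left side of the second hypothesis equal to
    [pairing A v (Jmap v)], which is thus its own opposite. *)
Lemma skew_bidegree_pairing A v : A^T = - A ->
  pairing A (Jmap v) (Jmap (Jmap v)) = - pairing A v (Jmap v) ->
  pairing A v (Jmap v) = 0.
Proof.
move=> sA; rewrite JmapK => h.
have e : pairing A (Jmap v) (- v) = pairing A v (Jmap v).
  rewrite /pairing linearN /= mulmxN mxE.
  have -> : (Jmap v *m A *m v^T) ord0 ord0 = ((Jmap v *m A *m v^T)^T) ord0 ord0 by rewrite [RHS]mxE.
  by rewrite trmx_mul trmxK trmx_mul sA mulNmx mulmxN mxE opprK mulmxA.
move: h; rewrite e => h.
have : pairing A v (Jmap v) *+ 2 = 0 by rewrite mulr2n {1}h addNr.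
by move=> /eqP; rewrite mulrn_eq0 => /eqP.
Qed.

End PairingBounds.

(** * The gauge and a linear functional below it *)

Section HullCurrent.
Context {R : realType}.
Variables (K : set 'rV[R]_3) (p : 'rV[R]_3).
Hypothesis cK : compact K.
Hypothesis hp : minimal_hull K p.
Implicit Types (w f g : C3 R -> R) (alpha beta : two_form R) (q v : C3 R).

(** The sign of [a] keeps [w] bounded below on each fibre. The class is a convex cone, as
    sublinearity of the gauge requires, and contains both [u] and [- u] for a test function [u],
    which is what gives an equation and not just an inequality. *)
Definition admissible w : Prop := exists phi a G,
  [/\ test_function phi, 0 <= a, smooth G, depends_re G &
      w = fun q => phi q + a * sqim q + G q].

Lemma admissible_smooth w : admissible w -> smooth w.
Proof.
move=> [phi [a [G [[sphi _] _ sG _ ->]]]].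
exact: (smoothD (smoothD sphi (smoothZ a (@smooth_sqim R))) sG).
Qed.

Lemma admissibleD w1 w2 : admissible w1 -> admissible w2 ->
  admissible (fun q => w1 q + w2 q).
Proof.
move=> [phi [a [G [t a0 sG rG ->]]]] [phi' [a' [G' [t' a0' sG' rG' ->]]]].
exists (fun q => phi q + phi' q), (a + a'), (fun q => G q + G' q); split.
- exact: test_functionD.
- exact: addr_ge0.
- exact: (smoothD sG sG').
- by move=> q q' e; rewrite (rG _ _ e) (rG' _ _ e).
- by apply/funext => q; ring.
Qed.

Lemma admissibleZ (c : R) w : 0 <= c -> admissible w -> admissible (fun q => c * w q).
Proof.
move=> c0 [phi [a [G [t a0 sG rG ->]]]].
exists (fun q => c * phi q), (c * a), (fun q => c * G q); split.
- exact: test_functionZ.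
- exact: mulr_ge0.
- exact: (smoothZ c sG).
- by move=> q q' e; rewrite (rG _ _ e).
- by apply/funext => q; ring.
Qed.

Lemma admissible_re G : smooth G -> depends_re G -> admissible G.
Proof.
move=> sG rG; exists (cst 0), 0, G; split => //; first exact: test_function0.
by apply/funext => q; rewrite mul0r !add0r.
Qed.

Lemma admissible_test phi : test_function phi -> admissible phi.
Proof.
move=> tphi; exists phi, 0, (cst 0); split => //; first exact: smooth_cst.
by apply/funext => q; rewrite mul0r !addr0.
Qed.

Lemma depends_re_sqre : depends_re (@sqre R).
Proof. by move=> q q' e; rewrite !sqreE e. Qed.

(** Here the hull hypothesis enters: minus the fibre infimum of [w] is minimal plurisubharmonic and
    at most 0 on [K], hence at most 0 at [p]. *)
Lemma hull_superharmonic w : admissible w ->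
  (forall q v, null_vector v -> levi w q v <= 0) ->
  (forall q, tube K q -> 0 <= w q) -> 0 <= w (real_pt p).
Proof.
move=> [phi [a [G [t a0 sG rG ->]]]] lw wK.
have psh := sup_fiber_psh t a0 sG rG lw.
have h := hp psh.
have : (ereal_sup ((fun x => (- inf_fiber phi G a x)%:E) @` K) <= 0)%E.
  apply: ge_ereal_sup => _ [x Kx <-]; rewrite lee_fin oppr_le0.
  apply: (le_inf_fiber rG) => y.
  by apply: wK; rewrite /tube /= re_row_mx.
move=> /(le_trans h); rewrite lee_fin oppr_le0 => /le_trans; apply.
exact: (inf_fiber_le t a0 rG).
Qed.

(* A pair [(T, L)] with [T alpha + L f <= w p] for all majorants [w] of
   [(alpha, f)] consists of a null positive current and a positive functional on
   the tube; taking [w = u] and [w = - u] gives [T (ddc u) = L u - u p]. *)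
Definition majorant alpha f w : Prop :=
  [/\ admissible w,
      forall q v, null_vector v -> levi w q v + pairing (alpha q) v (Jmap v) <= 0 &
      forall q, tube K q -> f q <= w q].

(** Boundedness, not compact support: the functional on the second factor must act on all bounded
    continuous functions for the Riesz theorem, and bounds are enough to produce majorants. *)
Definition bounded_pair (x : two_form R * (C3 R -> R)) : Prop :=
  (exists C, forall q j k, `|x.1 q j k| <= C) /\ (exists M, forall q, `|x.2 q| <= M).

Definition hull_gauge (x : two_form R * (C3 R -> R)) : R :=
  inf [set w (real_pt p) | w in majorant x.1 x.2].

Lemma K_bounded : exists M0, [/\ 0 <= M0, forall q, tube K q -> sqre q <= M0 &
  sqre (real_pt p) <= M0].
Proof.
have /compact_bounded[C [_ hC]] := cK.
pose B := `|C| + 1.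
have B0 : 0 <= B by rewrite addr_ge0.
have hB x : K x -> `|x| <= B.
  by apply: hC; rewrite (le_lt_trans (ler_norm C))// ltrDl.
(* The norm on rows is the maximum norm, so the Euclidean square in three variables is at most 3
   times its square. *)
exists (3 * B ^+ 2 + sqre (real_pt p)); split.
- by rewrite addr_ge0 ?re2_ge0// mulr_ge0// exprn_ge0.
- by move=> q Kq; rewrite ler_wpDr ?re2_ge0// sqreE; apply: dotv_le_norm; exact: hB.
- by rewrite lerDr mulr_ge0// exprn_ge0.
Qed.

Lemma smooth_quad (b c : R) : smooth (fun q : C3 R => b * (c - sqre q)).
Proof. exact: (smoothZ b (smoothB (smooth_cst c) (@smooth_sqre R))). Qed.

Lemma levi_quad (b c : R) q v :
  levi (fun q : C3 R => b * (c - sqre q)) q v = - (b * (2 * (sqre v + sqim v))).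
Proof.
have -> : (fun q : C3 R => b * (c - sqre q)) = (fun q => (b * c) + (- b) * sqre q).
  by apply/funext => z; ring.
rewrite (leviD _ _ (smooth_cst (b * c)) (smoothZ (- b) (@smooth_sqre R))).
rewrite (leviZ (- b) _ _ (@smooth_sqre R)) levi_sqre /levi !hess_cst; ring.
Qed.

(** The Levi form of [- B * |x|^2] is [- 2 B * |v|^2], which absorbs the form, while [M0] keeps the
    quadratic part nonnegative on the tube. The value at [p] then yields explicit bounds for the
    functional. *)
Lemma majorant_quad M0 alpha f (B M : R) : 0 <= B ->
  (forall q, tube K q -> sqre q <= M0) ->
  (forall q v, null_vector v -> pairing (alpha q) v (Jmap v) <= 2 * B * (sqre v + sqim v)) ->
  (forall q, tube K q -> f q <= M) ->
  majorant alpha f (fun q => B * (M0 - sqre q) + M).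
Proof.
move=> B0 hM0 ha hf; split.
- apply: admissible_re; first exact: (smoothD (smooth_quad B M0) (smooth_cst M)).
  by move=> q q' e; rewrite (depends_re_sqre e).
- move=> q v nv; rewrite (leviD _ _ (smooth_quad B M0) (smooth_cst M)) levi_quad.
  have -> : levi (cst M) q v = 0 by rewrite /levi !hess_cst addr0.
  have := ha q v nv; rewrite mulrA [B * 2]mulrC => h.
  by rewrite addr0 addrC subr_le0.
- move=> q Kq; rewrite -[leLHS]add0r lerD ?hf// mulr_ge0// subr_ge0; exact: hM0.
Qed.

Lemma majorant_exists x : bounded_pair x -> exists w, majorant x.1 x.2 w.
Proof.
move=> [[C hC] [M hM]]; have [M0 [_ hM0 _]] := K_bounded.
(* Here [2 * (3 * C)] is the [6 * C] of [pairing_bound]. *)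
exists (fun q => (3 * C) * (M0 - sqre q) + M); apply: majorant_quad => //.
- by rewrite mulr_ge0// (le_trans _ (hC 0 ord0 ord0)).
- move=> q v _; have := pairing_bound v (hC q); rewrite ler_norml => /andP[_].
  by rewrite mulrA -natrM.
- by move=> q _; have := hM q; rewrite ler_norml => /andP[].
Qed.

Lemma majorantD alpha beta f g w1 w2 : majorant alpha f w1 -> majorant beta g w2 ->
  majorant (alpha + beta) (f + g) (fun q => w1 q + w2 q).
Proof.
move=> [a1 l1 m1] [a2 l2 m2]; split.
- exact: admissibleD.
- move=> q v nv; rewrite (leviD _ _ (admissible_smooth a1) (admissible_smooth a2)).
  rewrite fctE pairingD addrACA -[leRHS]addr0 lerD//; [exact: l1|exact: l2].
- by move=> q Kq; rewrite lerD//; [exact: m1|exact: m2].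
Qed.

Lemma majorantZ (c : R) alpha f w : 0 <= c -> majorant alpha f w ->
  majorant (c *: alpha) (c *: f) (fun q => c * w q).
Proof.
move=> c0 [a1 l1 m1]; split.
- exact: admissibleZ.
- move=> q v nv; rewrite (leviZ c _ _ (admissible_smooth a1)).
  rewrite [(c *: alpha) q]/(c *: alpha q) pairingZ -mulrDr.
  by rewrite mulr_ge0_le0//; exact: l1.
- by move=> q Kq; rewrite ler_wpM2l//; exact: m1.
Qed.

Lemma bounded_pairN x : bounded_pair x -> bounded_pair (- x).
Proof.
move=> [[C hC] [M hM]]; split.
  by exists C => q j k; rewrite mxE normrN.
by exists M => q; rewrite normrN.
Qed.

(** The sum of the two majorants is a majorant of the zero pair, to which [hull_superharmonic]
    applies. This is the finiteness of the gauge. *)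
Lemma majorant_lb x w w' : majorant x.1 x.2 w -> majorant (- x).1 (- x).2 w' ->
  - w' (real_pt p) <= w (real_pt p).
Proof.
move=> m1 m2; have := majorantD m1 m2; rewrite /= !subrr => -[a l m].
rewrite -subr_ge0 opprK addrC; have := hull_superharmonic a; rewrite addrC; apply.
  by move=> q v nv; have := l q v nv; rewrite pairing0 addr0.
by move=> q Kq; exact: m.
Qed.

Lemma hull_gauge_le x w : bounded_pair x -> majorant x.1 x.2 w ->
  hull_gauge x <= w (real_pt p).
Proof.
move=> bx m; apply: ge_inf; last by exists w.
have [w' m'] := majorant_exists (bounded_pairN bx).
by exists (- w' (real_pt p)) => _ [w2 m2 <-]; exact: majorant_lb m2 m'.
Qed.

Lemma le_hull_gauge x (c : R) : bounded_pair x ->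
  (forall w, majorant x.1 x.2 w -> c <= w (real_pt p)) -> c <= hull_gauge x.
Proof.
move=> bx h; apply: lb_le_inf; last by move=> _ [w m <-]; exact: h.
by have [w m] := majorant_exists bx; exists (w (real_pt p)), w.
Qed.

Lemma bounded_pair0 : bounded_pair 0.
Proof. by split; [exists 0 => q j k; rewrite mxE normr0|exists 0 => q; rewrite normr0]. Qed.

Lemma bounded_pairP (a : R) x y : bounded_pair x -> bounded_pair y ->
  bounded_pair (a *: x + y).
Proof.
move=> [[C hC] [M hM]] [[C' hC'] [M' hM']]; split.
  exists (`|a| * C + C') => q j k.
  rewrite [_ q]/(a *: x.1 q + y.1 q) !mxE (le_trans (ler_normD _ _))// lerD//.
  by rewrite normrM ler_wpM2l.
exists (`|a| * M + M') => q.
rewrite [_ q]/(a * x.2 q + y.2 q) (le_trans (ler_normD _ _))// lerD//.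
by rewrite normrM ler_wpM2l.
Qed.

Lemma hull_gauge_sublinear : sublinear_on bounded_pair hull_gauge.
Proof.
have bD x y : bounded_pair x -> bounded_pair y -> bounded_pair (x + y).
  by move=> bx bY; have := bounded_pairP 1 bx bY; rewrite scale1r.
have bZ c x : bounded_pair x -> bounded_pair (c *: x).
  by move=> bx; have := bounded_pairP c bx bounded_pair0; rewrite addr0.
split=> [x y bx bY|].
  rewrite -lerBlDr; apply: le_hull_gauge => // w1 m1.
  rewrite lerBlDr -lerBlDl; apply: le_hull_gauge => // w2 m2.
  rewrite lerBlDl; apply: (hull_gauge_le (w := fun q => w1 q + w2 q)); first exact: bD.
  exact: majorantD.
apply: (homogeneous_le bounded_pair0 bounded_pairP) => c x c0 bx.
rewrite mulrC -ler_pdivrMr//; apply: le_hull_gauge => // w m.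
rewrite ler_pdivrMr// mulrC; apply: (hull_gauge_le (w := fun q => c * w q)); first exact: bZ.
by apply: majorantZ => //; exact: ltW.
Qed.

(** [T] and [L] restrict one dominated linear functional to the two factors; the joint inequality in
    the last clause keeps the link between them. *)
Lemma hull_functional : exists (T : two_form R -> R) (L : (C3 R -> R) -> R), [/\
  forall a alpha beta, (exists C, forall q j k, `|alpha q j k| <= C) ->
    (exists C, forall q j k, `|beta q j k| <= C) ->
    T (a *: alpha + beta) = a * T alpha + T beta,
  forall a f g, (exists M, forall q, `|f q| <= M) -> (exists M, forall q, `|g q| <= M) ->
    L (a *: f + g) = a * L f + L g &
  forall alpha f w, (exists C, forall q j k, `|alpha q j k| <= C) ->
    (exists M, forall q, `|f q| <= M) -> majorant alpha f w ->
    T alpha + L f <= w (real_pt p)].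
Proof.
have [F [linF leF]] := hahn_banach bounded_pair0 bounded_pairP hull_gauge_sublinear.
have [[C0 h0] [M0 h0']] := bounded_pair0.
have b1 alpha : (exists C, forall q j k, `|alpha q j k| <= C) ->
  bounded_pair (alpha, 0 : C3 R -> R) by move=> h; split => //; exists M0.
have b2 (f : C3 R -> R) : (exists M, forall q, `|f q| <= M) ->
  bounded_pair (0 : two_form R, f) by move=> h; split => //; exists C0.
exists (fun alpha => F (alpha, 0)), (fun f => F (0, f)); split.
- move=> a alpha beta ba bb; rewrite -linF; [|exact: b1|exact: b1].
  by congr F; apply/pair_equal_spec; split; rewrite //= scaler0 addr0.
- move=> a f g bf bg; rewrite -linF; [|exact: b2|exact: b2].
  by congr F; apply/pair_equal_spec; split; rewrite //= scaler0 addr0.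
- move=> alpha f w ba bf m.
  have := linF 1 _ _ (b1 _ ba) (b2 _ bf); rewrite scale1r mul1r => <-.
  have e : (alpha, 0 : C3 R -> R) + (0 : two_form R, f) = (alpha, f).
    by apply/pair_equal_spec; split; rewrite /= ?addr0 ?add0r.
  rewrite e (le_trans (leF _ _))//.
  exact: hull_gauge_le.
Qed.

End HullCurrent.

(** * From the hull to a current *)

Section HullToCurrent.
Context {R : realType}.
Implicit Types (w f g u : C3 R -> R) (alpha beta : two_form R) (q v : C3 R).

Lemma test_form_bounded alpha : test_form alpha -> exists C, forall q j k, `|alpha q j k| <= C.
Proof.
move=> [_ sa ca].
have h (jk : 'I_(3 + 3) * 'I_(3 + 3)) : exists C, 0 <= C /\
    forall q, `|alpha q jk.1 jk.2| <= C.
  apply: (csupp_bounded _ ca); first by apply: smooth_continuous; exact: sa.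
  by move=> q nq; rewrite (not_supp nq) mxE.
have [C hC] := choice h.
exists (\sum_jk C jk) => q j k; have [_ hjk] := hC (j, k).
rewrite (le_trans (hjk q))// (bigD1 (j, k))//= lerDl sumr_ge0// => i _.
by have [] := hC i.
Qed.

Lemma supp_subset (V W : zmodType) (f : C3 R -> V) (g : C3 R -> W) :
  (forall q, g q = 0 -> f q = 0) -> supp f `<=` supp g.
Proof.
by move=> h; apply: closure_subset => q /=; apply: contra_neq => /h.
Qed.

Lemma closed_supp (V : zmodType) (f : C3 R -> V) : closed (supp f).
Proof. exact: closed_closure. Qed.

Lemma supp_subset_closed (V : zmodType) (f : C3 R -> V) (A : set (C3 R)) : closed A ->
  (forall q, ~ A q -> f q = 0) -> supp f `<=` A.
Proof.
move=> cA h; rewrite [X in _ `<=` X](closure_id A).1//.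
apply: closure_subset => q /= fq; apply: contrapT => /h e.
by rewrite e eqxx in fq.
Qed.

Lemma test_formD alpha beta : test_form alpha -> test_form beta ->
  test_form (fun q => alpha q + beta q).
Proof.
move=> [a1 a2 a3] [b1 b2 b3]; split.
- by move=> q; rewrite linearD /= a1 b1 opprD.
- move=> j k; have := smoothD (a2 j k) (b2 j k).
  by congr smooth; apply/funext => q; rewrite mxE.
- apply: subclosed_compact (compactU a3 b3) _; first exact: closed_supp.
  apply: supp_subset_closed; first by apply: closedU; exact: closed_supp.
  by move=> q /not_orP[/not_supp -> /not_supp ->]; rewrite addr0.
Qed.

Lemma test_formM f alpha : smooth f -> test_form alpha -> test_form (fun q => f q *: alpha q).
Proof.
move=> sf [a1 a2 a3]; split.
- by move=> q; rewrite linearZ /= a1 scalerN.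
- move=> j k; have := smoothM sf (a2 j k).
  by congr smooth; apply/funext => q; rewrite mxE.
- apply: subclosed_compact a3 _; first exact: closed_supp.
  by apply: supp_subset => q ->; rewrite scaler0.
Qed.

Lemma ddc0 u q : smooth u -> ~ supp u q -> ddc u q = 0.
Proof.
move=> su nq.
have z i l : partial1 i (partial1 l u) q = 0.
  apply: partial1_supp => sq; apply: nq.
  apply: (supp_subset_closed _ _ sq); first exact: closed_supp.
  by move=> q' /partial1_supp.
have z0 i h : \sum_l Jmap (ebase R i) ord0 l * partial1 h (partial1 l u) q = 0.
  by apply: big1 => l _; rewrite (z h l) mulr0.
by apply/matrixP => j k; rewrite (ddc_entry q j k su) [LHS](congr2 (fun x y => - x + y) (z0 k j) (z0 j k)) oppr0 addr0 mxE.
Qed.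

Lemma supp_ddc u : smooth u -> supp (ddc u) `<=` supp u.
Proof.
by move=> su; apply: supp_subset_closed; [exact: closed_supp|move=> q; exact: ddc0].
Qed.

Lemma test_form_ddc u : test_function u -> test_form (ddc u).
Proof.
move=> [su cu]; split.
- by move=> q; apply/matrixP => j k; rewrite !mxE opprB.
- move=> j k; rewrite (_ : (fun q => _) = fun q =>
    - (\sum_(l < 3 + 3) Jmap (ebase R k) ord0 l * partial1 j (partial1 l u) q) +
    \sum_(l < 3 + 3) Jmap (ebase R j) ord0 l * partial1 k (partial1 l u) q); last first.
    by apply/funext => q; rewrite (ddc_entry q j k su).
  have s i h : smooth (fun q => \sum_(l < 3 + 3) Jmap (ebase R i) ord0 l * partial1 h (partial1 l u) q).
    apply: smooth_sum => l _; apply: smoothZ; apply: smooth_partial1; exact: smooth_partial1.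
  exact: smoothD (smoothN (s k j)) (s j k).
- apply: subclosed_compact cu _; first exact: closed_supp.
  exact: supp_ddc.
Qed.

Lemma ddc_bounded u : test_function u -> exists C, forall q j k, `|ddc u q j k| <= C.
Proof. by move=> tu; apply: test_form_bounded; exact: test_form_ddc. Qed.

Lemma re_part_continuous : continuous (@re_part R).
Proof.
move=> q; apply/(@cvgrPdist_le _ _ _ (nbhs q)) => e e0.
apply/nbhs_ballP; exists e => //= q'; rewrite -ball_normE /= => h.
rewrite (le_trans _ (ltW h))//; apply: norm_le_coord => // k.
have -> : (re_part q - re_part q') ord0 k = (q - q') ord0 (lshift 3 k).
  by rewrite /re_part !mxE.
exact: coord_le_norm.
Qed.

Lemma compact_tube_slab (K : set 'rV[R]_3) (M : R) : compact K ->
  compact (tube K `&` [set q | sqim q <= M]).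
Proof.
move=> cK; apply: bounded_closed_compact.
  have /compact_bounded[C [_ hC]] := cK.
  have hB x : K x -> `|x| <= `|C| + 1.
    by apply: hC; rewrite (le_lt_trans (ler_norm C))// ltrDl.
  exists (`|C| + 1 + (1 + `|M|)); split; first exact: num_real.
  move=> B hBb q [Kq Mq] /=; rewrite (le_trans _ (ltW hBb))//.
  have M1 : 0 <= 1 + `|M| by rewrite addr_ge0.
  have C1 : 0 <= `|C| + 1 by rewrite addr_ge0.
  apply: norm_le_coord; first exact: addr_ge0.
  move=> k; rewrite -[k]splitK /unsplit; case: (fintype.split k) => j.
    rewrite lshift_re ler_wpDr// (le_trans (coord_le_norm _ _))//.
    exact: hB.
  rewrite ler_wpDl// rshift_im (le_trans (coord_le_norm _ _))// norm_le_dotv// -sqimE.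
  have qM : sqim q <= M := Mq; rewrite (le_trans qM)// (le_trans (ler_norm M))//.
  by rewrite sqrrD expr1n mul1r -addrA addrCA mulr2n -!addrA lerDl !addr_ge0.
apply: closedI.
  apply: closed_comp; first by move=> q _; exact: re_part_continuous.
  exact: compact_closed (@norm_hausdorff _ _) cK.
have -> : [set q | sqim q <= M] = @sqim R @^-1` [set x | x <= M] by [].
apply: closed_comp; last exact: closed_le.
by move=> q _; apply: smooth_continuous; exact: smooth_sqim.
Qed.

Lemma hull_to_current (K : set 'rV[R]_3) (p : 'rV[R]_3) : compact K ->
  minimal_hull K p ->
  exists T : functional R,
    [/\ null_positive_current T,
        (mass T < +oo)%E,
        bounded_set (@re_part R @` current_supp T)
      & exists mu : probability (borelC3 R) R,
          mu (tube K) = 1%E /\ ddc_current_eq T mu p].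
Proof.
move=> cK hp.
have [T [L [linT linL TL]]] := hull_functional cK hp.
have [M0 [M00 hM0 pM0]] := K_bounded p cK.
have b0 : exists C : R, forall (q : C3 R) j k, `|(0 : two_form R) q j k| <= C.
  by exists 0 => q j k; rewrite mxE normr0.
have bf0 : exists M : R, forall q : C3 R, `|(0 : C3 R -> R) q| <= M.
  by exists 0 => q; rewrite normr0.
have T0 : T 0 = 0.
  have := linT 1 0 0 b0 b0; rewrite scale1r mul1r addr0 => h.
  by apply: (@addrI _ (T 0)); rewrite -h addr0.
have L0 : L 0 = 0.
  have := linL 1 0 0 bf0 bf0; rewrite scale1r mul1r addr0 => h.
  by apply: (@addrI _ (L 0)); rewrite -h addr0.
have TN alpha : (exists C, forall q j k, `|alpha q j k| <= C) -> T (- alpha) = - T alpha.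
  by move=> ba; have := linT (-1) alpha 0 ba b0; rewrite scaleN1r addr0 mulN1r T0 addr0.
have LN f : (exists M, forall q, `|f q| <= M) -> L (- f) = - L f.
  by move=> bf; have := linL (-1) f 0 bf bf0; rewrite scaleN1r addr0 mulN1r L0 addr0.
have Tw alpha w : (exists C, forall q j k, `|alpha q j k| <= C) ->
    majorant K alpha 0 w -> T alpha <= w (real_pt p).
  by move=> ba m; have := TL _ _ _ ba bf0 m; rewrite L0 addr0.
have Lw f w : (exists M, forall q, `|f q| <= M) ->
    majorant K 0 f w -> L f <= w (real_pt p).
  by move=> bf m; have := TL _ _ _ b0 bf m; rewrite T0 add0r.
have bN alpha : (exists C, forall q j k, `|alpha q j k| <= C) ->
    exists C, forall q j k, `|(- alpha) q j k| <= C.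
  by move=> [C hC]; exists C => q j k; rewrite mxE normrN.
have bfN f : (exists M, forall q, `|f q| <= M) -> exists M, forall q, `|(- f) q| <= M.
  by move=> [C hC]; exists C => q; rewrite normrN.
(* The quadratic majorant with [f = 0]: positivity is the case [B = 0], and continuity and finite
   mass come from larger [B]. *)
have Tle alpha (B : R) : (exists C, forall q j k, `|alpha q j k| <= C) -> 0 <= B ->
    (forall q v, null_vector v -> pairing (alpha q) v (Jmap v) <= 2 * B * (sqre v + sqim v)) ->
    T alpha <= B * (M0 - sqre (real_pt p)).
  move=> ba B0 hB.
  have := Tw _ _ ba (@majorant_quad _ K M0 alpha 0 B 0 B0 hM0 hB (fun q _ => lexx _)).
  by rewrite addr0.
have Mp : 0 <= M0 - sqre (real_pt p) by rewrite subr_ge0.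
have Tpos alpha : (exists C, forall q j k, `|alpha q j k| <= C) ->
   null_positive_form alpha -> 0 <= T alpha.
  move=> ba na; rewrite -oppr_le0 -TN//.
  have := Tle _ 0 (bN _ ba) (lexx _); rewrite mul0r; apply => q v nv.
  rewrite mulr0 mul0r; have -> : (- alpha) q = (-1) *: alpha q by rewrite scaleN1r.
  by rewrite pairingZ mulN1r oppr_le0; exact: na.
have Tddc u : test_function u -> T (ddc u) - L u = - u (real_pt p).
  move=> tu.
  have bu : exists M, forall q, `|u q| <= M.
    by have [C [_ hC]] := test_function_bounded tu; exists C.
  have bd := ddc_bounded tu.
  have su := tu.1.
  apply/eqP; rewrite eq_le; apply/andP; split.
    have := TL (ddc u) (- u) (fun q => - u q) bd (bfN _ bu); rewrite LN//; apply.
    split => //; first by apply: admissible_test; exact: test_functionN.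
    move=> q v nv; rewrite ddc_pairing//.
    have -> : (fun q => - u q) = (fun q => (-1) * u q) by apply/funext => z; rewrite mulN1r.
    by rewrite leviZ// mulN1r addNr.
  rewrite lerNl opprB addrC.
  have := TL (- ddc u) u u (bN _ bd) bu; rewrite TN//; apply.
  split => //; first exact: admissible_test.
  move=> q v nv; have -> : (- ddc u) q = (-1) *: ddc u q by rewrite scaleN1r.
  by rewrite pairingZ ddc_pairing// mulN1r subrr.
exists T; split.
- split.
  + split.
      move=> a alpha beta ta tb; apply: linT; exact: test_form_bounded.
    (* The current has order zero, with a bound independent of the compact set; 3 is half the
       constant of [pairing_bound]. *)
    move=> Q cQ; exists 0%N, (3 * (M0 - sqre (real_pt p))) => alpha M ta sQ hM.
    have hC q j k : `|alpha q j k| <= M by have := hM [::] isT j k q.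
    have ba : exists C, forall q j k, `|alpha q j k| <= C by exists M.
    have M_ge0 : 0 <= M by apply: le_trans (hC 0 ord0 ord0).
    have M3 : 0 <= 3 * M by rewrite mulr_ge0.
    have pb q v : `|pairing (alpha q) v (Jmap v)| <= 2 * (3 * M) * (sqre v + sqim v).
      by have := pairing_bound v (hC q); rewrite mulrA -natrM.
    have e : 3 * (M0 - sqre (real_pt p)) * M = 3 * M * (M0 - sqre (real_pt p)) by rewrite mulrAC.
    rewrite e ler_norml; apply/andP; split.
      rewrite lerNl -TN//; apply: Tle => //; first exact: bN.
      move=> q v nv; have -> : (- alpha) q = (-1) *: alpha q by rewrite scaleN1r.
      by rewrite pairingZ mulN1r; have := pb q v; rewrite ler_norml lerNl => /andP[].
    by apply: Tle => // q v nv; have := pb q v; rewrite ler_norml => /andP[].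
  + move=> alpha ta h.
    have ba := test_form_bounded ta; have [sk _ _] := ta.
    have p0 q v : pairing (alpha q) v (Jmap v) = 0.
      by apply: skew_bidegree_pairing => //; exact: h.
    apply/eqP; rewrite eq_le; apply/andP; split.
      have := Tle _ 0 ba (lexx _); rewrite mul0r; apply => q v _.
      by rewrite p0 mulr0 mul0r.
    by apply: Tpos => // q v _; rewrite p0.
  + by move=> alpha ta; apply: Tpos; exact: test_form_bounded.
(* Comass at most 1 gives [pairing <= |v|^2], the hypothesis of [Tle] with [B = 1 / 2]. *)
- apply: (@le_lt_trans _ _ (2^-1 * (M0 - sqre (real_pt p)))%:E); last exact: ltry.
  apply: ge_ereal_sup => _ [alpha [ta ca] <-]; rewrite lee_fin.
  apply: Tle => //; first exact: test_form_bounded.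
  move=> q v _; rewrite mulfV// mul1r.
  by have := comass_pairing v (ca q); rewrite ler_norml => /andP[].
(* A form supported in [|x|^2 > M0] is dominated by a multiple of the barrier, which vanishes on the
   tube and at [p]. So [T] is at most 0 on it and on its opposite. *)
- have suppM0 q : current_supp T q -> sqre q <= M0.
    move=> sq; rewrite leNgt; apply/negP => Mq.
    pose U := [set q : C3 R | M0 < sqre q].
    have oU : open U.
      have -> : U = @sqre R @^-1` [set x | M0 < x] by [].
      apply: open_comp; last exact: open_gt.
      by move=> x _; apply: smooth_continuous; exact: smooth_sqre.
    have [alpha [ta sa /eqP]] := sq U oU Mq; apply.
    have T_le0 beta : test_form beta -> supp beta `<=` U -> T beta <= 0.
      move=> tb sb; have bb := test_form_bounded tb; have [C hC] := bb.
      have [_ _ cb] := tb.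
      have [c [c0 hc]] : exists c, 0 < c /\ forall q, supp beta q -> c <= flat 1 (sqre q - M0).
        have [[z sz]|/forallNP n0] := pselect (exists z, supp beta z); last first.
          by exists 1; split => // q0 /n0.
        have cf : {within supp beta, continuous (fun q : C3 R => flat 1 (sqre q - M0))}.
          apply: continuous_subspaceT; apply: smooth_continuous; apply: smooth_flat.
          exact: smooth_sqreB.
        have [z0 z0s hz0] := compact_EVT_min (ex_intro _ z sz) cb cf.
        exists (flat 1 (sqre z0 - M0)); split.
          by apply: flat1_gt0; rewrite subr_gt0; apply: sb; rewrite inE in z0s.
        by move=> q0 sq0; apply: hz0; rewrite inE.
      have C0 : 0 <= C by apply: le_trans (hC 0 ord0 ord0).
      (* [D * (2 * c)] is the [6 * C] of [pairing_bound], and [c] bounds the exponential factor from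
         below on the support. *)
      pose D := 3 * C / c.
      have D0 : 0 <= D by rewrite divr_ge0 ?mulr_ge0// ltW.
      have mb : majorant K beta 0 (fun q => (- D) * barrier M0 q).
        split.
        - apply: admissible_re; first by apply: smoothZ; exact: smooth_barrier.
          by move=> x y e; rewrite /barrier (depends_re_sqre e).
        - move=> x v nv; rewrite leviZ; last exact: smooth_barrier.
          rewrite mulNr addrC subr_le0.
          have lb := levi_barrier M0 x v.
          have vv : 0 <= sqre v + sqim v by rewrite addr_ge0 ?re2_ge0 ?im2_ge0.
          have [sx|/not_supp ->] := pselect (supp beta x); last first.
            rewrite pairing0 mulr_ge0// (le_trans _ lb)//.
            by rewrite !mulr_ge0 ?flat1_ge0.
          have := pairing_bound v (hC x); rewrite ler_norml => /andP[_ h].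
          rewrite (le_trans h)// (@le_trans _ _ (D * (2 * c * (sqre v + sqim v))))//.
            by rewrite le_eqVlt /D; apply/orP; left; apply/eqP; field; rewrite gt_eqF.
          rewrite ler_wpM2l// (le_trans _ lb)// ler_wpM2r// ler_wpM2l//.
          exact: hc.
        - by move=> x Kx; rewrite barrier0 ?mulr0//; exact: hM0.
      have := Tw _ _ bb mb; rewrite barrier0 ?mulr0//.
    have ba := test_form_bounded ta.
    apply/eqP; rewrite eq_le T_le0//= -oppr_le0 -TN//; apply: T_le0.
      have [t1 t2 t3] := ta; split.
      + by move=> x; rewrite [(- alpha) x]/(- alpha x) linearN /= t1.
      + move=> j k; have := smoothN (t2 j k).
        by congr smooth; apply/funext => x; rewrite mxE.
      + rewrite /supp (_ : [set x | (- alpha) x != 0] = [set x | alpha x != 0])//.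
        by apply/seteqP; split => x /=; rewrite oppr_eq0.
    rewrite /supp (_ : [set x | (- alpha) x != 0] = [set x | alpha x != 0])//.
    by apply/seteqP; split => x /=; rewrite oppr_eq0.
  exists (Num.sqrt M0); split; first exact: num_real.
  move=> B hB _ [q sq <-] /=; rewrite (le_trans _ (ltW hB))// norm_le_dotv ?sqrtr_ge0//.
  by rewrite sqr_sqrtr// -sqreE; exact: suppM0.
have L1 : L (cst 1) = 1.
  have b1 : exists M, forall q : C3 R, `|(cst 1 : C3 R -> R) q| <= M by exists 1 => q; rewrite normr1.
  have mj (a : R) : majorant K 0 (cst a) (cst a).
    split => //; first by apply: admissible_re => //; exact: smooth_cst.
    by move=> q v nv; rewrite /levi !hess_cst pairing0 !addr0.
  apply/eqP; rewrite eq_le (Lw _ _ b1 (mj 1))/= -lerN2 -LN//.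
  by have := Lw _ _ (bfN _ b1) (mj (-1)).
have cbb f : cbounded f -> exists M, forall q, `|f q| <= M by case.
have [||||mu [muK muL]] := @riesz_probability _ L (tube K).
- by move=> a f g bf bg; apply: linL; exact: cbb.
- move=> f bf f0; rewrite -oppr_le0 -LN; last exact: cbb.
  have m0 : majorant K 0 (- f) (cst 0).
    split; first by apply: admissible_re => //; exact: smooth_cst.
      by move=> q v nv; rewrite /levi !hess_cst pairing0 !addr0.
    by move=> q Kq; rewrite oppr_le0 f0.
  exact: Lw (bfN _ (cbb _ bf)) m0.
- exact: L1.
- move=> e e0.
  pose N := (M0 - sqre (real_pt p)) / e + 1.
  have N0 : 0 < N by rewrite ltr_wpDl// divr_ge0// ltW.
  exists (tube K `&` [set q | sqim q <= N]); split.
  + exact: compact_tube_slab.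
  + by move=> q [].
  move=> f bf f01 fA.
  (* The Levi forms of [|y|^2] and [|x|^2] coincide, so that of [w] is zero. On the tube [w] is
     nonnegative, and at least 1 where [|y|^2 > N]; at [p] it equals [(M0 - |p|^2) / N], at most [e]
     by the choice of [N]. *)
  pose w q := N^-1 * sqim q + N^-1 * (M0 - sqre q).
  have Ni : 0 <= N^-1 by rewrite invr_ge0 ltW.
  have mw : majorant K 0 f w.
    split.
    - exists (cst 0), N^-1, (fun q => N^-1 * (M0 - sqre q)); split => //.
      + exact: test_function0.
      + exact: smooth_quad.
      + by move=> x y ee; rewrite (depends_re_sqre ee).
      + by apply/funext => q; rewrite /w /cst add0r.
    - move=> q v nv.
      rewrite (leviD _ _ (smoothZ _ (@smooth_sqim R)) (smooth_quad _ _)).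
      rewrite (leviZ _ _ _ (@smooth_sqim R)) levi_quad levi_sqim pairing0.
      by rewrite addr0 subrr.
    - move=> q Kq; have q0 : 0 <= N^-1 * (M0 - sqre q) by rewrite mulr_ge0// subr_ge0 hM0.
      have [qN|Nq] := leP (sqim q) N.
        by rewrite fA// addr_ge0// mulr_ge0// im2_ge0.
      have /andP[_ f1] := f01 q; rewrite (le_trans f1)// ler_wpDr//.
      by rewrite mulrC ler_pdivlMr// mul1r ltW.
  have := Lw _ _ (cbb _ bf) mw; move=> /le_trans; apply.
  have -> : w (real_pt p) = N^-1 * (M0 - sqre (real_pt p)).
    rewrite /w sqimE /real_pt im_row_mx {1}/dotv big1 ?mulr0 ?add0r// => j _.
    by rewrite mxE mulr0.
  rewrite mulrC ler_pdivrMr// /N mulrDr mulr1 mulrC divfK ?gt_eqF// lerDl.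
  exact: ltW.
exists mu; split => // u tu.
have cu := smooth_continuous tu.1.
have bu : cbounded u.
  by split => //; have [C [_ hC]] := test_function_bounded tu; exists C.
rewrite muL// integral_dirac//; last first.
  by apply/measurable_EFinP; exact: continuous_borel.
rewrite diracT mul1e -EFinB; congr EFin.
by have := Tddc u tu => h; rewrite -[LHS](subrK (L u)) h addrC.
Qed.

End HullToCurrent.

(** * Lattice sums *)

Section Translation.
Context {R : realType}.
Implicit Types (u f g : C3 R -> R) (q v w a : C3 R).

Lemma partial1_shift f a k : partial1 k (fun q => f (q + a)) = fun q => partial1 k f (q + a).
Proof.
apply/funext => q; rewrite /partial1 /derive.
by under eq_fun do rewrite /= -addrA.
Qed.

Lemma smooth_shift f a : smooth f -> smooth (fun q => f (q + a)).
Proof.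
move=> sf; apply/CnP => n; elim: n f sf => [|n IH] f sf /=.
  move=> q; apply: continuous_comp; last exact: smooth_continuous.
  exact: cvgD (@cvg_id _ _) (@cvg_cst _ _ _ _ _).
split.
- move=> q; apply: continuous_comp; last exact: smooth_continuous.
  exact: cvgD (@cvg_id _ _) (@cvg_cst _ _ _ _ _).
- move=> k q; have := @smooth_derivable _ _ (q + a) k sf.
  by rewrite /derivable; under eq_fun do rewrite /= addrA.
- by move=> k; rewrite partial1_shift; apply: IH; exact: smooth_partial1.
Qed.

Lemma hess_shift f a q v w : hess (fun q => f (q + a)) q v w = hess f (q + a) v w.
Proof.
apply: eq_bigr => j _; apply: eq_bigr => k _.
by rewrite (partial1_shift f a k) (partial1_shift (partial1 k f) a j).
Qed.

Lemma levi_shift f a q v : levi (fun q => f (q + a)) q v = levi f (q + a) v.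
Proof. by rewrite /levi !(hess_shift f a). Qed.

Lemma levi_sum (I : Type) (r : seq I) (F : I -> C3 R -> R) q v :
  (forall i, smooth (F i)) ->
  levi (fun q => \sum_(i <- r) F i q) q v = \sum_(i <- r) levi (F i) q v.
Proof. by move=> sF; rewrite /levi !hess_sum// -big_split. Qed.

Lemma levi_re f q v : depends_re f -> levi f q v = levi f (real_pt (re_part q)) v.
Proof.
move=> df; pose a := real_pt (re_part q) - q.
have e : (fun q => f (q + a)) = f.
  apply/funext => z; apply: df; rewrite re_partD.
  by rewrite re_partD re_partN /real_pt re_row_mx subrr addr0.
by rewrite -{1}e (levi_shift f a) /a addrC subrK.
Qed.

Lemma local_lipschitz f (M : R) : smooth f -> exists C, 0 <= C /\
  forall q q', `|q| <= M -> `|q'| <= M -> `|f q - f q'| <= C * `|q - q'|.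
Proof.
move=> sf.
have [C hC] := choice (fun k => ball_bound M (smooth_continuous (smooth_partial1 k sf))).
exists (\sum_k C k); split; first by apply: sumr_ge0 => k _; case: (hC k).
move=> q q' qM q'M.
have [c [/andP[c0 c1]]] := line_MVT q' (q - q') sf; rewrite [q' + (q - _)]addrC subrK => ->.
rewrite /grad (le_trans (ler_norm_sum _ _ _))// mulr_suml ler_sum// => k _.
rewrite normrM mulrC ler_pM// ?coord_le_norm//.
have [_] := hC k; apply.
have -> : q' + c *: (q - q') = c *: q + (1 - c) *: q'.
  by rewrite scalerBr scalerBl scale1r addrCA.
rewrite (le_trans (ler_normD _ _))// !normrZ (ger0_norm c0) ger0_norm ?subr_ge0//.
have -> : M = c * M + (1 - c) * M by ring.
by rewrite lerD// ler_wpM2l// subr_ge0.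
Qed.

Lemma hess_lipschitz f (M : R) : smooth f -> exists C, 0 <= C /\
  forall q q' v, `|q| <= M -> `|q'| <= M -> `|v| <= 1 ->
    `|hess f q v v - hess f q' v v| <= C * `|q - q'|.
Proof.
move=> sf.
have [C hC] := choice (fun jk : 'I_(3 + 3) * 'I_(3 + 3) =>
  local_lipschitz M (smooth_partial1 jk.1 (smooth_partial1 jk.2 sf))).
exists (\sum_j \sum_k C (j, k)); split.
  by apply: sumr_ge0 => j _; apply: sumr_ge0 => k _; case: (hC (j, k)).
move=> q q' v qM q'M v1; rewrite /hess -sumrB mulr_suml (le_trans (ler_norm_sum _ _ _))//.
apply: ler_sum => j _; rewrite -sumrB mulr_suml (le_trans (ler_norm_sum _ _ _))//.
apply: ler_sum => k _; rewrite -mulrBr normrM -[leRHS]mul1r ler_pM//.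
  by rewrite normrM mulr_ile1// (le_trans (coord_le_norm _ _)).
by have [_] := hC (j, k); exact.
Qed.

End Translation.

Section ShiftSum.

(** Translation invariance of a lattice sum, for a finite box large enough to contain the supports
    of both the function and its translate. *)
Lemma sum_shift (R : zmodType) (V : zmodType) (s : seq V) (F : V -> R) (l : V) : uniq s ->
  (forall k, F k != 0 -> k \in s) -> (forall k, F (k + l) != 0 -> k \in s) ->
  \sum_(k <- s) F (k + l) = \sum_(k <- s) F k.
Proof.
move=> us h1 h2.
have dropz (G : V -> R) : \sum_(k <- s) G k = \sum_(k <- [seq k <- s | G k != 0]) G k.
  rewrite big_filter [RHS]big_mkcond/=; apply: eq_bigr => k _.
  by case: eqP.
rewrite dropz [RHS]dropz -(big_map (fun k => k + l) predT F).
apply: perm_big; apply: uniq_perm.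
- by rewrite (map_inj_uniq (addIr l)) filter_uniq.
- exact: filter_uniq.
move=> k; apply/mapP/idP; first case=> i.
  by rewrite !mem_filter => /andP[Fi _] ->; rewrite Fi h1.
rewrite mem_filter => /andP[Fk ks]; exists (k - l); last by rewrite subrK.
by rewrite mem_filter subrK Fk h2// subrK.
Qed.

Definition int_box (n : nat) : seq 'rV[int]_3 :=
  [seq \row_i ((val ((f : {ffun 'I_3 -> 'I_(n.*2.+1)}) i))%:Z - n%:Z) | f <- enum {ffun 'I_3 -> 'I_(n.*2.+1)}].

Lemma int_box_uniq n : uniq (int_box n).
Proof.
rewrite map_inj_uniq ?enum_uniq// => f g /rowP h; apply/ffunP => i; apply: val_inj.
by have := h i; rewrite !mxE => /addIr [].
Qed.

Lemma size_int_box n : size (int_box n) = (n.*2.+1 ^ 3)%N.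
Proof. by rewrite size_map -cardT card_ffun !card_ord. Qed.

Lemma mem_int_box n k : (k \in int_box n) = [forall i, `|k ord0 i| <= n%:Z].
Proof.
apply/mapP/forallP => [[f _ -> i]|h].
  rewrite mxE; rewrite ler_norml; case: (f i) => a a_lt /=; lia.
have h0 i : 0 <= k ord0 i + n%:Z.
  by have := h i; rewrite ler_norml => /andP[+ _]; rewrite -subr_ge0 opprK.
have h' i : (absz (k ord0 i + n%:Z)%R < n.*2.+1)%N.
  have := h i; have := h0 i; rewrite ler_norml; lia.
exists [ffun i => Ordinal (h' i)]; first by rewrite mem_enum.
by apply/rowP => i; rewrite mxE ffunE /= gez0_abs ?addrK.
Qed.

End ShiftSum.

(** * A discrete mollifier *)

Section Mollifier.
Context {R : realType}.
Implicit Types (x y z : 'rV[R]_3) (q v : C3 R) (k l : 'rV[int]_3).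
Local Notation mu := (@lebesgue_measure R).

Variables (f : 'rV[R]_3 -> R) (p : 'rV[R]_3) (A B e : R).
Hypothesis A0 : 0 <= A.
Hypothesis e0 : 0 < e.
Hypothesis e1 : e <= 1.
Hypothesis fA : forall x y, `|f x - f y| <= A * `|x - y|.
Hypothesis pB : `|p| <= B.
(** The margin 1 in the radius covers the kernel width [e <= 1]: nodes that matter for a point of
    norm at most [B] have norm at most [B + 1]. *)
Hypothesis submean : forall z (v1 v2 : 'rV[R]_3), isothermal v1 v2 -> `|z| <= B + 1 ->
  `|v1| <= 1 -> `|v2| <= 1 ->
  2 * pi * f z <= \int[mu]_(t in circle_dom) f (z + cos t *: v1 + sin t *: v2).

(** The kernel is left unnormalised; its weight is controlled from below by [mass_lb]. *)
Definition kappa x : R := flat 1 (e ^+ 2 - dotv x x).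
Definition kappaC q : R := flat 1 (e ^+ 2 - sqre q).

Lemma kappaCE q : kappaC q = kappa (re_part q).
Proof. by rewrite /kappaC sqreE. Qed.

Lemma smooth_kappaC : smooth kappaC.
Proof. by apply: smooth_flat; exact: (smoothB (smooth_cst _) (@smooth_sqre R)). Qed.

Lemma kappa_ge0 x : 0 <= kappa x.
Proof. exact: flat1_ge0. Qed.

Lemma kappa_le1 x : kappa x <= 1.
Proof.
rewrite /kappa /flat; case: ifP => // h; rewrite hornerC mul1r -expR0 ler_expR.
by rewrite oppr_le0 invr_ge0 ltW.
Qed.

Lemma kappa_supp x : kappa x != 0 -> `|x| <= e.
Proof.
move=> kx; apply: norm_le_dotv; first exact: ltW.
rewrite -subr_ge0 leNgt; apply: contra kx => h; rewrite /kappa flat_le0//.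
exact: ltW.
Qed.

Definition node (h : R) k : 'rV[R]_3 := p + h *: map_mx intr k.

Lemma nodeD h k l : node h (k + l) = node h k + h *: map_mx intr l.
Proof. by rewrite /node map_mxD scalerDr addrA. Qed.

(* A Riemann sum over the lattice [p + h Z^3] replaces the convolution of [f]
   with the kernel. *)
Definition mollify (h : R) (s : seq 'rV[int]_3) q : R :=
  \sum_(k <- s) (f (node h k) / (size s)%:R) * kappaC (q + - real_pt (node h k)).

Lemma smooth_mollify h s : smooth (mollify h s).
Proof.
apply: smooth_sum => k _; apply: smoothZ; apply: smooth_shift; exact: smooth_kappaC.
Qed.

Lemma re_real_pt x : re_part (real_pt x) = x.
Proof. exact: re_row_mx. Qed.

Lemma mollifyE h s q : mollify h s q =
  \sum_(k <- s) (f (node h k) / (size s)%:R) * kappa (re_part q - node h k).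
Proof. by apply: eq_bigr => k _; rewrite kappaCE re_partD re_partN re_real_pt. Qed.

Lemma mollify_re h s : depends_re (mollify h s).
Proof. by move=> q q' qq; rewrite !mollifyE qq. Qed.

Lemma mollify_le0 h s q : (forall z, `|re_part q - z| <= e -> f z <= 0) -> mollify h s q <= 0.
Proof.
move=> hf; rewrite mollifyE; apply: sumr_le0 => k _.
have [->|/kappa_supp ke] := eqVneq (kappa (re_part q - node h k)) 0; first by rewrite mulr0.
by rewrite mulr_le0_ge0 ?kappa_ge0// mulr_le0_ge0 ?hf// invr_ge0.
Qed.

Lemma levi_mollify h s q v : levi (mollify h s) q v =
  \sum_(k <- s) (f (node h k) / (size s)%:R) * levi kappaC (q - real_pt (node h k)) v.
Proof.
have sk k := smooth_shift (- real_pt (node h k)) smooth_kappaC.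
rewrite levi_sum; last by move=> k; apply: smoothZ; exact: sk.
by apply: eq_bigr => k _; rewrite (leviZ _ _ _ (sk k)) (levi_shift kappaC).
Qed.


(** Dividing by the number of nodes turns the lattice sums into averages, so their bounds do not
    depend on the mesh. *)
Lemma avg_le (s : seq 'rV[int]_3) (c : 'rV[int]_3 -> R) (C : R) : 0 <= C ->
  (forall k, k \in s -> `|c k| <= C) -> `|\sum_(k <- s) c k / (size s)%:R| <= C.
Proof.
move=> C0 hc; rewrite -mulr_suml normrM normfV (ger0_norm (ler0n _ _)).
have [->|s0] := eqVneq (size s) 0%N; first by rewrite invr0 mulr0.
rewrite ler_pdivrMr ?ltr0n ?lt0n// (le_trans (ler_norm_sum _ _ _))//.
apply: (@le_trans _ _ (\sum_(k <- s) C)).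
  by rewrite big_seq [leRHS]big_seq; apply: ler_sum.
by rewrite big_const_seq count_predT iter_addr addr0 mulr_natr.
Qed.

Variable L : nat.
(** The box has radius [mesh m * (L * m) = e * L / 2] about [p]. A node within [e <= 1] of a point
    of norm at most [B + 2] lies within [1 + (B + 2) + B] of [p], hence in the box. *)
Hypothesis hL : 2 * B + 3 <= e * L%:R / 2.
Definition mesh (m : nat) : R := e / (2 * m%:R).
Definition mesh_box (m : nat) := int_box (L * m).

Lemma mesh_gt0 m : (0 < m)%N -> 0 < mesh m.
Proof. by move=> m0; rewrite divr_gt0// mulr_gt0// ltr0n. Qed.

Lemma B_ge0 : 0 <= B.
Proof. exact: le_trans pB. Qed.

Lemma L_gt0 : (0 < L)%N.
Proof.
rewrite lt0n; apply/eqP => L0; move: hL; rewrite L0 mulr0 mul0r.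
have := B_ge0; lra.
Qed.

Lemma mesh_n m n : (0 < m)%N -> mesh m * (n * m)%N%:R = e * n%:R / 2.
Proof. by move=> m0; rewrite /mesh natrM; field; rewrite pnatr_eq0 -lt0n. Qed.

Lemma node_norm h k (n : nat) : 0 <= h -> k \in int_box n -> `|node h k - p| <= h * n%:R.
Proof.
move=> h0 /[!mem_int_box]/forallP kn; rewrite /node addrC addKr normrZ ger0_norm//.
rewrite ler_wpM2l//; apply: norm_le_coord => // i; rewrite mxE -intr_norm.
by rewrite -[leRHS]/(n%:Z%:~R) ler_int.
Qed.

Lemma mem_box h k (n : nat) : 0 < h -> `|node h k - p| <= h * n%:R -> k \in int_box n.
Proof.
move=> h0; rewrite /node addrC addKr normrZ gtr0_norm// ler_pM2l// => kn.
rewrite mem_int_box; apply/forallP => i; rewrite -(ler_int R) intr_norm.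
by apply: le_trans kn; have := coord_le_norm (map_mx intr k : 'rV[R]_3) i; rewrite mxE.
Qed.

Definition fmax : R := `|f p| + A * (e * L%:R / 2).

Lemma fmax_ge0 : 0 <= fmax.
Proof. by rewrite addr_ge0// mulr_ge0// !mulr_ge0// ltW. Qed.

Lemma f_node m k : (0 < m)%N -> k \in mesh_box m -> `|f (node (mesh m) k)| <= fmax.
Proof.
move=> m0 ks; rewrite -[f _](subrK (f p)) addrC (le_trans (ler_normD _ _))// lerD2l.
rewrite (le_trans (fA _ _))// ler_wpM2l// -(mesh_n L m0) node_norm// ltW//.
exact: mesh_gt0.
Qed.

(** In maximum norm [e / 2], the Euclidean square is at most [3 e^2 / 4], which leaves [e^2 / 4] in
    the exponent. *)
Lemma kappa_lb x : `|x| <= e / 2 -> flat 1 (e ^+ 2 / 4) <= kappa x.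
Proof.
move=> hx; have e20 : 0 < e ^+ 2 / 4 by rewrite divr_gt0// exprn_gt0.
have le : e ^+ 2 / 4 <= e ^+ 2 - dotv x x.
  by have := dotv_le_norm hx; rewrite expr_div_n (_ : 2 ^+ 2 = 4) => [|]; [lra|ring].
rewrite /kappa /flat e20 (lt_le_trans e20 le) !hornerC !mul1r ler_expR lerN2 lef_pV2//.
by rewrite posrE (lt_le_trans e20 le).
Qed.

(** The nodes of [int_box m] lie within [e / 2] of [p], where [kappa_lb] applies, and they form at
    least the fraction [1 / L^3] of the whole box. The product is independent of [m], so refining
    the mesh keeps the lower bound at [p]. *)
Definition mass_lb : R := flat 1 (e ^+ 2 / 4) / L%:R ^+ 3.

Lemma mass_lb_gt0 : 0 < mass_lb.
Proof.
rewrite divr_gt0// ?exprn_gt0 ?ltr0n ?L_gt0//; apply: flat1_gt0.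
by rewrite divr_gt0// exprn_gt0.
Qed.

Lemma mollify_ge m (a : R) : (0 < m)%N -> 0 <= a -> (forall z, `|p - z| <= e -> a <= f z) ->
  a * mass_lb <= mollify (mesh m) (mesh_box m) (real_pt p).
Proof.
move=> m0 a0 hf; rewrite mollifyE re_real_pt.
set N : R := (size (mesh_box m))%:R.
have h0 := mesh_gt0 m0.
have N0 : 0 < N by rewrite ltr0n size_int_box expn_gt0.
have pos k : 0 <= f (node (mesh m) k) / N * kappa (p - node (mesh m) k).
  have [->|/kappa_supp ke] := eqVneq (kappa (p - node (mesh m) k)) 0; first by rewrite mulr0.
  by rewrite mulr_ge0 ?kappa_ge0// divr_ge0 ?(le_trans a0 (hf _ ke))// ltW.
rewrite (bigID (fun k => k \in int_box m))/=.
rewrite ler_wpDr//; first exact: sumr_ge0.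
have -> : \sum_(k <- mesh_box m | k \in int_box m)
     f (node (mesh m) k) / N * kappa (p - node (mesh m) k) =
   \sum_(k <- int_box m) f (node (mesh m) k) / N * kappa (p - node (mesh m) k).
  rewrite -big_filter; apply: perm_big; apply: uniq_perm.
  - by rewrite filter_uniq// int_box_uniq.
  - exact: int_box_uniq.
  move=> k; rewrite mem_filter andb_idr// !mem_int_box => /forallP hk.
  apply/forallP => i; rewrite (le_trans (hk i))// lez_nat leq_pmull// L_gt0//.
apply: (@le_trans _ _ (\sum_(k <- int_box m) a / N * flat 1 (e ^+ 2 / 4))); last first.
  rewrite big_seq [leRHS]big_seq; apply: ler_sum => k km.
  have nk : `|p - node (mesh m) k| <= e / 2.
    rewrite distrC (le_trans (node_norm (ltW h0) km))//.
    by have := mesh_n 1 m0; rewrite mul1n mulr1 => ->.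
  apply: ler_pM.
  - by rewrite divr_ge0// ltW.
  - exact: flat1_ge0.
  - rewrite ler_pM2r ?invr_gt0//; apply: hf; rewrite (le_trans nk)//.
    by rewrite ler_pdivrMr// ler_peMr ?ler1n// ltW.
  - exact: kappa_lb.
rewrite big_const_seq count_predT iter_addr addr0 -[leRHS]mulr_natr size_int_box.
have -> (b c d : R) : a / b * c * d = a * (c * (d / b)) by ring.
apply: (ler_wpM2l a0); apply: ler_wpM2l; first exact: flat1_ge0.
have L0 : 0 < L%:R :> R by rewrite ltr0n L_gt0.
rewrite ler_pdivlMr// ler_pdivrMl ?exprn_gt0// /N size_int_box.
(* The count reduces to [2 L m + 1 <= L (2 m + 1)], true since [L >= 1]. *)
rewrite -natrX -natrM ler_nat -expnMn leq_exp2r//.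
by have := L_gt0; move: L m0 => l; rewrite -!muln2; nia.
Qed.

(* The translation by [y] acts on [f] instead of the kernel, so that submean
   inequalities pass from [f] to the sum. *)
Definition mollify_tr m x0 y : R :=
  \sum_(k <- mesh_box m) (f (node (mesh m) k + y) * kappa (x0 - node (mesh m) k)) /
     (size (mesh_box m))%:R.

Lemma mollify_tr0 m x0 : mollify_tr m x0 0 = mollify (mesh m) (mesh_box m) (real_pt x0).
Proof.
rewrite mollifyE re_real_pt; apply: eq_bigr => k _; rewrite addr0.
exact: mulrAC.
Qed.

(* Translations by lattice vectors only permute the nodes. *)
Lemma mollify_shift m x0 (l : 'rV[int]_3) : (0 < m)%N -> `|x0| <= B ->
  `|mesh m *: map_mx intr l : 'rV[R]_3| <= 2 ->
  mollify (mesh m) (mesh_box m) (real_pt (x0 + mesh m *: map_mx intr l)) =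
  mollify_tr m x0 (mesh m *: map_mx intr l).
Proof.
move=> m0 x0B hl; have h0 := mesh_gt0 m0.
rewrite mollifyE re_real_pt /mollify_tr.
set w := mesh m *: map_mx intr l in hl *.
pose F k := f (node (mesh m) k) / (size (mesh_box m))%:R * kappa (x0 + w - node (mesh m) k).
have FE k : F (k + l) = f (node (mesh m) k + w) * kappa (x0 - node (mesh m) k) / (size (mesh_box m))%:R.
  by rewrite /F nodeD -/w mulrAC opprD addrACA subrr addr0.
under [RHS]eq_bigr do rewrite -FE.
rewrite sum_shift ?int_box_uniq//.
- move=> k; rewrite mulf_eq0 negb_or => /andP[_ /kappa_supp h].
  apply: (mem_box h0); rewrite mesh_n//; apply: le_trans hL.
  have -> : node (mesh m) k - p = - (x0 + w - node (mesh m) k) + (x0 + w) + - p.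
    by rewrite opprB subrK.
  rewrite (le_trans (ler_normD _ _))// normrN (le_trans (lerD (ler_normD _ _) (lexx _)))//.
  rewrite normrN; have := ler_normD x0 w; have := pB; have := e1; lra.
- move=> k; rewrite FE mulf_eq0 negb_or => /andP[]; rewrite mulf_eq0 negb_or => /andP[_ /kappa_supp h _].
  apply: (mem_box h0); rewrite mesh_n//; apply: le_trans hL.
  have -> : node (mesh m) k - p = - (x0 - node (mesh m) k) + x0 + - p.
    by rewrite opprB subrK.
  rewrite (le_trans (ler_normD _ _))// normrN (le_trans (lerD (ler_normD _ _) (lexx _)))//.
  rewrite normrN; have := pB; have := e1; lra.
Qed.


Lemma real_pt_norm x : `|real_pt x| <= `|x|.
Proof.
have -> : real_pt x = row_mx x 0 - row_mx 0 0 by rewrite /real_pt row_mx0 subr0.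
by rewrite (le_trans (row_mx_norm0 _ _ _))// subr0.
Qed.

Lemma real_ptD x y : real_pt (x + y) = real_pt x + real_pt y.
Proof. by rewrite /real_pt add_row_mx addr0. Qed.

Lemma real_ptN x : real_pt (- x) = - real_pt x.
Proof. by rewrite /real_pt opp_row_mx oppr0. Qed.

(** Round [y] down to a lattice vector [w] with [|y - w| <= mesh m]. At [w] the two sums agree by
    [mollify_shift]; moving from [y] to [w] costs [fmax * C] through the kernel in the first sum and
    [A] through [f] in the second, each times the mesh. *)
Lemma mollify_approx : exists E, 0 <= E /\ forall m x0 y, (0 < m)%N ->
  `|x0| <= B -> `|y| <= 1 ->
  `|mollify (mesh m) (mesh_box m) (real_pt (x0 + y)) - mollify_tr m x0 y| <= E * mesh m.
Proof.
have [C [C0 hC]] := local_lipschitz (2 * B + 3 + e * L%:R / 2) smooth_kappaC.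
exists (fmax * C + A); split; first by rewrite addr_ge0// mulr_ge0// fmax_ge0.
move=> m x0 y m0 x0B y1; have h0 := mesh_gt0 m0.
have h1 : mesh m <= 1.
  rewrite /mesh ler_pdivrMr ?mulr_gt0 ?ltr0n// mul1r (le_trans e1)//.
  by rewrite -natrM ler1n muln_gt0.
pose l : 'rV[int]_3 := \row_i Num.floor (y ord0 i / mesh m).
pose w : 'rV[R]_3 := mesh m *: map_mx intr l.
have yw : `|y - w| <= mesh m.
  apply: norm_le_coord => [|i]; first exact: ltW.
  rewrite !mxE.
  have /andP[l1 l2] := floor_itv (y ord0 i / mesh m).
  have e' : y ord0 i = mesh m * (y ord0 i / mesh m) by rewrite mulrC divfK// gt_eqF.
  rewrite {1}e' -mulrBr normrM gtr0_norm// ler_piMr ?(ltW h0)//.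
  rewrite ger0_norm ?subr_ge0// lerBlDr; move: l2; rewrite intrD => /ltW; rewrite addrC.
  exact.
have w2 : `|w| <= 2.
  have -> : w = y - (y - w) by rewrite opprB addrC subrK.
  by rewrite (le_trans (ler_normB _ _))// (le_trans (lerD y1 (le_trans yw h1)))// -natrD.
rewrite -[_ - _](subrKA (mollify (mesh m) (mesh_box m) (real_pt (x0 + w)))).
rewrite (le_trans (ler_normD _ _))// mulrDl lerD//.
  rewrite !mollifyE -sumrB !re_real_pt.
  under eq_bigr do rewrite -mulrBr mulrAC.
  apply: avg_le; first by rewrite !mulr_ge0 ?fmax_ge0// ltW.
  move=> k ks; rewrite normrM -mulrA ler_pM ?f_node//.
  rewrite -(re_real_pt (x0 + y - _)) -(re_real_pt (x0 + w - _)) -!kappaCE.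
  have nk : `|node (mesh m) k| <= B + e * L%:R / 2.
    rewrite -[node _ _](subrK p) addrC (le_trans (ler_normD _ _))// lerD//.
    by rewrite (le_trans (node_norm (ltW h0) ks))// mesh_n.
  have b x : `|x| <= 2 -> `|real_pt (x0 + x - node (mesh m) k)| <= 2 * B + 3 + e * L%:R / 2.
    move=> x2; rewrite (le_trans (real_pt_norm _))// (le_trans (ler_normB _ _))//.
    have := ler_normD x0 x; move: nk x2 x0B.
    by move: (`|node _ _|) (`|x0 + x|) (`|x0|) (`|x|) => *; lra.
  have y2 : `|y| <= 2 by rewrite (le_trans y1)// ler1n.
  rewrite (le_trans (hC _ _ (b _ y2) (b _ w2)))// ler_wpM2l//.
  rewrite -real_ptN -real_ptD (le_trans (real_pt_norm _))//.
  suff -> : x0 + y - node (mesh m) k - (x0 + w - node (mesh m) k) = y - w by [].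
  by rewrite opprB addrA subrK opprD addrACA subrr add0r.
rewrite (mollify_shift m0 x0B w2) -sumrB.
under eq_bigr do rewrite -mulrBl -mulrBl.
apply: avg_le; first by rewrite mulr_ge0// ltW.
move=> k ks; rewrite normrM -[leRHS]mulr1 ler_pM//.
  rewrite (le_trans (fA _ _))// ler_wpM2l// opprD addrACA subrr add0r distrC//.
by rewrite ger0_norm ?kappa_ge0 ?kappa_le1.
Qed.

(** The constant is uniform in [m]: the Levi form is an average of translates of that of [kappaC],
    with weights at most [fmax]. *)
Lemma levi_lipschitz : exists D, 0 <= D /\ forall m q q' v, (0 < m)%N ->
  `|q| <= B + 2 -> `|q'| <= B + 2 -> `|v| <= 1 -> `|Jmap v| <= 1 ->
  `|levi (mollify (mesh m) (mesh_box m)) q v - levi (mollify (mesh m) (mesh_box m)) q' v|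
     <= D * `|q - q'|.
Proof.
have [C [C0 hC]] := hess_lipschitz (2 * B + 3 + e * L%:R / 2) smooth_kappaC.
exists (fmax * (C + C)); split; first by rewrite mulr_ge0 ?fmax_ge0// addr_ge0.
move=> m q q' v m0 qB q'B v1 Jv1; have h0 := mesh_gt0 m0.
rewrite !levi_mollify -sumrB.
under eq_bigr do rewrite -mulrBr mulrAC.
apply: avg_le; first by rewrite !mulr_ge0 ?fmax_ge0// addr_ge0.
move=> k ks; rewrite normrM -mulrA ler_pM ?f_node//.
have nk : `|real_pt (node (mesh m) k)| <= B + e * L%:R / 2.
  rewrite (le_trans (real_pt_norm _))//.
  rewrite -[node _ _](subrK p) addrC (le_trans (ler_normD _ _))// lerD//.
  by rewrite (le_trans (node_norm (ltW h0) ks))// mesh_n.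
have b q0 : `|q0| <= B + 2 -> `|q0 - real_pt (node (mesh m) k)| <= 2 * B + 3 + e * L%:R / 2.
  move=> qb; rewrite (le_trans (ler_normB _ _))//; lra.
have eq2 : q - q' = (q - real_pt (node (mesh m) k)) - (q' - real_pt (node (mesh m) k)).
  by rewrite opprB addrA subrK.
rewrite /levi opprD addrACA (le_trans (ler_normD _ _))// mulrDl lerD// eq2; apply: hC => //; exact: b.
Qed.


Lemma sum_submean (s : seq 'rV[int]_3) (c : 'rV[int]_3 -> R -> R) (a : 'rV[int]_3 -> R) :
  (forall k, continuous (c k)) ->
  (forall k, 2 * pi * a k <= \int[mu]_(t in circle_dom) c k t) ->
  2 * pi * (\sum_(k <- s) a k) <= \int[mu]_(t in circle_dom) (\sum_(k <- s) c k t).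
Proof.
move=> cc ha; elim: s => [|k s IH].
  by rewrite big_nil mulr0; apply: Rintegral_ge0 => t _; rewrite big_nil.
rewrite big_cons mulrDr.
under eq_Rintegral do rewrite big_cons.
rewrite RintegralD.
- by rewrite lerD.
- exact: circle_dom_measurable.
- exact: circle_integrable.
- by apply: circle_integrable; exact: cont_sum.
Qed.

Lemma f_continuous : continuous f.
Proof. exact: lipschitz_cont fA. Qed.

(** The inequality is linear in [f] and the kernel weights are nonnegative constants, so it holds
    term by term. Nodes with a nonzero weight are within [e] of [x0], where [submean] is
    available. *)
Lemma mollify_tr_submean m x0 (v1 v2 : 'rV[R]_3) : isothermal v1 v2 -> (0 < m)%N ->
  `|x0| <= B -> `|v1| <= 1 -> `|v2| <= 1 ->
  2 * pi * mollify_tr m x0 0 <=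
    \int[mu]_(t in circle_dom) mollify_tr m x0 (cos t *: v1 + sin t *: v2).
Proof.
move=> iso m0 x0B v11 v21.
have cy k : continuous (fun t : R => f (node (mesh m) k + (cos t *: v1 + sin t *: v2))).
  move=> t; apply: (@continuous_comp _ _ _ (fun t : R => node (mesh m) k + (cos t *: v1 + sin t *: v2)) f).
    apply: cvgD; first exact: cvg_cst.
    by apply: cvgD; apply: cvgZr_tmp; [exact: continuous_cos|exact: continuous_sin].
  exact: f_continuous.
apply: sum_submean => k.
  move=> t; apply: cvgM; last exact: cvg_cst.
  by apply: cvgM; [exact: cy|exact: cvg_cst].
under eq_Rintegral do rewrite -mulrA.
rewrite RintegralZr; last 2 first.
  exact: circle_dom_measurable.
  exact: circle_integrable.
rewrite addr0 -!mulrA mulrA [leLHS]mulrA.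
have [->|/kappa_supp ke] := eqVneq (kappa (x0 - node (mesh m) k)) 0.
  by rewrite !mul0r !mulr0.
rewrite ler_wpM2r//; first by rewrite divr_ge0 ?kappa_ge0.
under eq_Rintegral do rewrite addrA.
apply: submean => //.
rewrite -(subrK x0 (node _ _)) addrC (le_trans (ler_normD _ _))// lerD// distrC.
exact: le_trans ke e1.
Qed.

Lemma sq_norm_le1 q : sqre q = 1 -> sqim q = 1 -> `|q| <= 1.
Proof.
move=> r1 i1; apply: norm_le_coord => // k.
rewrite -(@expr_le1 _ 2)// real_normK ?num_real//.
rewrite -[k]splitK /unsplit; case: (fintype.split k) => j.
  by rewrite lshift_re -r1 sqreE coord_sq_le_dotv.
by rewrite rshift_im -i1 sqimE coord_sq_le_dotv.
Qed.

Lemma null_isothermal q (r : R) : 0 < r -> null_vector q ->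
  isothermal (r *: re_part q) (r *: - im_part q).
Proof.
move=> r0 /null_vectorP[q0 ee d].
have dZ (a b : 'rV[R]_3) c : dotv (r *: a) (r *: (c *: b)) = (r ^+ 2 * c) * dotv a b.
  by rewrite /dotv mulr_sumr; apply: eq_bigr => j _; rewrite !mxE; ring.
have dd (a : 'rV[R]_3) : dotv (r *: a) (r *: a) = r ^+ 2 * dotv a a.
  by rewrite /dotv mulr_sumr; apply: eq_bigr => j _; rewrite !mxE; ring.
have dN (a : 'rV[R]_3) : dotv (- a) (- a) = dotv a a.
  by apply: eq_bigr => j _; rewrite !mxE mulrNN.
split.
- by rewrite -scaleN1r dZ d mulr0.
- by rewrite /enorm !dd dN -sqreE -sqimE ee.
- rewrite /enorm dd -sqreE sqrtr_eq0 -ltNge mulr_gt0 ?exprn_gt0// lt0r re2_ge0 andbT.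
  apply: contra q0 => /eqP q0; have := enorm2 q; rewrite -ee q0 addr0 => /eqP.
  rewrite expf_eq0 /= /enorm sqrtr_eq0 => h.
  apply/eqP/rowP => k; rewrite mxE; apply/eqP.
  have : \sum_i q ord0 i * q ord0 i == 0.
    by rewrite eq_le h/= sumr_ge0// => i _; rewrite -expr2 sqr_ge0.
  rewrite psumr_eq0; last by move=> i _; rewrite -expr2 sqr_ge0.
  by move=> /allP/(_ k (mem_index_enum k)); rewrite mulf_eq0 orbb.
Qed.

Lemma sqre_circ q v w r t : sqre (circ q v w r t - q) =
  r ^+ 2 * (cos t ^+ 2 * sqre v + sin t ^+ 2 * sqre w + 2 * (cos t * sin t) * dotv (re_part v) (re_part w)).
Proof.
rewrite !sqreE /dotv !mulr_sumr -!big_split/= mulr_sumr; apply: eq_bigr => j _.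
rewrite /circ !mxE; ring.
Qed.

(** Suppose the Levi form of [G] at [q0] is below [- 2 eta]. By [levi_lipschitz] it stays below
    [- eta] near the circles of radius at most [r], so [u = - G - (eta / 4) |x - x0|^2] has
    nonnegative Levi form there and the circle mean of [G] is at most [G q0 - c]. The translated
    sums force this mean to be at least [G q0 - E * mesh m], a contradiction once the mesh is
    small. *)
Lemma levi_mollify_unit (eta : R) : 0 < eta -> exists m0, (0 < m0)%N /\ forall q v,
  `|re_part q| <= B -> null_vector v -> sqre v = 1 -> sqim v = 1 ->
  - (2 * eta) <= levi (mollify (mesh m0) (mesh_box m0)) q v.
Proof.
move=> eta0.
have [E [E0 hE]] := mollify_approx.
have [D [D0 hD]] := levi_lipschitz.
(* Points of the circles are within [2 * r] of the centre, so [D * (2 * r) <= eta] limits the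
   variation of the Levi form to [eta]. *)
pose r := Num.min (1 / 2) (eta / (2 * D + 1)).
have D1 : 0 < 2 * D + 1 by rewrite ltr_wpDl// mulr_ge0.
have r0 : 0 < r by rewrite lt_min !divr_gt0.
have r12 : 2 * r <= 1 by rewrite mulrC -ler_pdivlMr// ge_min lexx.
have r1 : r <= 1 by lra.
have rD : D * (2 * r) <= eta.
  rewrite (@le_trans _ _ (r * (2 * D + 1)))//; first by rewrite mulrDr; lra.
  by rewrite -ler_pdivlMr// ge_min lexx orbT.
pose c := eta / 4 * r ^+ 2.
have c0 : 0 < c by rewrite mulr_gt0 ?exprn_gt0// divr_gt0.
(* This [m] gives [E * mesh m = E * e / (2 * m) < c]. *)
pose m := (Num.bound (E * e / (2 * c))).+1.
exists m; split => // q v qB nv v1 v2.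
rewrite (levi_re _ _ (@mollify_re _ _)).
set x0 := re_part q in qB *; set G := mollify _ _; pose q0 := real_pt x0.
rewrite leNgt; apply/negP => lG.
have n1 : `|v| <= 1 by exact: sq_norm_le1.
have n2 : `|Jmap v| <= 1 by apply: sq_norm_le1; rewrite ?sqre_Jmap ?sqim_Jmap.
have sG : smooth G by exact: smooth_mollify.
have q0B : `|q0| <= B by rewrite (le_trans (real_pt_norm _)).
have circ_near s t : 0 <= s <= r -> `|circ q0 v (Jmap v) s t - q0| <= 2 * r.
  move=> /andP[s0 sr].
  have short (a b : R) : `|a| <= 1 -> 0 <= b <= 1 -> s * `|a| * b <= r.
    move=> a1 /andP[b0 b1]; rewrite -[leRHS]mulr1 ler_pM ?mulr_ge0//.
    by rewrite -[leRHS]mulr1 ler_pM.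
  have -> : circ q0 v (Jmap v) s t - q0 = (s * cos t) *: v + (s * sin t) *: Jmap v.
    by rewrite /circ -(addrA q0) [LHS]addrC addKr.
  rewrite (le_trans (ler_normD _ _))// mulrDl mul1r lerD// normrZ normrM ger0_norm//.
    by apply: short; rewrite ?normr_ge0 ?n1 ?n2// ler_norml cos_geN1 cos_le1.
  by apply: short; rewrite ?normr_ge0 ?n1 ?n2// ler_norml sin_geN1 sin_le1.
(* On a vector with both parts of length 1 the Levi form of [sqre] is 4, so the correction uses up
   exactly [eta]; on the circle of radius [r] it equals [c]. *)
pose u (z : C3 R) := - G z + (- (eta / 4)) * sqre (z + - q0).
have sq : smooth (fun z : C3 R => sqre (z + - q0)) by apply: smooth_shift; exact: smooth_sqre.
have su : smooth u by exact: (smoothD (smoothN sG) (smoothZ _ sq)).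
have lu s t : 0 <= s <= r -> 0 <= levi u (circ q0 v (Jmap v) s t) v.
  move=> hs; rewrite /u (leviD _ _ (smoothN sG) (smoothZ _ sq)) (leviZ _ _ _ sq).
  rewrite (levi_shift (@sqre R)) levi_sqre v1 v2.
  have -> : levi (fun z : C3 R => - G z) (circ q0 v (Jmap v) s t) v = - levi G (circ q0 v (Jmap v) s t) v.
    have -> : (fun z : C3 R => - G z) = (fun z : C3 R => (-1) * G z) by apply/funext => z; rewrite mulN1r.
    by rewrite leviZ// mulN1r.
  have cn := circ_near s t hs.
  have cB : `|circ q0 v (Jmap v) s t| <= B + 2.
    rewrite -(subrK q0 (circ _ _ _ _ _)) addrC (le_trans (ler_normD _ _))// lerD//.
    by rewrite (le_trans cn)// -[leRHS]mulr1 ler_wpM2l.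
  have q0B2 : `|q0| <= B + 2 by rewrite (le_trans q0B)// lerDl.
  have := hD m _ _ _ (ltn0Sn _) cB q0B2 n1 n2.
  have := ler_wpM2l D0 cn; rewrite ler_norml -/G.
  move: rD lG; rewrite -/q0; move: (levi G q0 v) (levi G _ v) (`|_ - q0|) => a b d.
  move=> *; lra.
have := subharmonic_mean su (ltW r0) lu.
rewrite {1}/u subrr {1}/sqre; under eq_bigr do rewrite mxE mul0r.
rewrite big1// mulr0 addr0.
have cG : continuous (fun t => G (circ q0 v (Jmap v) r t)).
  by apply: comp_circ_continuous; exact: smooth_continuous.
have uE t : u (circ q0 v (Jmap v) r t) = (- 1) * G (circ q0 v (Jmap v) r t) + (- c).
  rewrite /u sqre_circ sqre_Jmap v1 v2 re_Jmap.
  have -> : dotv (re_part v) (- im_part v) = 0.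
    have /null_vectorP[_ _ d] := nv.
    have dN (a b : 'rV[R]_3) : dotv a (- b) = - dotv a b.
      by rewrite /dotv -sumrN; apply: eq_bigr => j _; rewrite !mxE mulrN.
    by rewrite dN d oppr0.
  by rewrite mulr0 addr0 !mulr1 cos2Dsin2 mulr1 mulN1r mulNr.
under eq_Rintegral do rewrite uE.
have mD := @circle_dom_measurable R.
rewrite RintegralD//; last 2 first.
  by apply: circle_integrable; apply: contZ.
  by apply: circle_integrable; exact: cst_continuous.
rewrite circle_integral_cst RintegralZl//; last exact: circle_integrable.
(* The opposite estimate: [mollify_tr] is exactly submean, agrees with [G] at the centre and differs
   from it by at most [E * mesh m] on the circle. *)
have : 2 * pi * G q0 - 2 * pi * (E * mesh m) <= \int[mu]_(t in circle_dom) G (circ q0 v (Jmap v) r t).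
  pose y t := cos t *: (r *: re_part v) + sin t *: (r *: - im_part v).
  have reE t : re_part (circ q0 v (Jmap v) r t) = x0 + y t.
    rewrite /circ !re_partD !re_partZ re_Jmap re_real_pt /y !scalerA -addrA.
    by rewrite ![_ * r]mulrC.
  have cH : continuous (fun t => mollify_tr m x0 (y t)).
    apply: cont_sum => k; apply: contM; last exact: cst_continuous.
    apply: contM; last exact: cst_continuous.
    move=> t; apply: (@continuous_comp _ _ _ (fun t : R => node (mesh m) k + y t) f).
      apply: cvgD; first exact: cvg_cst.
      by apply: cvgD; apply: cvgZr_tmp; [exact: continuous_cos|exact: continuous_sin].
    exact: f_continuous.
  have nr (w : 'rV[R]_3) : `|w| <= 1 -> `|r *: w| <= r.
    by move=> w1; rewrite normrZ gtr0_norm// ler_piMr// ltW.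
  have vr1 : `|re_part v| <= 1.
    by apply: norm_le_coord => // j; rewrite -lshift_re (le_trans (coord_le_norm _ _)).
  have vi1 : `|- im_part v| <= 1.
    by rewrite normrN; apply: norm_le_coord => // j; rewrite -rshift_im (le_trans (coord_le_norm _ _)).
  have := @mollify_tr_submean m x0 _ _ (null_isothermal r0 nv) (ltn0Sn _) qB
    (le_trans (nr _ vr1) r1) (le_trans (nr _ vi1) r1).
  rewrite mollify_tr0 -/G -/q0 => h.
  apply: (@le_trans _ _ (\int[mu]_(t in circle_dom) (mollify_tr m x0 (y t) + - (E * mesh m)))).
    rewrite RintegralD//; last 2 first.
      exact: circle_integrable.
      by apply: circle_integrable; exact: cst_continuous.
    by rewrite circle_integral_cst mulrN lerD2r.
  apply: le_Rintegral => //.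
  - by apply: circle_integrable; apply: contD => //; exact: cst_continuous.
  - exact: circle_integrable.
  move=> t _.
  have -> : G (circ q0 v (Jmap v) r t) = G (real_pt (x0 + y t)).
    by apply: mollify_re; rewrite re_real_pt reE.
  have yt1 : `|y t| <= 1.
    have -> : y t = re_part (circ q0 v (Jmap v) r t - q0).
      by rewrite re_partD re_partN reE re_real_pt addrC addKr.
    apply: norm_le_coord => // j; rewrite -lshift_re (le_trans (coord_le_norm _ _))//.
    by rewrite (le_trans (circ_near r t _))// lexx ltW.
  by have := hE m x0 (y t) (ltn0Sn _) qB yt1; rewrite ler_norml -/G => /andP[+ _]; lra.
have mc : E * mesh m < c.
  rewrite /mesh mulrA ltr_pdivrMr ?mulr_gt0 ?ltr0n//.
  have x0' : 0 <= E * e / (2 * c) by rewrite divr_ge0 ?mulr_ge0// ltW.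
  have := archi_boundP x0'; rewrite ltr_pdivrMr ?mulr_gt0// => h.
  rewrite (lt_le_trans h)// mulrA [leRHS]mulrC ler_wpM2r ?mulr_ge0 ?ltW//.
  by rewrite mulrC ltr_pM2l// ltr_nat ltnSn.
have := @two_pi_gt0 R; move: mc.
move: (\int[mu]_(t in circle_dom) _) (G q0) (2 * pi) (E * mesh m) => I g tp em mc tp0 h1 h2.
have : tp * em < tp * c by rewrite ltr_pM2l.
move: h1 h2; rewrite !mulrN !mulN1r; lra.
Qed.

(** Both sides are homogeneous of degree 2 in [v], and a null vector has real and imaginary parts of
    equal length [s]; dividing by [s] reduces to the unit case. *)
Lemma levi_mollify_ge (eta : R) : 0 < eta -> exists m0, (0 < m0)%N /\ forall q v,
  `|re_part q| <= B -> null_vector v ->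
  - (eta * (sqre v + sqim v)) <= levi (mollify (mesh m0) (mesh_box m0)) q v.
Proof.
move=> eta0; have [m0 [m00 h]] := levi_mollify_unit eta0.
exists m0; split => // q v qB nv; have /null_vectorP[v0 vv d] := nv.
pose s := Num.sqrt (sqre v).
have s0 : 0 < s.
  have [_ _] := null_isothermal ltr01 nv; rewrite scale1r /enorm -sqreE => n.
  by rewrite lt0r n sqrtr_ge0.
have s2 : s ^+ 2 = sqre v by rewrite sqr_sqrtr ?re2_ge0.
pose w := s^-1 *: v.
have vw : v = s *: w by rewrite scalerA divff ?scale1r// gt_eqF.
have sqZ (a : R) (x : C3 R) : sqre (a *: x) = a ^+ 2 * sqre x.
  by rewrite /sqre mulr_sumr; apply: eq_bigr => j _; rewrite !mxE; ring.
have siZ (a : R) (x : C3 R) : sqim (a *: x) = a ^+ 2 * sqim x.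
  by rewrite /sqim mulr_sumr; apply: eq_bigr => j _; rewrite !mxE; ring.
have hZ (a : R) (x : C3 R) (g : C3 R -> R) (z : C3 R) : hess g z (a *: x) (a *: x) = a ^+ 2 * hess g z x x.
  rewrite /hess mulr_sumr; apply: eq_bigr => j _; rewrite mulr_sumr; apply: eq_bigr => k _.
  by rewrite !mxE; ring.
have JZ (a : R) (x : C3 R) : Jmap (a *: x) = a *: Jmap x by exact: (linearZ_LR (@Jmap R)).
have w1 : sqre w = 1 by rewrite sqZ exprVn s2 mulVf// -s2 expf_neq0// gt_eqF.
have w2 : sqim w = 1 by rewrite siZ exprVn -vv s2 mulVf// -s2 expf_neq0// gt_eqF.
have nw : null_vector w.
  apply/null_vectorP; split; last first.
  - have -> : im_part w = s^-1 *: im_part v by apply/rowP => j; rewrite !mxE.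
    rewrite re_partZ.
    transitivity (s^-1 ^+ 2 * dotv (re_part v) (im_part v)); last by rewrite d mulr0.
    by rewrite /dotv mulr_sumr; apply: eq_bigr => j _; rewrite !mxE; ring.
  - by rewrite w1 w2.
  - by rewrite scaler_eq0 invr_eq0 gt_eqF//=.
have := h q w qB nw w1 w2.
clearbody w.
have lZ (a : R) (x : C3 R) (g : C3 R -> R) (z : C3 R) : levi g z (a *: x) = a ^+ 2 * levi g z x.
  by rewrite /levi JZ !hZ mulrDr.
rewrite [in X in _ -> _ <= X]vw [in X in _ -> X <= _]vw lZ sqZ siZ w1 w2 => hw.
have -> : - (eta * (s ^+ 2 * 1 + s ^+ 2 * 1)) = s ^+ 2 * (- (2 * eta)) by ring.
by rewrite ler_wpM2l// sqr_ge0.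
Qed.

End Mollifier.

(** * Sup-convolution *)

(* The integral of a nonnegative function is a supremum over simple functions,
   hence monotone even for non-measurable functions. *)
Lemma le_integral_any d (T : measurableType d) (R : realType) (mu : {measure set T -> \bar R})
    (D : set T) (f g : T -> \bar R) : (forall x, D x -> (f x <= g x)%E) ->
  (\int[mu]_(x in D) f x <= \int[mu]_(x in D) g x)%E.
Proof.
have ge0 (f' g' : T -> \bar R) : (forall x, 0 <= f' x)%E -> (forall x, 0 <= g' x)%E ->
    (forall x, D x -> (f' x <= g' x)%E) ->
    (\int[mu]_(x in D) f' x <= \int[mu]_(x in D) g' x)%E.
  move=> f0 g0 fg; rewrite !ge0_integralE//.
  apply: ereal_sup_le => _ [h /= hf <-]; exists h => // x.
  rewrite (le_trans (hf x))// /patch; case: ifPn => [|//].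
  by rewrite inE => /fg.
move=> fg; rewrite integralE [leRHS]integralE.
have fgD : {in D, forall x, (f x <= g x)%E} by move=> x /[!inE]/fg.
apply: leeB; apply: ge0 => // x Dx.
  by apply: (funepos_le fgD); rewrite inE.
by apply: (funeneg_le fgD); rewrite inE.
Qed.

Section SupConvolution.
Context {R : realType}.
Implicit Types (x y z v a b : 'rV[R]_3).
Variables (u : 'rV[R]_3 -> \bar R) (rho m M A : R).
Hypothesis pu : minimal_psh [set: 'rV[R]_3] u.
Hypothesis rho0 : 0 <= rho.
Hypothesis A0 : 0 <= A.
Hypothesis uM : forall z, `|z| <= rho -> (u z <= M%:E)%E.
Hypothesis mM : - m <= M.
Local Notation mu := (@lebesgue_measure R).

Definition truncation z : R := fine (maxe (u z) (- m)%:E).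

Lemma truncationE z : (truncation z)%:E = maxe (u z) (- m)%:E.
Proof.
rewrite /truncation fineK// fin_numE; have [h _ _] := pu.
have := h z I; case: (u z) => [r||]// _.
  by rewrite -EFin_max.
by rewrite max_r ?leNye.
Qed.

Lemma truncation_ge z : - m <= truncation z.
Proof. by rewrite -lee_fin truncationE le_max lexx orbT. Qed.

Lemma le_truncation z : (u z <= (truncation z)%:E)%E.
Proof. by rewrite truncationE le_max lexx. Qed.

Lemma truncation_le z : `|z| <= rho -> truncation z <= M.
Proof. by move=> zr; rewrite -lee_fin truncationE ge_max uM//= lee_fin. Qed.

Lemma truncation_eq z : - m < truncation z -> u z = (truncation z)%:E.
Proof.
by rewrite -lte_fin truncationE lt_max ltxx orbF => /ltW/max_idPl ->.
Qed.

(** The supremum runs over a ball on which [u <= M], so it is finite; truncating at [- m] makes [u]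
    real-valued and gives [- m] as a floor for [sup_conv] on that ball. *)
Definition sup_conv x : R := sup [set truncation z - A * `|x - z| | z in [set z : 'rV[R]_3 | `|z| <= rho]].

Lemma sup_conv_has x : has_sup [set truncation z - A * `|x - z| | z in [set z : 'rV[R]_3 | `|z| <= rho]].
Proof.
split; first by exists (truncation 0 - A * `|x - 0|), 0 => //=; rewrite normr0.
exists M => _ [z zr <-]; rewrite lerBlDr (le_trans (truncation_le zr))// lerDl.
exact: mulr_ge0.
Qed.

Lemma sup_conv_ub x z : `|z| <= rho -> truncation z - A * `|x - z| <= sup_conv x.
Proof. by move=> zr; apply: ub_le_sup; [case: (sup_conv_has x)|exists z]. Qed.

Lemma sup_conv_le x (c : R) : (forall z, `|z| <= rho -> truncation z - A * `|x - z| <= c) ->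
  sup_conv x <= c.
Proof. by move=> h; apply: ge_sup; [case: (sup_conv_has x)|move=> _ [z zr <-]; exact: h]. Qed.

Lemma sup_conv_ge x : `|x| <= rho -> truncation x <= sup_conv x.
Proof. by move=> xr; have := sup_conv_ub x xr; rewrite subrr normr0 mulr0 subr0. Qed.

Lemma sup_conv_lipschitz x y : `|sup_conv x - sup_conv y| <= A * `|x - y|.
Proof.
have half a b : sup_conv a - sup_conv b <= A * `|a - b|.
  rewrite lerBlDl; apply: sup_conv_le => z zr.
  have := sup_conv_ub b zr; have : A * `|b - z| <= A * `|a - b| + A * `|a - z|.
    by rewrite -mulrDr ler_wpM2l// -[b - z](subrKA a) distrC (le_trans (ler_normD _ _))// distrC.
  by move=> *; lra.
by rewrite ler_norml half andbT lerNl opprB distrC half.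
Qed.

Lemma sup_conv_continuous : continuous sup_conv.
Proof. exact: (lipschitz_cont sup_conv_lipschitz). Qed.

(** Translate the circle: if [z] competes at [x], then [z + y] competes at [x + y] at the same
    distance, so the submean inequality of [u] about [z] passes to [sup_conv] about [x]. The bound
    [|x| + 3 <= rho] keeps these competitors in the ball: 1 for [x - z] and 2 for [y]. *)
Lemma sup_conv_submean x (v1 v2 : 'rV[R]_3) : isothermal v1 v2 -> `|v1| <= 1 -> `|v2| <= 1 ->
  `|x| + 3 <= rho -> M - A <= - m ->
  2 * pi * sup_conv x <=
    \int[mu]_(t in circle_dom) sup_conv (x + cos t *: v1 + sin t *: v2).
Proof.
move=> iso v11 v21 xr MA.
pose y t := cos t *: v1 + sin t *: v2.
have y2 t : `|y t| <= 2.
  rewrite (le_trans (ler_normD _ _))// (natrD _ 1 1) lerD// normrZ mulr_ile1//.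
    by rewrite ler_norml cos_geN1 cos_le1.
  by rewrite ler_norml sin_geN1 sin_le1.
have cW : continuous (fun t => sup_conv (x + cos t *: v1 + sin t *: v2)).
  move=> t; apply: (@continuous_comp _ _ _ (fun t : R => x + cos t *: v1 + sin t *: v2) sup_conv).
    apply: cvgD; first apply: cvgD; first exact: cvg_cst.
      by apply: cvgZr_tmp; exact: continuous_cos.
    by apply: cvgZr_tmp; exact: continuous_sin.
  exact: sup_conv_continuous.
have tp := @two_pi_gt0 R.
rewrite mulrC -ler_pdivlMr//; apply: sup_conv_le => z zr.
rewrite ler_pdivlMr// mulrC.
have xyr t : `|x + cos t *: v1 + sin t *: v2| <= rho.
  rewrite -addrA (le_trans (ler_normD _ _))// (le_trans _ xr)// lerD2l.
  by rewrite (le_trans (y2 t))// ler_nat.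
(* A competitor worth at most [- m] is beaten by the floor [- m] along the circle. Any other
   satisfies [A * |x - z| < M + m <= A], so it is within 1 of [x], and its truncation is
   inactive. *)
have [low|high] := leP (truncation z - A * `|x - z|) (- m).
  apply: (@le_trans _ _ (\int[mu]_(t in circle_dom) (- m))).
    by rewrite circle_integral_cst ler_pM2l.
  apply: le_Rintegral.
  - exact: circle_dom_measurable.
  - by apply: circle_integrable; exact: cst_continuous.
  - exact: circle_integrable.
  by move=> t _; rewrite (le_trans (truncation_ge (x + cos t *: v1 + sin t *: v2)))// sup_conv_ge.
have xz : `|x - z| <= 1.
  rewrite leNgt; apply/negP => xz; have := truncation_le zr.
  have : A * 1 <= A * `|x - z| by rewrite ler_wpM2l// ltW.
  by move: high MA; move: (truncation z) (A * `|_|) => *; lra.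
have uz : u z = (truncation z)%:E.
  by apply: truncation_eq; rewrite (lt_le_trans high)// lerBlDr lerDl mulr_ge0.
pose d := A * `|x - z|.
have [_ _ /(_ z v1 v2 iso) [_ _ /(_ (0, 0) 1 ltr01)]] := pu.
move=> /(_ (fun _ _ => I)) /=.
rewrite /plane_param /= !scale0r !addr0 uz.
have le t : (u (z + (0 + 1 * cos t) *: v1 + (0 + 1 * sin t) *: v2) <=
   (sup_conv (x + cos t *: v1 + sin t *: v2) + d)%:E)%E.
  rewrite !add0r !mul1r (le_trans (le_truncation _))// lee_fin -lerBlDr.
  have zy : `|z + cos t *: v1 + sin t *: v2| <= rho.
    rewrite -addrA (le_trans (ler_normD _ _))// (le_trans _ xr)//.
    rewrite -(subrK x z) addrC addrA (le_trans (lerD (ler_normD _ _) (lexx _)))//.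
    by have := y2 t; rewrite distrC; move: xz; rewrite addrC; move: (`|x - z|) (`|y t|) (`|x|) => *; lra.
  have := sup_conv_ub (x + cos t *: v1 + sin t *: v2) zy.
  suff -> : x + cos t *: v1 + sin t *: v2 - (z + cos t *: v1 + sin t *: v2) = x - z by [].
  by rewrite -(addrA x) -(addrA z) opprD addrACA subrr addr0.
have cWb : continuous (fun t => sup_conv (x + cos t *: v1 + sin t *: v2) + d).
  by apply: contD => //; exact: cst_continuous.
have := @le_integral_any _ _ _ mu circle_dom _ _ (fun t _ => le t).
rewrite (circle_integralE cWb) => h1 h2.
have : ((truncation z)%:E <= ((2 * pi)^-1)%:E *
   (\int[mu]_(t in circle_dom) (sup_conv (x + cos t *: v1 + sin t *: v2) + d))%:E)%E.
  apply: le_trans h2 _; apply: lee_wpmul2l => //.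
  by rewrite lee_fin invr_ge0 ltW.
rewrite -EFinM lee_fin -ler_pdivrMl ?invr_gt0// invrK.
have mD := @circle_dom_measurable R.
rewrite RintegralD//; last 2 first.
  exact: circle_integrable.
  by apply: circle_integrable; exact: cst_continuous.
by rewrite circle_integral_cst mulrBr lerBlDr.
Qed.

End SupConvolution.

(** * Lipschitz and smooth approximants *)

Section Regularization.
Context {R : realType}.
Implicit Types (x y z v : 'rV[R]_3).
Local Notation mu := (@lebesgue_measure R).

Lemma usc_open (u : 'rV[R]_3 -> \bar R) (c : R) : usc_on [set: 'rV[R]_3] u -> open [set z | (u z < c%:E)%E].
Proof.
move=> uu; rewrite openE => z /= uz; have := uu z I c uz.
by rewrite near_withinE => h; apply: filterS h => y; exact.
Qed.

Lemma usc_bounded (u : 'rV[R]_3 -> \bar R) (C : set 'rV[R]_3) : compact C -> usc_on [set: 'rV[R]_3] u ->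
  (forall x, u x != +oo%E) -> exists M, forall z, C z -> (u z <= M%:E)%E.
Proof.
move=> /compact_near_coveringP cC uu uoo.
have := cC R (pinfty_nbhs R) (fun M z => (u z <= M%:E)%E) _.
case.
  move=> x Cx.
  have [a ua] : exists a : R, (u x < a%:E)%E.
    have := uoo x; case: (u x) => [r||]// _; last by exists 0; rewrite ltNye.
    by exists (r + 1); rewrite lte_fin ltrDl.
  exists ([set z | (u z < a%:E)%E], [set M | a < M]).
    split; first by have := uu x I a ua; rewrite near_withinE => h; apply: filterS h => y; exact.
    by exists a; split => //; exact: num_real.
  by move=> [z M] [/= uz aM]; rewrite (le_trans (ltW uz))// lee_fin ltW.
move=> M0 [_ h]; exists (M0 + 1) => z Cz; have := h (M0 + 1); rewrite ltrDl => /(_ ltr01); exact.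
Qed.

Lemma closed_ball_compact (rho : R) : compact [set z : 'rV[R]_3 | `|z| <= rho].
Proof.
apply: bounded_closed_compact.
  by exists rho; split; [exact: num_real|move=> x Mx q /= /le_trans; apply; exact: ltW].
have -> : [set z : 'rV[R]_3 | `|z| <= rho] = (fun z : 'rV[R]_3 => `|z|) @^-1` [set x : R | x <= rho] by [].
apply: closed_comp; first by move=> x _; exact: (@norm_continuous _ ('rV[R]_3) x).
exact: closed_le.
Qed.

(** Sup-convolution raises values, so the bound on [K] has to be protected: [K] is at a positive
    distance from the closed set where [u >= c'], and a large slope [A] makes competitors from that
    set worth at most [c'] on [K]. *)
Lemma psh_sup_conv (u : 'rV[R]_3 -> \bar R) (K : set 'rV[R]_3) p (B : R) : minimal_psh [set: 'rV[R]_3] u -> compact K ->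
  (forall x, K x -> `|x| <= B) -> `|p| <= B -> (ereal_sup (u @` K) < u p)%E ->
  exists W A c' c, [/\ 0 <= A, forall x y, `|W x - W y| <= A * `|x - y|,
    forall x (v1 v2 : 'rV[R]_3), isothermal v1 v2 -> `|x| <= B + 1 -> `|v1| <= 1 -> `|v2| <= 1 ->
      2 * pi * W x <= \int[mu]_(t in circle_dom) W (x + cos t *: v1 + sin t *: v2),
    c' < c & (forall x, K x -> W x <= c') /\ c <= W p].
Proof.
move=> pu cK KB pB Kp; have [uoo uu _] := pu.
have {}uoo x : u x != +oo%E by exact: uoo.
have [c uc] : exists c : R, u p = c%:E.
  have := uoo p; move: Kp; case: (u p) => [r||]//; first by exists r.
  by rewrite ltNge leNye.
have [c' [Kc' c'c]] : exists c' : R, (ereal_sup (u @` K) < c'%:E)%E /\ c' < c.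
  move: Kp; rewrite uc; case: (ereal_sup _) => [r||]//.
    rewrite lte_fin => rc; exists ((r + c) / 2); rewrite lte_fin.
    by split; lra.
  by move=> _; exists (c - 1); rewrite ltNye; split => //; lra.
have B0 : 0 <= B by exact: le_trans pB.
(* The submean property is wanted for [|x| <= B + 1], and [sup_conv_submean] asks for 3 more. *)
pose rho := B + 4.
have rho0 : 0 <= rho by rewrite addr_ge0.
have [M hM] := usc_bounded (@closed_ball_compact rho) uu uoo.
have cM : c <= M.
  by rewrite -lee_fin -uc; apply: hM => /=; rewrite (le_trans pB)// lerDl.
pose m := - c'.
have mM : - m <= M by rewrite opprK; lra.
have [delta [d0 hd]] : exists d, 0 < d /\
    forall x z, K x -> (c'%:E <= u z)%E -> d <= `|x - z|.
  pose V := [set z | (c'%:E <= u z)%E].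
  have cV : closed V.
    rewrite -openC (_ : ~` V = [set z | (u z < c'%:E)%E]); first exact: usc_open.
    by apply/seteqP; split => z /=; rewrite ltNge => /negP.
  have Vp : V p by rewrite /V /= uc lee_fin ltW.
  have [h [ch h0 hV hz]] := dist_function cV (ex_intro _ p Vp).
  have [[x Kx]|/forallNP n0] := pselect (exists x, K x); last first.
    by exists 1; split => // x z /n0.
  have cf : {within K, continuous h} by exact: continuous_subspaceT.
  have [z0 z0K hz0] := compact_EVT_min (ex_intro _ x Kx) cK cf.
  rewrite inE in z0K.
  exists (h z0); split.
    apply/hV => /=; apply/negP; rewrite -ltNge (le_lt_trans _ Kc')//.
    by apply: ereal_sup_ubound; exists z0.
  move=> y z Ky Vz; rewrite (le_trans _ (hz _ _ Vz))//.
  by apply: hz0; rewrite inE.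
(* The first bound is the slope condition of [sup_conv_submean]; the second gives
   [M - A * delta <= c']. *)
pose A := Num.max (M + m) ((M - c') / delta).
have A0 : 0 <= A by rewrite le_max /m; apply/orP; left; lra.
exists (sup_conv u rho m A), A, c', c; split => //.
- exact: (sup_conv_lipschitz pu rho0 A0 hM mM).
- move=> x v1 v2 iso xB v11 v21; apply: (sup_conv_submean pu rho0 A0 hM mM iso) => //.
    by rewrite /rho; lra.
  have : M + m <= A by rewrite le_max lexx.
  by lra.
split.
  move=> x Kx; apply: (sup_conv_le pu rho0 A0 hM mM) => z zr.
  have [uz|/(hd _ _ Kx) xz] := ltP (u z) c'%:E.
    rewrite -[leRHS]subr0 lerB ?mulr_ge0//.
    rewrite -lee_fin (truncationE m pu) ge_max (ltW uz)/= lee_fin opprK//.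
  rewrite lerBlDr (le_trans (truncation_le pu hM mM zr))// -lerBlDl.
  apply: (@le_trans _ _ (A * delta)); last by rewrite ler_wpM2l.
  by rewrite -ler_pdivrMr// le_max lexx orbT.
have pr : `|p| <= rho by rewrite (le_trans pB)// lerDl.
rewrite (le_trans _ (sup_conv_ge pu rho0 A0 hM mM pr))//.
by rewrite -lee_fin (truncationE m pu) uc le_max lexx.
Qed.

End Regularization.

(** The kernel width [e] and the box size [L] depend only on [W], [B] and the gap, so [gamma] is
    available before [eta], which enters only through the mesh. *)
Lemma psh_smooth_approx (R : realType) (u : 'rV[R]_3 -> \bar R) (K : set 'rV[R]_3)
    (p : 'rV[R]_3) (B : R) : minimal_psh [set: 'rV[R]_3] u -> compact K ->
  (forall x, K x -> `|x| <= B) -> `|p| <= B -> (ereal_sup (u @` K) < u p)%E ->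
  exists gamma, 0 < gamma /\ forall eta, 0 < eta -> exists g : C3 R -> R,
    [/\ smooth g, depends_re g,
      forall q v, `|re_part q| <= B -> null_vector v ->
        - (eta * (sqre v + sqim v)) <= levi g q v,
      forall q, tube K q -> g q <= 0 & gamma <= g (real_pt p)].
Proof.
move=> pu cK KB pB Kp.
have [W [A [c' [c [A0 WA Wsub c'c [WK Wp]]]]]] := psh_sup_conv pu cK KB pB Kp.
(* Centering at the midpoint gives [f <= - a] on [K] and [f p >= a]. *)
pose b := (c' + c) / 2; pose a := (c - c') / 2.
have a0 : 0 < a by rewrite /a; lra.
pose f x := W x - b.
have fA x y : `|f x - f y| <= A * `|x - y|.
  by rewrite /f opprB addrA subrK WA.
have fsub z (v1 v2 : 'rV[R]_3) : isothermal v1 v2 -> `|z| <= B + 1 -> `|v1| <= 1 -> `|v2| <= 1 ->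
  2 * pi * f z <= \int[lebesgue_measure]_(t in circle_dom) f (z + cos t *: v1 + sin t *: v2).
  move=> iso zB v11 v21; rewrite /f.
  have cW : continuous (fun t => W (z + cos t *: v1 + sin t *: v2)).
    move=> t; apply: (@continuous_comp _ _ _ (fun t : R => z + cos t *: v1 + sin t *: v2) W).
      apply: cvgD; first apply: cvgD; first exact: cvg_cst.
        by apply: cvgZr_tmp; exact: continuous_cos.
      by apply: cvgZr_tmp; exact: continuous_sin.
    exact: (lipschitz_cont WA).
  rewrite RintegralD; last 3 first.
  - exact: circle_dom_measurable.
  - exact: circle_integrable.
  - by apply: circle_integrable; exact: cst_continuous.
  by rewrite circle_integral_cst mulrDr lerD2r; exact: Wsub.
(* Within [e] of a point [f] changes by at most [a / 2]: it stays negative near [K] and at least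
   [a / 2] near [p]. *)
pose e := Num.min 1 (a / (2 * A + 1)).
have A1 : 0 < 2 * A + 1 by rewrite ltr_wpDl// mulr_ge0.
have e0 : 0 < e by rewrite lt_min ltr01 divr_gt0.
have e1 : e <= 1 by rewrite ge_min lexx.
have Ae : A * e <= a / 2.
  have : e * (2 * A + 1) <= a by rewrite -ler_pdivlMr// ge_min lexx orbT.
  by rewrite mulrDr mulr1 mulrCA => h; rewrite [A * e]mulrC; lra.
have AE z x : `|x - z| <= e -> f x - a / 2 <= f z <= f x + a / 2.
  move=> xz; have := fA x z; have := ler_wpM2l A0 xz; rewrite ler_norml.
  by move: (A * `|_|) => y h1 /andP[h2 h3]; apply/andP; split; lra.
have B0 : 0 <= B by exact: le_trans pB.
pose L := Num.bound ((2 * B + 3) * 2 / e).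
have hL : 2 * B + 3 <= e * L%:R / 2.
  have h0 : 0 <= (2 * B + 3) * 2 / e.
    by rewrite divr_ge0 ?(ltW e0)// mulr_ge0// addr_ge0// mulr_ge0.
  by rewrite ler_pdivlMr// -ler_pdivrMl// mulrC ltW// archi_boundP.
clearbody e L.
exists (a / 2 * mass_lb e L); split.
  by apply: mulr_gt0; [rewrite divr_gt0|refine (@mass_lb_gt0 R p B e e0 pB L hL)].
move=> eta eta0.
have [m [m0 hm]] := levi_mollify_ge A0 e0 e1 fA pB fsub hL eta0.
exists (mollify f p e (mesh e m) (mesh_box L m)); split => //.
- exact: smooth_mollify.
- exact: mollify_re.
- move=> q Kq; apply: (mollify_le0 _ e0) => z /AE/andP[_ h].
  by rewrite (le_trans h)//; have := WK _ Kq; rewrite /f /b /a; lra.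
have a20 : 0 <= a / 2 by rewrite divr_ge0// ltW.
have hp z : `|p - z| <= e -> a / 2 <= f z.
  by move=> /AE/andP[h _]; rewrite (le_trans _ h)//; move: Wp; rewrite /f /b /a; lra.
exact: (mollify_ge A0 e0 e1 pB hL m0 a20 hp).
Qed.

(** * Currents and test forms *)

Section TestForms.
Context {R : realType}.
Implicit Types (u f g : C3 R -> R) (alpha beta : two_form R) (q v w : C3 R).

(** The standard Kaehler form, whose value on [v] and [Jmap v] is [|v|^2]; multiples of it
    compensate negative Levi forms. *)
Definition omega0 : 'M[R]_(3 + 3) := \matrix_(j, k) Jmap (ebase R j) ord0 k.

Lemma omega0E j k : omega0 j k = Jmap (ebase R j) ord0 k.
Proof. exact: mxE. Qed.

Lemma pairing_omega0 v w : pairing omega0 v w = dotv (Jmap v) w.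
Proof.
rewrite /pairing mxE; apply: eq_bigr => k _; rewrite [w^T _ _]mxE [(_ *m _) _ _]mxE.
by congr (_ * _); rewrite -sum_Jmap; apply: eq_bigr => j _; rewrite omega0E.
Qed.

Lemma dotv_Jmap v w : dotv (Jmap v) w = - dotv v (Jmap w).
Proof.
have oppE (x : 'rV[R]_3) i : (- x) ord0 i = - x ord0 i by rewrite mxE.
rewrite /dotv !big_split_ord /= opprD addrC -!sumrN; congr (_ + _); apply: eq_bigr => j _.
  by rewrite !rshift_im !lshift_re im_Jmap re_Jmap oppE mulrN opprK.
by rewrite !rshift_im !lshift_re im_Jmap re_Jmap oppE mulNr.
Qed.

Lemma omega0_skew : omega0^T = - omega0.
Proof.
apply/matrixP => j k; rewrite [LHS]mxE [RHS]mxE !omega0E.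
have d (v : C3 R) i : v ord0 i = dotv v (ebase R i).
  rewrite /dotv (bigD1 i)//= big1 ?addr0.
    by rewrite /ebase mxE !eqxx mulr1.
  by move=> l li; rewrite /ebase mxE eqxx (negbTE li) mulr0.
by rewrite !d dotv_Jmap /dotv; congr (- _); apply: eq_bigr => i _; rewrite mulrC.
Qed.

Lemma omega0_comass (c : R) : 0 <= c <= 1 -> comass_le1 (c *: omega0).
Proof.
move=> /andP[c0 c1] v w v1 w1; rewrite pairingZ pairing_omega0.
have dd (x : C3 R) : enorm x <= 1 -> sqre x + sqim x <= 1.
  by rewrite -enorm2 => x1; rewrite expr_le1 ?sqrtr_ge0.
have h : `|dotv (Jmap v) w| <= 1.
  rewrite (@le_trans _ _ ((dotv (Jmap v) (Jmap v) + dotv w w) / 2))//.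
    rewrite /dotv -big_split/= mulr_suml (le_trans (ler_norm_sum _ _ _))// ler_sum// => k _.
    move: (Jmap v ord0 k) (w ord0 k) => x y.
    rewrite ler_norml; apply/andP; split.
      have := sqr_ge0 (x + y); rewrite expr2 => h; lra.
    have := sqr_ge0 (x - y); rewrite expr2 => h; lra.
  have e (x : C3 R) : dotv x x = sqre x + sqim x by rewrite /dotv big_split_ord.
  rewrite !e sqre_Jmap sqim_Jmap ler_pdivrMr// mul1r.
  by have := dd _ v1; have := dd _ w1 => h1 h2; lra.
by rewrite normrM ger0_norm// mulr_ile1.
Qed.

End TestForms.

(** * Vanishing of a current off its support *)

Section CurrentSupport.
Context {R : realType}.
Implicit Types (u f g : C3 R -> R) (alpha beta : two_form R) (q v w : C3 R).

Lemma norm_sq q : `|q| ^+ 2 <= sqre q + sqim q.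
Proof.
rewrite -enorm2 ler_pXn2r ?nnegrE ?sqrtr_ge0//.
by apply: norm_le_dotv; rewrite ?sqrtr_ge0// sqr_sqrtr// dotv_ge0.
Qed.

Lemma bump_function (U : set (C3 R)) q0 : open U -> U q0 -> exists f (V A : set (C3 R)),
  [/\ smooth f, open V /\ V q0, forall q, V q -> f q = 1, closed A /\ A `<=` U &
    forall q, ~ A q -> f q = 0].
Proof.
move=> oU Uq; have : nbhs q0 U by exact: open_nbhs_nbhs.
move=> /nbhs_ballP[r /= r0 rU].
pose d (q : C3 R) := sqre (q + - q0) + sqim (q + - q0).
have sd : smooth d.
  exact: (smoothD (smooth_shift (- q0) (@smooth_sqre R)) (smooth_shift (- q0) (@smooth_sqim R))).
(* [step] vanishes from 2 on, that is from squared distance [2 / c = (r / 2)^2] on. *)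
pose c := 8 / r ^+ 2.
have c0 : 0 < c by rewrite divr_gt0 ?exprn_gt0.
have sg : smooth (fun q => c * d q) by exact: smoothZ.
have cg := smooth_continuous sg.
exists (fun q => step (c * d q)), [set q | c * d q < 1], [set q | c * d q <= 2]; split.
- exact: smooth_step.
- split.
    have -> : [set q | c * d q < 1] = (fun q => c * d q) @^-1` [set x | x < 1] by [].
    by apply: open_comp; [move=> x _; exact: cg|exact: open_lt].
  rewrite /= /d subrr /sqre /sqim !big1 ?addr0 ?mulr0// => j _; rewrite mxE mul0r//.
- by move=> q /= h; rewrite step1// ltW.
- split.
    have -> : [set q | c * d q <= 2] = (fun q => c * d q) @^-1` [set x | x <= 2] by [].
    by apply: closed_comp; [move=> x _; exact: cg|exact: closed_le].
  move=> q /= h; apply: rU; rewrite -ball_normE /= distrC.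
  have h1 : d q <= 2 / c by rewrite ler_pdivlMr// mulrC.
  have : `|q - q0| ^+ 2 <= (r / 2) ^+ 2.
    rewrite (le_trans (norm_sq _))// (le_trans h1)// /c le_eqVlt; apply/orP; left; apply/eqP.
    by field; rewrite gt_eqF.
  have r20 : 0 < r / 2 by rewrite divr_gt0.
  by rewrite ler_pXn2r ?nnegrE ?(ltW r20)// => /le_lt_trans; apply; lra.
- by move=> q /= /negP; rewrite -ltNge => h; rewrite step0// ltW.
Qed.

Variable T : functional R.
Hypothesis cT : current T.

Lemma currentD alpha beta : test_form alpha -> test_form beta ->
  T (fun q => alpha q + beta q) = T alpha + T beta.
Proof.
move=> ta tb; have [lin _] := cT; have := lin 1 _ _ ta tb; rewrite mul1r => <-.
by congr T; apply/funext => q; rewrite scale1r.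
Qed.

Lemma currentP (a : R) alpha beta : test_form alpha -> test_form beta ->
  T (fun q => a *: alpha q + beta q) = a * T alpha + T beta.
Proof. by have [lin _] := cT; exact: lin. Qed.

Lemma test_form0 : test_form (fun=> 0 : 'M[R]_(3 + 3)).
Proof.
split=> [q|j k|]; first by rewrite trmx0 oppr0.
  have := smooth_cst (0 : R); congr smooth; apply/funext => q; by rewrite mxE.
rewrite /supp (_ : [set q | _] = set0) ?closure0; first exact: compact0.
by apply/seteqP; split => // q /=; rewrite eqxx.
Qed.

Lemma current0 : T (fun=> 0) = 0.
Proof.
have := currentD test_form0 test_form0.
rewrite (_ : (fun q => 0 + 0) = (fun=> 0)); last by apply/funext => q; rewrite addr0.
by move=> h; apply: (@addrI _ (T (fun=> 0))); rewrite addr0; exact: esym.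
Qed.

(* Finitely many bumps [f_i], each equal to [1] near a point of the support of
   [alpha] and killed by [T], cover that support; then the form obtained from
   [alpha] on multiplying by all [1 - f_i] vanishes, but has the same image. *)
Lemma current_off_supp alpha : test_form alpha ->
  (forall q, supp alpha q -> ~ current_supp T q) -> T alpha = 0.
Proof.
move=> ta hs.
have loc q : exists fV : (C3 R -> R) * set (C3 R), open fV.2 /\ (supp alpha q ->
    [/\ smooth fV.1, fV.2 q, forall z, fV.2 z -> fV.1 z = 1 &
      forall beta, test_form beta -> T (fun z => fV.1 z *: beta z) = 0]).
  have [sq|nq] := pselect (supp alpha q); last by exists (cst 0, setT); split; [exact: openT|].
  have /existsNP[U /not_implyP[oU /not_implyP[Uq nU]]] := hs q sq.
  have [f [V [A [sf [oV Vq] fV [cA AU] fA]]]] := bump_function oU Uq.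
  exists (f, V); split => // _; split => //= beta tb.
  apply: contrapT => /eqP Tn; apply: nU; exists (fun z => f z *: beta z); split => //.
    exact: test_formM.
  apply: subset_trans AU; apply: supp_subset_closed => // z /fA ->.
  by rewrite scale0r.
have [F hF] := choice loc.
have [_ _ ca] := ta.
move: (ca); rewrite compact_cover => /(_ _ (supp alpha) (fun q => (F q).2)).
case; first by move=> q _; case: (hF q).
  by move=> q sq; exists q => //; have [_ /(_ sq)[]] := hF q.
move=> D Ds cov.
pose s : seq (C3 R) := finmap.enum_fset D.
have sD q : q \in s -> supp alpha q by move=> qs; have := Ds q qs; rewrite inE.
pose P (s : seq (C3 R)) z := \prod_(i <- s) (1 - (F i).1 z).
have main (s' : seq (C3 R)) : (forall q, q \in s' -> supp alpha q) ->
    test_form (fun z => P s' z *: alpha z) /\ T (fun z => P s' z *: alpha z) = T alpha.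
  elim: s' => [|i s' IH] si.
    have -> : (fun z => P [::] z *: alpha z) = alpha.
      by apply/funext => z; rewrite /P big_nil scale1r.
    by [].
  have [|tb Tb] := IH; first by move=> q qs; apply: si; rewrite inE qs orbT.
  have [_ /(_ (si i (mem_head _ _)))[sf _ _ f0]] := hF i.
  have e : (fun z => P (i :: s') z *: alpha z) = (fun z => (- 1) *: ((F i).1 z *: (P s' z *: alpha z)) + P s' z *: alpha z).
    by apply/funext => z; rewrite /P big_cons mulrBl mul1r scalerBl !scalerA mulN1r mulNr scaleNr addrC.
  have tf := test_formM sf tb.
  split; last by rewrite e currentP// f0// mulr0 add0r.
  have -> : (fun z => P (i :: s') z *: alpha z) = (fun z => (1 - (F i).1 z) *: (P s' z *: alpha z)).
    by apply/funext => z; rewrite /P big_cons scalerA.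
  exact: test_formM (smoothB (smooth_cst 1) sf) tb.
have [_ <-] := main s sD.
rewrite -current0; congr T; apply/funext => z.
have [sz|/not_supp ->] := pselect (supp alpha z); last by rewrite scaler0.
have [i /= iD Fi] := cov z sz.
have [_ /(_ (sD i iD))[_ _ f1 _]] := hF i.
suff -> : P s z = 0 by rewrite scale0r.
have [l1 [l2 ->]] : exists l1 l2, s = l1 ++ i :: l2.
  by have : i \in s by []; move: (s) => s0 /splitPr[l1 l2]; exists l1, l2.
by rewrite /P big_cat big_cons/= f1// subrr mul0r mulr0.
Qed.

End CurrentSupport.

(** * From a current to the hull *)

Section LocalBounds.
Context {R : realType}.
Implicit Types (u f g : C3 R -> R) (q v w : C3 R).

Lemma partial1_local (U : set (C3 R)) f g k : open U -> (forall q, U q -> f q = g q) ->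
  forall q, U q -> partial1 k f q = partial1 k g q.
Proof.
move=> oU fg q Uq; have h : nbhs q U by exact: open_nbhs_nbhs.
have E : \near q, (f : C3 R -> R^o) q = (g : C3 R -> R^o) q by exact: filterS h.
exact: (near_eq_derive (ebase R k) E).
Qed.

Lemma levi_local (U : set (C3 R)) f g v : open U -> (forall q, U q -> f q = g q) ->
  forall q, U q -> levi f q v = levi g q v.
Proof.
move=> oU fg q Uq; have h j k := partial1_local j oU (partial1_local k oU fg) Uq.
have hh x : hess f q x x = hess g q x x.
  apply: eq_bigr => j _; apply: eq_bigr => k _; exact: (congr1 (fun t => _ * t) (h j k)).
by rewrite /levi (hh v) (hh (Jmap v)).
Qed.

Lemma depends_re_partial1 f k : depends_re f -> depends_re (partial1 k f).
Proof.
move=> df q q' qq; pose a := q' - q.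
have e : (fun q => f (q + a)) = f.
  apply/funext => z; apply: df.
  by rewrite re_partD re_partD re_partN qq subrr addr0.
by rewrite -[in LHS]e (partial1_shift f a) /a addrC subrK.
Qed.

Lemma depends_re_bound f (B : R) : smooth f -> depends_re f -> exists C, 0 <= C /\
  forall q, `|re_part q| <= B -> `|f q| <= C.
Proof.
move=> sf df; have [C [C0 hC]] := ball_bound B (smooth_continuous sf).
exists C; split => // q qB; rewrite (df q (real_pt (re_part q))); last first.
  by rewrite /real_pt re_row_mx.
by apply: hC; exact: le_trans (real_pt_norm _) qB.
Qed.

Lemma grad_ebase f q (c : R) k : grad f q (c *: ebase R k) = c * partial1 k f q.
Proof.
rewrite /grad (bigD1 k)//= mxE /ebase mxE !eqxx mulr1 big1 ?addr0// => j jk.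
by rewrite !mxE eqxx (negbTE jk) mulr0 mul0r.
Qed.

Lemma derive_scale (c : R) f q k : smooth f ->
  is_derive q (ebase R k) ((fun q => f (c *: q)) : C3 R -> R^o) (c * partial1 k f (c *: q)).
Proof.
move=> sf.
have d := derive1_curve sf (is_diff_line (c *: q) (c *: ebase R k) 0).
rewrite scale0r addr0 grad_ebase in d.
have e : f \o (fun t : R => c *: q + t *: (c *: ebase R k)) =
    fun s : R => f (c *: (s *: ebase R k + q)).
  apply/funext => s /=; rewrite scalerDr addrC; congr f; congr (_ + _).
  by rewrite !scalerA mulrC.
rewrite e in d; have [d1 d2] := d.
split; first exact/derivable1P.
rewrite -d2 /derive.
suff -> : (fun s : R => s^-1 *: (((fun q => f (c *: q)) \o shift q) (s *: ebase R k) - f (c *: q))) =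
    (fun s : R => s^-1 *: (((fun s : R => f (c *: (s *: ebase R k + q))) \o shift 0) (s *: (1 : R)) -
       f (c *: (0 *: ebase R k + q)))) by [].
by apply/funext => s /=; rewrite addr0 scale0r add0r [_ *: 1]mulr1.
Qed.

Lemma partial1_scale (c : R) f k : smooth f ->
  partial1 k (fun q => f (c *: q)) = fun q => c * partial1 k f (c *: q).
Proof. by move=> sf; apply/funext => q; have [_] := derive_scale c q k sf. Qed.

Lemma smooth_scale (c : R) f : smooth f -> smooth (fun q => f (c *: q)).
Proof.
move=> sf; apply/CnP => n; elim: n f sf => [|n IH] f sf /=.
  move=> q; apply: (@continuous_comp _ _ _ (fun q => c *: q) f); first exact: scaler_continuous.
  exact: smooth_continuous.
split.
- move=> q; apply: (@continuous_comp _ _ _ (fun q => c *: q) f); first exact: scaler_continuous.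
  exact: smooth_continuous.
- by move=> k q; have [] := derive_scale c q k sf.
- move=> k; rewrite (partial1_scale c k sf); apply: CnM.
    by have /CnP := smooth_cst c; exact.
  by apply: IH; exact: smooth_partial1.
Qed.

Lemma grad_bound f q v (C : R) : (forall k, `|partial1 k f q| <= C) ->
  `|grad f q v| <= 6 * C * `|v|.
Proof.
move=> hC; rewrite /grad (le_trans (ler_norm_sum _ _ _))//.
apply: (@le_trans _ _ (\sum_(k < 3 + 3) C * `|v|)).
  by apply: ler_sum => k _; rewrite normrM mulrC ler_pM// coord_le_norm.
by rewrite sumr_const card_ord -mulrA mulr_natl.
Qed.

Lemma hess_bound f q v (C : R) : (forall j k, `|partial1 j (partial1 k f) q| <= C) ->
  `|hess f q v v| <= 36 * C * `|v| ^+ 2.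
Proof.
move=> hC; rewrite /hess (le_trans (ler_norm_sum _ _ _))//.
apply: (@le_trans _ _ (\sum_(j < 3 + 3) \sum_(k < 3 + 3) C * `|v| ^+ 2)).
  apply: ler_sum => j _; rewrite (le_trans (ler_norm_sum _ _ _))//; apply: ler_sum => k _.
  rewrite normrM mulrC ler_pM//; rewrite normrM expr2 ler_pM// coord_le_norm//.
by rewrite !sumr_const !card_ord -mulrnA -[leLHS]mulr_natl mulrA.
Qed.

(** Partials of [s (c *: q)] carry a factor [c], or [c^2 <= c] at second order. Those of [s] are
    bounded over [|x| <= B], since they vanish for [|y|^2 > 2]; and [c <= 1] keeps [c *: q] over the
    same set. *)
Lemma cutoff_bound (B : R) : exists C, 0 <= C /\ forall c q, 0 <= c <= 1 -> `|re_part q| <= B ->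
  (forall k, `|partial1 k (fun q : C3 R => step (sqim (c *: q))) q| <= c * C) /\
  (forall j k, `|partial1 j (partial1 k (fun q : C3 R => step (sqim (c *: q)))) q| <= c * C).
Proof.
pose s (q : C3 R) := step (sqim q).
have ss : smooth s by apply: smooth_step; exact: smooth_sqim.
have [B0|Bn] := leP 0 B; last first.
  exists 0; split => // c q _ qB; have : `|re_part q| < 0 by exact: le_lt_trans Bn.
  by rewrite ltNge normr_ge0.
have out q : 2 < sqim q -> (forall k, partial1 k s q = 0) /\
    (forall j k, partial1 j (partial1 k s) q = 0).
  pose U := [set q : C3 R | 2 < sqim q].
  have oU : open U.
    have -> : U = @sqim R @^-1` [set x | 2 < x] by [].
    apply: open_comp; last exact: open_gt.
    by move=> x _; apply: smooth_continuous; exact: smooth_sqim.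
  have z : forall q, U q -> s q = cst 0 q by move=> q' /= h; rewrite /s step0// ltW.
  have z1 k : forall q, U q -> partial1 k s q = cst 0 q.
    by move=> q' Uq; rewrite (partial1_local k oU z Uq) partial1_cst.
  move=> Uq; split=> [k|j k]; first exact: z1.
  by rewrite (partial1_local j oU (z1 k) Uq) partial1_cst.
have near q : `|re_part q| <= B -> sqim q <= 2 -> `|q| <= B + 2.
  move=> qB q2; apply: norm_le_coord => [|k]; first exact: addr_ge0.
  rewrite -[k]splitK /unsplit; case: (fintype.split k) => j.
    by rewrite lshift_re (le_trans (coord_le_norm _ _))// ler_wpDr.
  rewrite ler_wpDl// rshift_im (le_trans (coord_le_norm _ _))// norm_le_dotv// -sqimE.
  by rewrite (le_trans q2)// expr2; lra.
have [C1 hC1] := choice (fun k => ball_bound (B + 2) (smooth_continuous (smooth_partial1 k ss))).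
have [C2 hC2] := choice (fun jk : 'I_(3 + 3) * 'I_(3 + 3) =>
  ball_bound (B + 2) (smooth_continuous (smooth_partial1 jk.1 (smooth_partial1 jk.2 ss)))).
have C10 k : 0 <= C1 k by have [] := hC1 k.
have C20 k : 0 <= C2 k by have [] := hC2 k.
pose C := \sum_k C1 k + \sum_k C2 k.
have S1 : 0 <= \sum_k C1 k by apply: sumr_ge0.
have S2 : 0 <= \sum_k C2 k by apply: sumr_ge0.
have h1 q k : `|re_part q| <= B -> `|partial1 k s q| <= C.
  move=> qB; have [q2|/out[h _]] := leP (sqim q) 2; last by rewrite h normr0 addr_ge0.
  have [_ /(_ q (near q qB q2)) h] := hC1 k; rewrite (le_trans h)// ler_wpDr//.
  by rewrite (bigD1 k)//= lerDl sumr_ge0.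
have h2 q j k : `|re_part q| <= B -> `|partial1 j (partial1 k s) q| <= C.
  move=> qB; have [q2|/out[_ h]] := leP (sqim q) 2; last by rewrite h normr0 addr_ge0.
  have [_ /(_ q (near q qB q2)) h] := hC2 (j, k); rewrite (le_trans h)// ler_wpDl//.
  by rewrite (bigD1 (j, k))//= lerDl sumr_ge0.
exists C; split; first exact: addr_ge0.
move=> c q /andP[c0 c1] qB.
have cqB : `|re_part (c *: q)| <= B.
  by rewrite re_partZ normrZ ger0_norm// (le_trans _ qB)// ler_piMl.
have e1 k : partial1 k (fun q : C3 R => s (c *: q)) = fun q => c * partial1 k s (c *: q).
  exact: partial1_scale.
split=> [k|j k]; rewrite -/(s) e1.
  by rewrite normrM ger0_norm// ler_wpM2l// h1.
have sk := smooth_partial1 k ss.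
rewrite (partial1Z j c (smooth_scale c sk)) (partial1_scale c j sk) mulrA.
rewrite normrM ger0_norm ?mulr_ge0// ler_pM// ?mulr_ge0//; first by rewrite ler_piMr.
exact: h2.
Qed.


(** Every term of the product rule other than [psi * levi g] contains a derivative of the cutoff,
    hence a factor [c]; and [0 <= psi <= 1] preserves the lower bound of the main term. *)
Lemma cutoff_levi g (B : R) : smooth g -> depends_re g -> exists C, 0 <= C /\
  forall c eta q v, 0 <= c <= 1 -> 0 <= eta -> `|re_part q| <= B ->
    - (eta * (sqre v + sqim v)) <= levi g q v ->
    - ((eta + C * c) * (sqre v + sqim v)) <=
       levi (fun q => step (sqim (c *: q)) * g q) q v.
Proof.
move=> sg dg.
have [G0 [G00 hG0]] := depends_re_bound B sg dg.
have [G1 hG1] := choice (fun k => depends_re_bound B (smooth_partial1 k sg) (depends_re_partial1 k dg)).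
have G10 k : 0 <= G1 k by have [] := hG1 k.
pose G := G0 + \sum_k G1 k.
have S1 : 0 <= \sum_k G1 k by apply: sumr_ge0.
have G_ge0 : 0 <= G by exact: addr_ge0.
have [C [C0 hC]] := cutoff_bound B.
(* For each of [v] and [Jmap v]: 36 from [g * hess psi] and 36 from each of the two gradient
   products. *)
exists (216 * C * G); split; first by rewrite !mulr_ge0.
move=> c eta q v c01 eta0 qB lg; have [h1 h2] := hC c q c01 qB.
set psi := fun q : C3 R => step (sqim (c *: q)) in h1 h2 *.
have spsi : smooth psi.
  by apply: (@smooth_scale c (fun q => step (sqim q))); apply: smooth_step; exact: smooth_sqim.
have gG : `|g q| <= G by rewrite (le_trans (hG0 q qB))// lerDl.
have dG k : `|partial1 k g q| <= G.
  have [_ /(_ q qB) h] := hG1 k; rewrite (le_trans h)// ler_wpDl//.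
  by rewrite (bigD1 k)//= lerDl sumr_ge0.
have c0 : 0 <= c by case/andP: c01.
set n2 := sqre v + sqim v in lg *.
have n20 : 0 <= n2 by rewrite addr_ge0 ?re2_ge0 ?im2_ge0.
have vn : `|v| ^+ 2 <= n2 by exact: norm_sq.
have Jvn : `|Jmap v| ^+ 2 <= n2.
  by rewrite (le_trans (norm_sq _))// sqre_Jmap sqim_Jmap addrC.
have cC0 : 0 <= c * C by rewrite mulr_ge0.
have hb w : `|w| ^+ 2 <= n2 -> `|hess psi q w w| <= 36 * (c * C) * n2.
  move=> wn; rewrite (le_trans (hess_bound w h2))// ler_wpM2l// mulr_ge0//.
have gb w : `|w| ^+ 2 <= n2 -> `|grad psi q w * grad g q w| <= 36 * (c * C) * G * n2.
  move=> wn; rewrite normrM (@le_trans _ _ ((6 * (c * C) * `|w|) * (6 * G * `|w|)))//.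
    by rewrite ler_pM//; exact: grad_bound.
  have -> : 6 * (c * C) * `|w| * (6 * G * `|w|) = 36 * (c * C) * G * `|w| ^+ 2 by ring.
  by rewrite ler_wpM2l// !mulr_ge0.
have E w : `|w| ^+ 2 <= n2 -> - (108 * (c * C) * G * n2) <=
    hess (fun q => psi q * g q) q w w - psi q * hess g q w w.
  move=> wn; rewrite (hessM _ _ _ spsi sg) addrAC [psi q * _ + _]addrC addrK.
  have a1 : `|g q * hess psi q w w| <= G * (36 * (c * C) * n2).
    by rewrite normrM ler_pM// hb.
  have a2 := gb w wn; rewrite [grad g q w * _]mulrC.
  move: a1 a2; rewrite !ler_norml; move: (g q * _) (grad psi q w * _) => x y.
  move=> /andP[x1 _] /andP[y1 _]; lra.
have := E v vn; have := E (Jmap v) Jvn.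
have psi01 : 0 <= psi q <= 1 by rewrite step_ge0 step_le1.
have : - (eta * n2) <= psi q * levi g q v.
  case/andP: psi01 => p0 p1.
  apply: (@le_trans _ _ (psi q * - (eta * n2))); last by rewrite ler_wpM2l.
  by rewrite mulrN lerN2 ler_piMl// mulr_ge0.
have -> : psi q * levi g q v = psi q * hess g q v v + psi q * hess g q (Jmap v) (Jmap v).
  exact: mulrDr.
have -> : levi (fun q => psi q * g q) q v = hess (fun q => psi q * g q) q v v +
   hess (fun q => psi q * g q) q (Jmap v) (Jmap v) by [].
have -> : - ((eta + 216 * C * G * c) * n2) = - (eta * n2) - (108 * (c * C) * G * n2) - (108 * (c * C) * G * n2) by ring.
move: (hess _ q v v) (hess _ q (Jmap v) (Jmap v)) (psi q * hess g q v v) (psi q * hess g q (Jmap v) (Jmap v)).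
by move: (eta * n2) (_ * n2) => *; lra.
Qed.

End LocalBounds.

(** * Testing the current on cut-off approximants *)

Section CurrentToHull.
Context {R : realType}.
Implicit Types (u f g : C3 R -> R) (q v w : C3 R).

Lemma compact_slab (M N : R) : compact [set q : C3 R | sqre q <= M /\ sqim q <= N].
Proof.
have cK := @closed_ball_compact R (`|M| + 1).
apply: subclosed_compact (compact_tube_slab (M := N) cK) _.
  have -> : [set q : C3 R | sqre q <= M /\ sqim q <= N] =
     (@sqre R @^-1` [set x | x <= M]) `&` (@sqim R @^-1` [set x | x <= N]) by [].
  by apply: closedI; (apply: closed_comp; last exact: closed_le) => q _;
    apply: smooth_continuous; [exact: smooth_sqre|exact: smooth_sqim].
move=> q [qM qN]; split => //=.
have M0 : 0 <= `|M| + 1 by rewrite addr_ge0.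
apply: norm_le_dotv => //; rewrite -sqreE (le_trans qM)// (le_trans (ler_norm M))//.
rewrite sqrrD expr1n mulr1 mulr2n.
have := sqr_ge0 `|M|; have := normr_ge0 M; move: (`|M| ^+ 2) (`|M|) => *; lra.
Qed.

Lemma mass_bound (T : functional R) : current T -> (mass T < +oo)%E ->
  exists M, 0 <= M /\ forall alpha, test_form alpha -> (forall q, comass_le1 (alpha q)) -> T alpha <= M.
Proof.
move=> cT mT; exists (fine (mass T)).
have ub alpha : test_form alpha -> (forall q, comass_le1 (alpha q)) -> ((T alpha)%:E <= mass T)%E.
  by move=> ta ca; apply: ereal_sup_ubound; exists alpha.
have m0 : (0 <= mass T)%E.
  have := ub _ (@test_form0 R); rewrite (current0 cT); apply.
  by move=> _ v w _ _; rewrite pairing0 normr0.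
have fm : mass T \is a fin_num by rewrite ge0_fin_numE.
split; first exact: fine_ge0.
by move=> alpha ta ca; rewrite -lee_fin fineK//; exact: ub.
Qed.

Lemma measurable_tube (K : set 'rV[R]_3) : compact K -> measurable (tube K : set (borelC3 R)).
Proof.
move=> cK; rewrite -[tube K]setCK; apply: measurableC; apply: sub_gen_smallest.
rewrite openC; apply: closed_comp; first by move=> q _; exact: re_part_continuous.
exact: compact_closed (@norm_hausdorff _ _) cK.
Qed.

(** [f] is dominated everywhere by [|M|] times the indicator of the complement of the tube, a null
    set. *)
Lemma integral_le0_tube (K : set 'rV[R]_3) (mu : probability (borelC3 R) R) f (M : R) :
  compact K -> mu (tube K) = 1%E -> (forall q, f q <= M) -> (forall q, tube K q -> f q <= 0) ->
  (\int[mu]_q (f q)%:E <= 0)%E.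
Proof.
move=> cK muK fM fK.
have mK := measurable_tube cK.
have mC : measurable (~` tube K : set (borelC3 R)) by exact: measurableC.
have muC : mu (~` tube K : set (borelC3 R)) = 0%E.
  by rewrite probability_setC// muK subee.
apply: (@le_trans _ _ (\int[mu]_q ((`|M|%:E * (\1_(~` tube K) (q : borelC3 R))%:E))))%E.
  apply: le_integral_any => q _; rewrite -EFinM lee_fin indicE.
  have [Kq|nK] := pselect (tube K q).
    by rewrite memNset ?mulr0 ?fK//; apply.
  by rewrite mem_set// mulr1 (le_trans (fM q))// ler_norm.
rewrite ge0_integralZl_EFin//.
- by rewrite integral_indic// setIT [X in (_ * X)%E]muC mule0.
- by apply/measurable_EFinP; exact: measurable_indic.
Qed.

Lemma current_to_hull (K : set 'rV[R]_3) (p : 'rV[R]_3) (T : functional R) : compact K ->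
  null_positive_current T -> (mass T < +oo)%E ->
  bounded_set (@re_part R @` current_supp T) ->
  (exists mu : probability (borelC3 R) R, mu (tube K) = 1%E /\ ddc_current_eq T mu p) ->
  minimal_hull K p.
Proof.
move=> cK [cT _ posT] mT bT [mu [muK eqT]] u pu.
rewrite leNgt; apply/negP => Kp.
have [M1 [M10 hM1]] := mass_bound cT mT.
have [M0 [M00 KM0 pM0]] := K_bounded p cK.
have [S [S1 SK Sp ST]] : exists S, [/\ 1 <= S, forall q, tube K q -> sqre q <= S,
    sqre (real_pt p) <= S & forall q, current_supp T q -> sqre q <= S].
  case: bT => C [_ hC].
  pose D := `|C| + 1.
  have hD q : current_supp T q -> `|re_part q| <= D.
    by move=> sq; apply: (hC D); [rewrite (le_lt_trans (ler_norm C))// ltrDl|exists q].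
  have D0 : 0 <= 3 * D ^+ 2 by rewrite mulr_ge0// sqr_ge0.
  exists (M0 + 1 + 3 * D ^+ 2); split.
  - by rewrite -addrA addrCA lerDl addr_ge0.
  - by move=> q /KM0 h; rewrite (le_trans h)// -addrA lerDl addr_ge0.
  - by rewrite (le_trans pM0)// -addrA lerDl addr_ge0.
  by move=> q /hD qD; rewrite ler_wpDl// ?addr_ge0// sqreE; exact: dotv_le_norm.
have S0 : 0 < S by exact: lt_le_trans S1.
pose B := 4 * S.
have reB q : sqre q <= 4 * S -> `|re_part q| <= B.
  have B0 : 0 <= B by rewrite mulr_ge0// ltW.
  move=> qS; apply: norm_le_dotv => //; rewrite -sqreE (le_trans qS)//.
  by rewrite expr2 /B ler_peMl// /B; lra.
have S4 : S <= 4 * S by lra.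
have KB x : K x -> `|x| <= B.
  move=> Kx; rewrite -(re_row_mx x 0); apply: reB; rewrite (le_trans _ S4)//.
  by apply: SK; rewrite /tube /= re_row_mx.
have pB : `|p| <= B by rewrite -(re_row_mx p 0); apply: reB; exact: le_trans Sp S4.
have [gam [gam0 hg]] := psh_smooth_approx pu cK KB pB Kp.
(* With the choice of [c] below, [eta * M1] and [C * c * M1] are each at most [gam / 4], so that
   [E * M1 < gam]. *)
pose eta := gam / (4 * (M1 + 1)).
have M11 : 0 < M1 + 1 by rewrite ltr_wpDl.
have eta0 : 0 < eta by rewrite divr_gt0// mulr_gt0.
have [g [sg dg lg gK gp]] := hg eta eta0.
have [C [C0 hC]] := cutoff_levi B sg dg.
pose c := Num.min 1 (gam / (4 * (C + 1) * (M1 + 1))).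
have C1 : 0 < C + 1 by rewrite ltr_wpDl.
have c0 : 0 < c by rewrite lt_min ltr01 divr_gt0// !mulr_gt0.
have c1 : c <= 1 by rewrite ge_min lexx.
have c01 : 0 <= c <= 1 by rewrite ltW.
pose E := eta + C * c.
have E0 : 0 <= E by apply: addr_ge0; [exact: ltW|rewrite mulr_ge0// ltW].
have EM : E * M1 < gam.
  have h1 : eta * (4 * (M1 + 1)) = gam by rewrite /eta divfK// gt_eqF// mulr_gt0.
  have h2 : c * (4 * (C + 1) * (M1 + 1)) <= gam.
    by rewrite -ler_pdivlMr ?ge_min ?lexx ?orbT// !mulr_gt0.
  have h3 : 0 <= c * M1 by rewrite mulr_ge0// ltW.
  have h4 : 0 <= eta * M1 by rewrite mulr_ge0// ltW.
  have h5 : 0 <= C * c by rewrite mulr_ge0// ltW.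
  have h6 : 0 <= C * c * M1 by rewrite mulr_ge0.
  by move: c0 gam0 eta0 => *; rewrite /E; nra.
pose psi (q : C3 R) := step (sqim (c *: q)).
have siZ q : sqim (c *: q) = c ^+ 2 * sqim q.
  by rewrite /sqim mulr_sumr; apply: eq_bigr => j _; rewrite !mxE; ring.
have c20 : 0 < c ^+ 2 by rewrite exprn_gt0.
have spsi : smooth psi.
  by apply: (@smooth_scale _ c (fun q => step (sqim q))); apply: smooth_step; exact: smooth_sqim.
pose cut (M : R) (q : C3 R) := step (M^-1 * sqre q).
have scut M : smooth (cut M) by apply: smooth_step; exact: smoothZ (@smooth_sqre R).
have cut1 M q : 0 < M -> sqre q <= M -> cut M q = 1.
  by move=> M_gt0 h; rewrite /cut step1// mulrC ler_pdivrMr// mul1r.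
have cut0 M q : 0 < M -> 2 * M <= sqre q -> cut M q = 0.
  by move=> M_gt0 h; rewrite /cut step0// mulrC ler_pdivlMr.
(* The cutoff at [8 S] only makes [phi] compactly supported: the form is tested after multiplication
   by [theta], which lives in [|x|^2 <= 4 S], where [phi] is locally [psi * g]. *)
pose phi q := cut (8 * S) q * (psi q * g q).
have sphi : smooth phi by exact: smoothM (scut _) (smoothM spsi sg).
have S8 : 0 < 8 * S by rewrite mulr_gt0.
have S2 : 0 < 2 * S by rewrite mulr_gt0.
have tphi : test_function phi.
  split => //.
  have cA := @compact_slab (2 * (8 * S)) (2 / c ^+ 2).
  have clA := compact_closed (@norm_hausdorff _ _) cA.
  apply: subclosed_compact cA _; first exact: closed_supp.
  apply: supp_subset_closed; first exact: clA.
  move=> q /not_andP[/negP|/negP]; rewrite -ltNge => h.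
    by rewrite /phi cut0 ?mul0r// ltW.
  rewrite /phi /psi siZ step0 ?mul0r ?mulr0//.
  by rewrite mulrC -ler_pdivrMr// ltW.
have talpha := test_form_ddc tphi.
pose theta := cut (2 * S).
have talpha' : test_form (fun q => theta q *: ddc phi q).
  exact: test_formM (scut (2 * S)) talpha.
(* The part removed is supported in [|x|^2 >= 2 S], away from the support of [T]. *)
have Tcut : T (ddc phi) = T (fun q => theta q *: ddc phi q).
  have s1 : smooth (fun q => 1 - theta q) by exact: smoothB (smooth_cst 1) (scut _).
  have t2 := test_formM s1 talpha.
  have e : ddc phi = fun q => theta q *: ddc phi q + (1 - theta q) *: ddc phi q.
    by apply/funext => q; rewrite -scalerDl addrC subrK scale1r.
  rewrite [in LHS]e currentD// (current_off_supp cT t2) ?addr0//.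
  move=> q sq /ST qS.
  have : [set q : C3 R | 2 * S <= sqre q] q.
    apply: (supp_subset_closed _ _ sq).
      have -> : [set q : C3 R | 2 * S <= sqre q] = @sqre R @^-1` [set x | 2 * S <= x] by [].
      apply: closed_comp; last exact: closed_ge.
      by move=> z _; apply: smooth_continuous; exact: smooth_sqre.
    move=> z /negP; rewrite -ltNge => h.
    by rewrite /theta cut1 ?subrr ?scale0r// ltW.
  by rewrite /= => /le_trans/(_ qS); rewrite leNgt ltr_pMl// ltr1n.
(* A wider cutoff in [y], equal to 1 wherever [psi] is nonzero, so that the Kaehler form is intact
   where it has to compensate and still has compact support. *)
pose psi2 (q : C3 R) := step (2^-1 * sqim (c *: q)).
have spsi2 : smooth psi2.
  have s : smooth (fun q => 2^-1 * sqim (c *: q)).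
    by apply: smoothZ; apply: smooth_scale; exact: smooth_sqim.
  exact: smooth_step s.
pose om q := (theta q * psi2 q) *: omega0 : 'M[R]_(3 + 3).
have tom : test_form om.
  split.
  - by move=> q; rewrite /om linearZ /= omega0_skew scalerN.
  - move=> j k; have := smoothM (smoothM (scut (2 * S)) spsi2) (smooth_cst (omega0 j k)).
    by congr smooth; apply/funext => q; rewrite /om [RHS]mxE.
  - have cA := @compact_slab (2 * (2 * S)) (4 / c ^+ 2).
    have clA := compact_closed (@norm_hausdorff _ _) cA.
    apply: subclosed_compact cA _; first exact: closed_supp.
    apply: supp_subset_closed; first exact: clA.
    move=> q /not_andP[/negP|/negP]; rewrite -ltNge => h.
      by rewrite /om /theta cut0 ?mul0r ?scale0r// ltW.
    rewrite /om /psi2 siZ step0 ?mulr0 ?scale0r//.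
    move: h; rewrite ltr_pdivrMr// => h; lra.
have Tom : T om <= M1.
  apply: hM1 => // q; apply: omega0_comass.
  by rewrite mulr_ge0 ?step_ge0//= mulr_ile1 ?step_ge0 ?step_le1.
have npos : null_positive_form (fun q => E *: om q + theta q *: ddc phi q).
  move=> q v nv; rewrite pairingD !pairingZ pairing_omega0 ddc_pairing//.
  have -> : dotv (Jmap v) (Jmap v) = sqre v + sqim v.
    by rewrite /dotv big_split_ord /= -/(sqre _) -/(sqim _) sqre_Jmap sqim_Jmap addrC.
  have n20 : 0 <= sqre v + sqim v by rewrite addr_ge0 ?re2_ge0 ?im2_ge0.
  have th0 : 0 <= theta q by exact: step_ge0.
  have -> : E * (theta q * psi2 q * (sqre v + sqim v)) + theta q * levi phi q v =
     theta q * (psi2 q * (E * (sqre v + sqim v)) + levi phi q v) by ring.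
  have [qS|Sq] := leP (2 * (2 * S)) (sqre q); first by rewrite /theta cut0// mul0r.
  rewrite mulr_ge0//.
  pose U1 := [set z : C3 R | sqre z < 8 * S].
  have oU1 : open U1.
    have -> : U1 = @sqre R @^-1` [set x | x < 8 * S] by [].
    apply: open_comp; last exact: open_lt.
    by move=> z _; apply: smooth_continuous; exact: smooth_sqre.
  have phi1 : forall z, U1 z -> phi z = psi z * g z.
    by move=> z /= h; rewrite /phi cut1 ?mul1r// ltW.
  have U1q : U1 q by rewrite /U1 /=; lra.
  (* In the first case [psi2 = 1] and [cutoff_levi] bounds the Levi form below by [- E * |v|^2]; in
     the second [phi] vanishes near [q]. *)
  have [q2|q2] := leP (c ^+ 2 * sqim q) 2.
    rewrite (levi_local v oU1 phi1 U1q) /psi2 siZ step1; last by lra.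
    rewrite mul1r addrC -lerBlDr sub0r.
    have qB : `|re_part q| <= B by apply: reB; lra.
    by apply: hC => //; [exact: ltW|exact: lg].
  pose U2 := [set z : C3 R | 2 < c ^+ 2 * sqim z].
  have oU2 : open U2.
    have -> : U2 = (fun z : C3 R => c ^+ 2 * sqim z) @^-1` [set x | 2 < x] by [].
    apply: open_comp; last exact: open_gt.
    by move=> z _; apply: smooth_continuous; apply: smoothZ; exact: smooth_sqim.
  have phi2 : forall z, U2 z -> phi z = cst 0 z.
    by move=> z /= h; rewrite /phi /psi siZ step0 ?mul0r ?mulr0// ltW.
  rewrite (levi_local v oU2 phi2 (q2 : U2 q)) /levi !hess_cst !addr0.
  by rewrite mulr_ge0 ?step_ge0// mulr_ge0.
have Tpos : 0 <= E * T om + T (ddc phi).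
  rewrite Tcut -(currentP cT)//; apply: posT => //.
  have tE : test_form (fun q => E *: om q) by exact: test_formM (smooth_cst E) tom.
  exact: test_formD.
have phi_p : phi (real_pt p) = g (real_pt p).
  rewrite /phi cut1//; last by rewrite (le_trans Sp)//; lra.
  have i0 : sqim (real_pt p) = 0.
    by rewrite sqimE /real_pt im_row_mx {1}/dotv big1// => j _; rewrite mxE mulr0.
  by rewrite mul1r /psi siZ i0 mulr0 step1// mul1r.
have phiK q : tube K q -> phi q <= 0.
  move=> Kq; rewrite /phi mulr_ge0_le0 ?step_ge0// mulr_ge0_le0 ?step_ge0//; exact: gK.
have [Cphi [_ hCphi]] := test_function_bounded tphi.
have phiM q : phi q <= Cphi by have := hCphi q; rewrite ler_norml => /andP[].
have := integral_le0_tube cK muK phiM phiK.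
have cphi := smooth_continuous sphi.
have := eqT phi tphi.
rewrite integral_dirac//; last by apply/measurable_EFinP; exact: continuous_borel.
rewrite diracT mul1e phi_p.
(* The integral of [phi] is at most 0, yet it equals [T (ddc phi) + g p], which is at least
   [gam - E * M1 > 0]. *)
move=> e; have : (\int[mu]_q (phi q)%:E)%E = (T (ddc phi) + g (real_pt p))%:E.
  by rewrite EFinD e subeK.
move=> ->; rewrite lee_fin => h.
have : E * T om <= E * M1 by rewrite ler_wpM2l.
by lra.
Qed.

End CurrentToHull.

Theorem theorem6p4 (R : realType) (K : set 'rV[R]_3) (hK : compact K)
    (p : 'rV[R]_3) :
  minimal_hull K p <->
  exists T : functional R,
    [/\ null_positive_current T,
        (mass T < +oo)%E,
        bounded_set (@re_part R @` current_supp T)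
      & exists mu : probability (borelC3 R) R,
          mu (tube K) = 1%E /\ ddc_current_eq T mu p].
Proof.
split; first exact: hull_to_current.
by move=> [T [nT mT bT eT]]; exact: current_to_hull eT.
Qed.
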